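(* Let $(X,\mu)$ be a differentiability space with atlas $\{(U_\alpha,\phi_\alpha)\}$, where $\phi_\alpha:X\to\mathbb R^{N_\alpha}$. For each $\alpha$ let $\{\mathrm{Cone}(v_{\alpha,k},\theta_{\alpha,k})\}_{k\in\mathbb N}$ be a collection of open cones with $\{v_{\alpha,k}\}_k$ dense in the unit sphere $\mathbb S^{N_\alpha-1}$ and $\lim_{k\to\infty}\theta_{\alpha,k}=0$, and let $\mathcal A_k=(P_k,\nu_k)$ be Alberti representations of $\mu$ such that for each $\alpha$ the restriction $\mathcal A_k\llcorner U_\alpha$ is in the $\phi_\alpha$-direction of $\mathrm{Cone}(v_{\alpha,k},\theta_{\alpha,k})$. Let $\Gamma_0\subset\mathrm{Frag}(X)$ be a Borel set such that $P_k(\mathrm{Frag}(X)\setminus\Gamma_0)=0$ for each $k$, and let $(\mathcal F,\mathcal C,\mathcal S,D_X)$ be a quadruple of data for genericity (as in the context). Then there is a $\mu$-measurable subset $Y\subset X$ of full $\mu$-measure such that for each $x\in Y$ the set of velocity vectors $$G_x=\{v\in T_xX: v=\gamma'(t)\text{ for some }\gamma\in\Gamma_0\text{ such that }\gamma'(t)\text{ is }(\mathcal F,\mathcal C,\mathcal S,D_X)\text{-generic}\}$$ contains a dense set of directions in $T_xX$, i.e. $\overline{\{sw:s\in[0,\infty),w\in G_x\}}=T_xX$.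
   Context: Differentiability spaces. $X$ is a complete separable metric space with metric $d_X$, and $\mu$ is a Radon measure on $X$. For a Lipschitz $f:X\to\mathbb R$, $\operatorname{Lip}f(x)=\limsup_{r\searrow0}\sup\{|f(y)-f(x)|/r:d_X(x,y)\le r\}$. Finitely many Lipschitz functions are dependent at $x$ if some nontrivial linear combination $v$ of them satisfies $\operatorname{Lip}v(x)=0$; otherwise they are independent at $x$. An $n$-dimensional chart ($n\ge1$) is a pair $(U,\phi)$ with $U\subset X$ Borel, $\mu(U)>0$, $\phi:X\to\mathbb R^n$ Lipschitz, such that its components are independent at $\mu$-a.e. $x\in U$, and for every Lipschitz $f:X\to\mathbb R$ the tuple $(\phi^1,\dots,\phi^n,f)$ is dependent at $\mu$-a.e. $x\in U$. $(X,\mu)$ is a differentiability space if there is a countable collection (atlas) of charts $\{(U_\alpha,\phi_\alpha)\}$ with $\mu(X\setminus\bigcup_\alpha U_\alpha)=0$, chosen so that at each point of $U_\alpha\cap U_\beta$ the components of $\phi_\alpha$ are differentiable (have a first order Taylor expansion) with respect to $\phi_\beta$. $T^*X$ is the measurable bundle whose fibre over $x\in U_\alpha$ has basis $d\phi_\alpha^i(x)$, and $TX$ is its dual. Alberti representations. A fragment in $X$ is a Lipschitz map $\gamma:\operatorname{Dom}\gamma\to X$ with $\operatorname{Dom}\gamma\subset\mathbb R$ closed (nonempty). $\operatorname{Frag}(X)$ is identified, via graphs, with a subset of the nonempty closed subsets of $\mathbb R\times X$ with the Fell topology. An Alberti representation of $\mu$ is a pair $(P,\nu)$ where $P$ is a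 Radon measure on $\operatorname{Frag}(X)$; $\gamma\mapsto\nu_\gamma$ is a Borel map to nonnegative Radon measures on $X$ (i.e. $\gamma\mapsto\int g\,d\nu_\gamma$ is Borel for each $g\in C_c(X)$) with $\nu_\gamma\ll\mathscr H^1_\gamma$, the $1$-dimensional Hausdorff measure on the image of $\gamma$; $\mu=\int\nu_\gamma\,dP(\gamma)$; and for Borel $A\subset X$, $b\ge a$, the map $\gamma\mapsto\nu_\gamma(A\cap\gamma(\operatorname{Dom}\gamma\cap[a,b]))$ is Borel. Its restriction to a Borel set $U$ is $(P,\nu\llcorner U)$. For $v\in\mathbb S^{n-1}$, $\theta\in(0,\pi/2)$, $\mathrm{Cone}(v,\theta)=\{u\in\mathbb R^n:\tan\theta\,\langle v,u\rangle>\|\pi_v^\perp u\|_2\}$ with $\pi_v^\perp$ the orthogonal projection onto $v^\perp$. The restriction $(P,\nu\llcorner U)$ is in the $f$-direction of $\mathrm{Cone}(v,\theta)$ ($f:X\to\mathbb R^n$ Lipschitz) if for $P$-a.e. $\gamma$ and $\mathcal L^1$-a.e. $t\in\gamma^{-1}(U)$ one has $(f\circ\gamma)'(t)\in\mathrm{Cone}(v,\theta)$. Genericity. $\mathcal F$ is a countable collection of real Lipschitz functions on $X$ containing all components of all $\phi_\alpha$; $\mathcal C$ is a countable collection of bounded real Borel functions containing all $\chi_{U_\alpha}$; $D_X\subset X$ is countable dense; $\mathcal S$ is a countable collection of pseudometrics $\varrho$ on $X$ with $\varrho\le C_\varrho d_X$, including $d_X$. With $\varrho_x=\varrho(\cdot,x)$,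 a pair $(\gamma,t)$, $\gamma\in\operatorname{Frag}(X)$, $t\in\operatorname{Dom}\gamma$, is $(\mathcal F,\mathcal C,\mathcal S,D_X)$-generic if: $t$ is a Lebesgue density point of $\operatorname{Dom}\gamma$; for each $f\in\mathcal F$, $(f\circ\gamma)'$ exists and is approximately continuous at $t$; for each $u\in\mathcal C$, $u\circ\gamma$ is approximately continuous at $t$; for each $x\in D_X$, $\varrho\in\mathcal S$, $(\varrho_x\circ\gamma)'$ exists and is approximately continuous at $t$; and for each $\varrho\in\mathcal S$ the function $\sup_{x\in D_X}|(\varrho_x\circ\gamma)'|$ is approximately continuous at $t$. A generic velocity vector is $\gamma'(t)\in T_{\gamma(t)}X$, determined by $d\phi_\alpha^i(\gamma'(t))=(\phi_\alpha^i\circ\gamma)'(t)$ when $\gamma(t)\in U_\alpha$, where $(\gamma,t)$ is generic and $\gamma(t)\in\bigcup_\alpha U_\alpha$. *)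

(* Defs.v *)
From HB Require Import structures.
From mathcomp Require Import all_boot all_order all_algebra.
From mathcomp Require Import all_classical all_reals all_analysis.
From mathcomp Require Import measurable_realfun.

Set Implicit Arguments.
Unset Strict Implicit.
Unset Printing Implicit Defensive.
Import Order.TTheory GRing.Theory Num.Theory.
Import numFieldNormedType.Exports.

Local Open Scope classical_set_scope.
Local Open Scope ring_scope.

#[short(type="completeMetricType")]
HB.structure Definition CompleteMetric (K : numDomainType) :=
  { T of Complete T & Metric K T }.

Definition separable (T : topologicalType) :=
  exists2 D : set T, countable D & dense D.

Definition borel (T : ptopologicalType) := g_sigma_algebraType (@open T).

(* Locally finite and inner regular with respect to compact sets. The Fell
   topology need not be Hausdorff when X is not locally compact, so the compact
   sets have to be assumed Borel. *)
Definition radon (R : realType) (T : ptopologicalType)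
    (mu : set (borel T) -> \bar R) :=
  (forall x : T, exists V : set T, [/\ open V, V x & (mu V < +oo)%E]) /\
  (forall A : set (borel T), measurable A ->
    mu A = ereal_sup [set mu K | K in
      [set K : set (borel T) |
        [/\ compact (K : set T), measurable K & K `<=` A]]]).

Section euclidean.
Context {R : realType} {n : nat}.
Implicit Types u v : 'rV[R]_n.

Definition dot u v : R := \sum_(i < n) u 0 i * v 0 i.

Definition norm2 u : R := Num.sqrt (dot u u).

Definition sphere : set 'rV[R]_n := [set u | norm2 u = 1].

(* For v of norm 1, u - <v,u> v is the projection of u onto the orthogonal
   complement of v. *)
Definition cone v (theta : R) : set 'rV[R]_n :=
  [set u | norm2 (u - dot v u *: v) < tan theta * dot v u].

End euclidean.

Section lipschitz_functions.
Context {R : realType} {X : metricType R}.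

Definition lipschitz_fun (f : X -> R) :=
  exists L : R, forall x y, `|f x - f y| <= L * mdist x y.

Definition lipschitz_map n (phi : X -> 'rV[R]_n) :=
  exists L : R, forall x y, norm2 (phi x - phi y) <= L * mdist x y.

Definition Lip (f : X -> R) (x : X) : \bar R :=
  limf_esup (fun r : R =>
    ereal_sup [set (`|f y - f x| / r)%:E | y in [set y | mdist x y <= r]])
  (0 : R)^'+.

Definition dependent_at n (phi : X -> 'rV[R]_n) (x : X) :=
  exists a : 'rV[R]_n, a != 0 /\ Lip (fun y => dot a (phi y)) x = 0%E.

Definition differentiable_wrt n (phi : X -> 'rV[R]_n) (f : X -> R) (x : X) :=
  exists a : 'rV[R]_n, forall e : R, 0 < e -> \forall y \near x,
    `|f y - f x - dot a (phi y - phi x)| <= e * mdist x y.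

Definition pseudometric (rho : X -> X -> R) :=
  [/\ forall x y, 0 <= rho x y, forall x, rho x x = 0,
      forall x y, rho x y = rho y x &
      forall x y z, rho x z <= rho x y + rho y z].

End lipschitz_functions.

Section hausdorff.
Context {R : realType} {X : metricType R}.
Local Open Scope ereal_scope.

Definition diam (E : set X) : \bar R :=
  ereal_sup (0 |` [set (mdist x y)%:E | x in E & y in E]).

Definition hausdorff1_pre (delta : R) (A : set X) : \bar R :=
  ereal_inf [set \sum_(0 <= k <oo) diam (E k) | E in
    [set E : (set X)^nat | A `<=` \bigcup_k E k /\
                           forall k, diam (E k) <= delta%:E]].

Definition hausdorff1 (A : set X) : \bar R :=
  ereal_sup [set hausdorff1_pre delta A | delta in [set d : R | (0 < d)%R]].

End hausdorff.

Section charts.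
Context {R : realType} {X : completeMetricType R}.
Variable mu : {measure set (borel X) -> \bar R}.

Definition chart n (U : set X) (phi : X -> 'rV[R]_n) :=
  [/\ (0 < n)%N, measurable (U : set (borel X)) /\ (0 < mu U)%E,
      lipschitz_map phi,
      {ae mu, forall x, U x -> ~ dependent_at phi x} &
      forall f : X -> R, lipschitz_fun f ->
        {ae mu, forall x, U x ->
          dependent_at (fun y => row_mx (phi y) (const_mx (f y) : 'rV_1)) x}].

Context {I : countType} {N : I -> nat}.
Variables (U : I -> set X) (phi : forall a : I, X -> 'rV[R]_(N a)).

Definition atlas :=
  [/\ forall a, chart (U a) (phi a),
      mu (~` \bigcup_a U a) = 0%E &
      forall a b x, U a x -> U b x ->
        forall i, differentiable_wrt (phi b) (fun y => phi a y 0 i) x].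

(* The fibre of T*X over x is diff_at x modulo the functions f with
   Lip f x = 0, df(x) being the class of f. By the Taylor expansions it is
   spanned by the d(phi_a)^i(x) for any a with x in U_a, and these form a basis
   as soon as the components of phi_a are independent at x. *)
Definition diff_at (x : X) : set (X -> R) :=
  [set f | lipschitz_fun f /\
           exists a, U a x /\ differentiable_wrt (phi a) f x].

(* The dual of that diff_quotient: linear forms on diff_at x which vanish on the
   functions f with Lip f x = 0, extended by 0 outside diff_at x so that each
   form has a unique representative. On this finite-dimensional space the
   topology of pointwise convergence is the vector space topology. *)
Definition tangent (x : X) : set {ptws (X -> R) -> R} :=
  [set w | [/\ forall f, ~ diff_at x f -> w f = 0,
      forall (c : R) f g, diff_at x f -> diff_at x g ->
        w (fun y => c * f y + g y) = c * w f + w g &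
      forall f, diff_at x f -> Lip f x = 0%E -> w f = 0]].

End charts.

Section fell.
Context (T : topologicalType).

Record hyperspace := Hyperspace {
  hyperspace_set :> set T;
  hyperspace_closed : closed hyperspace_set;
  hyperspace_nonempty : hyperspace_set !=set0 }.

HB.instance Definition _ := gen_eqMixin hyperspace.
HB.instance Definition _ := gen_choiceMixin hyperspace.

Definition fell_subbase : set (set hyperspace) :=
  [set [set G : hyperspace | G `&` V !=set0] | V in @open T] `|`
  [set [set G : hyperspace | G `&` K = set0] | K in @compact T].

HB.instance Definition _ :=
  isSubBaseTopological.Build hyperspace fell_subbase id.

End fell.

Section fragments.
Context {R : realType} (X : completeMetricType R).

(* A fragment is identified with its graph. *)
Record frag := Frag {
  graph :> hyperspace (R * X)%type;
  graph_lipschitz : exists L : R, forall p q : R * X,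
    hyperspace_set graph p -> hyperspace_set graph q ->
    mdist p.2 q.2 <= L * `|p.1 - q.1|;
  graph_dom_closed : closed [set t : R | exists x, hyperspace_set graph (t, x)] }.

HB.instance Definition _ := gen_eqMixin frag.
HB.instance Definition _ := gen_choiceMixin frag.
HB.instance Definition _ := Topological.copy frag (initial_topology graph).

Definition point_graph : set (R * X)%type := [set (0, point)].

Lemma point_graph_closed : closed point_graph.
Proof.
rewrite (_ : point_graph = fst @^-1` [set (0 : R)] `&` snd @^-1` [set (point : X)]).
  apply: closedI.
    apply: closed_comp; first by move=> ? _; exact: cvg_fst.
    exact/accessible_closed_set1/hausdorff_accessible/Rhausdorff.
  apply: closed_comp; first by move=> ? _; exact: cvg_snd.
  exact/accessible_closed_set1/hausdorff_accessible/metric_hausdorff.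
by apply/seteqP; split=> [[t x] [-> ->]|[t x] [/= -> ->]].
Qed.

Lemma point_graph_nonempty : point_graph !=set0.
Proof. by exists (0, point). Qed.

Definition point_hyperspace :=
  Hyperspace point_graph_closed point_graph_nonempty.

Lemma point_graph_lipschitz : exists L : R, forall p q : R * X,
  hyperspace_set point_hyperspace p -> hyperspace_set point_hyperspace q ->
  mdist p.2 q.2 <= L * `|p.1 - q.1|.
Proof. by exists 0 => _ _ -> ->; rewrite mdistxx mul0r. Qed.

Lemma point_graph_dom_closed :
  closed [set t : R | exists x, hyperspace_set point_hyperspace (t, x)].
Proof.
rewrite (_ : [set _ | _] = [set 0]).
  exact/accessible_closed_set1/hausdorff_accessible/Rhausdorff.
by apply/seteqP; split=> t /= => [[x [->]]//|->]; exists point.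
Qed.

HB.instance Definition _ := isPointed.Build frag
  (Frag point_graph_lipschitz point_graph_dom_closed).

Definition dom (gamma : frag) : set R :=
  [set t | exists x, hyperspace_set gamma (t, x)].

(* Only meaningful on dom gamma, where the second component is unique. *)
Definition fpoint (gamma : frag) (t : R) : X :=
  xget point [set x | hyperspace_set gamma (t, x)].

End fragments.

Section real_line.
Context {R : realType}.
Local Notation leb := (@lebesgue_measure R).

Definition diff_quotient (h : R -> R) (t s : R) : R := (h s - h t) / (s - t).

Definition derivable_in (D : set R) (h : R -> R) (t : R) :=
  [/\ D t, limit_point D t & cvg (diff_quotient h t s @[s --> within D t^'])].

Definition derive_in (D : set R) (h : R -> R) (t : R) : R :=
  lim (diff_quotient h t s @[s --> within D t^']).

Definition density_point (A : set R) (t : R) :=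
  (leb (A `&` ball t r) * (leb (ball t r))^-1)%E @[r --> 0^'+] --> 1%E.

(* Here E is the set on which g is defined. *)
Definition ap_continuous (E : set R) (g : R -> R) (t : R) :=
  E t /\ forall e : R, 0 < e ->
    density_point (E `&` [set s | `|g s - g t| < e]) t.

End real_line.

Section alberti.
Context {R : realType} {X : completeMetricType R}.
Local Notation frag := (frag X).

Definition fderivable (gamma : frag) (f : X -> R) (t : R) :=
  derivable_in (dom gamma) (f \o fpoint gamma) t.

Definition fderive (gamma : frag) (f : X -> R) (t : R) : R :=
  derive_in (dom gamma) (f \o fpoint gamma) t.

Definition compactly_supported (g : X -> R) :=
  compact (closure [set x | g x != 0]).

Definition alberti (mu : {measure set (borel X) -> \bar R})
    (P : {measure set (borel frag) -> \bar R})
    (nu : frag -> {measure set (borel X) -> \bar R}) :=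
  [/\ radon P,
      (forall gamma, radon (nu gamma)) /\
      (forall g : X -> R, continuous g -> compactly_supported g ->
        measurable_fun [set: borel frag]
          (fun gamma => (\int[nu gamma]_x (g x)%:E)%E)),
      (forall gamma, nu gamma `<<
        (fun A : set (borel X) =>
           hausdorff1 (A `&` (fpoint gamma @` dom gamma)))),
      (forall A : set (borel X), measurable A ->
        mu A = (\int[P]_gamma nu gamma A)%E) &
      (forall (A : set (borel X)) (a b : R), measurable A -> a <= b ->
        measurable_fun [set: borel frag] (fun gamma =>
          nu gamma (A `&` (fpoint gamma @` (dom gamma `&` `[a, b])))))].

Definition in_direction (P : {measure set (borel frag) -> \bar R})
    (U : set X) n (phi : X -> 'rV[R]_n) (C : set 'rV[R]_n) :=
  {ae P, forall gamma, {ae (@lebesgue_measure R), forall t,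
    dom gamma t -> U (fpoint gamma t) ->
    (forall i, fderivable gamma (fun x => phi x 0 i) t) /\
    C (\row_i fderive gamma (fun x => phi x 0 i) t)}}.

End alberti.

Section genericity.
Context {R : realType} {X : completeMetricType R}.
Variables (F C : set (X -> R)) (S : set (X -> X -> R)) (D : set X).

Definition generic_data (I : countType) (N : I -> nat) (U : I -> set X)
    (phi : forall a : I, X -> 'rV[R]_(N a)) :=
  [/\ countable F /\ (forall f, F f -> lipschitz_fun f) /\
      (forall a i, F (fun x => phi a x 0 i)),
      countable C /\
      (forall u, C u -> measurable_fun [set: borel X] u /\
        exists M : R, forall x, `|u x| <= M) /\
      (forall a, C \1_(U a)),
      countable S /\
      (forall rho, S rho -> pseudometric rho /\
        exists K : R, forall x y, rho x y <= K * mdist x y) /\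
      S mdist &
      countable D /\ dense D].

Definition generic (gamma : frag X) (t : R) :=
  [/\ dom gamma t /\ density_point (dom gamma) t,
      forall f, F f -> ap_continuous (fderivable gamma f) (fderive gamma f) t,
      forall u, C u -> ap_continuous (dom gamma) (u \o fpoint gamma) t,
      forall x rho, D x -> S rho ->
        ap_continuous (fderivable gamma (rho^~ x)) (fderive gamma (rho^~ x)) t &
      forall rho, S rho ->
        ap_continuous
          [set s | forall x, D x -> fderivable gamma (rho^~ x) s]
          (fun s => sup [set `|fderive gamma (rho^~ x) s| | x in D]) t].

Context {I : countType} {N : I -> nat}.
Variables (U : I -> set X) (phi : forall a : I, X -> 'rV[R]_(N a)).

Definition is_velocity (gamma : frag X) (t : R)
    (w : {ptws (X -> R) -> R}) :=
  tangent U phi (fpoint gamma t) w /\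
  forall a, U a (fpoint gamma t) ->
    forall i, w (fun x => phi a x 0 i) = fderive gamma (fun x => phi a x 0 i) t.

Definition generic_velocities (Gamma0 : set (frag X)) (x : X)
    : set {ptws (X -> R) -> R} :=
  [set w | exists gamma t, [/\ Gamma0 gamma, generic gamma t,
    fpoint gamma t = x, (\bigcup_a U a) x & is_velocity gamma t w]].

End genericity.

Definition rays (R : realType) (T : Type) (G : set {ptws T -> R})
    : set {ptws T -> R} :=
  [set w | exists s : R, 0 <= s /\ exists2 v, G v & w = (fun f => s * v f)].

(* Main.v *)
(* For each k, let Q_k be the set of pairs (gamma, t) which are generic, with
   gamma in Gamma0 and with chart derivatives in the k-th cones. It contains a
   Borel set which, for P_k-almost every gamma, omits only a null set of t in
   Dom gamma (Lebesgue's density theorem and Rademacher's theorem on the line).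
   As nu_gamma << H^1 and Lipschitz maps preserve null sets, nu_gamma-almost
   every point of X is gamma(t) with (gamma, t) in Q_k, so the points of this
   form should fill mu-almost all of X.

   That they contain a Borel set of full measure is a projection theorem, for
   which no theory of analytic sets is needed: a fragment is determined by the
   set of basic boxes met by its graph, which identifies Frag(X) with a Borel
   subset of the Cantor space; finite measures on the product of the Cantor
   space with X are inner regular with respect to closed sets; and closed sets
   of this product project to closed sets, the Cantor space being compact.

   At a point that is good for all k, the velocities meet every cone. The axes
   of the cones are dense and their apertures tend to 0, so the rays through the
   velocities are dense in the tangent space. *)
Require Import Defs.
From HB Require Import structures.
From mathcomp Require Import all_boot all_order all_algebra.
From mathcomp Require Import all_classical all_reals all_analysis.
From mathcomp Require Import measurable_realfun.
From mathcomp Require Import lra ring.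

Set Implicit Arguments.
Unset Strict Implicit.
Unset Printing Implicit Defensive.

Import Order.TTheory GRing.Theory Num.Theory.
Import numFieldNormedType.Exports.
Local Open Scope classical_set_scope.
Local Open Scope ring_scope.

(** * Preliminaries on measurability *)

(** When [X] is not locally compact, [frag X] with the Fell topology need not be Hausdorff, so the
    theory of Polish spaces does not apply to it directly. It enters only through countably many
    bits, one for each box. The codes of fragments are exactly the coherent ones and form a Borel
    set, so a point found on the side of the codes lifts back to a fragment. In return, what is said
    about fragments, derivatives included, has to be reduced to countably many conditions that a
    graph meets an open set. A Borel set of pairs (gamma, t) does not directly give one of pairs
    (gamma, x), since a fragment may pass through x at many times; a measurable choice of a passage
    time mediates between the two. The finite measures on pairs to which inner regularity is applied
    are obtained by integrating against P_k the restrictions of the nu_k to sets of finite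
    mu-measure. *)

Section measurable_sets.
Context {dT} {T : measurableType dT}.
Implicit Types A B : set T.

Lemma measurable_exists (I : countType) (P : I -> set T) :
  (forall i, measurable (P i)) -> measurable [set z | exists i, P i z].
Proof.
move=> mP; rewrite (_ : [set _ | _] = \bigcup_i P i).
  exact: countable_bigcupT_measurable.
by apply/seteqP; split=> z [i]; [exists i|exists i].
Qed.

Lemma measurable_forall (I : countType) (P : I -> set T) :
  (forall i, measurable (P i)) -> measurable [set z | forall i, P i z].
Proof.
move=> mP; rewrite (_ : [set _ | _] = ~` [set z | exists i, (~` P i) z]).
  by apply/measurableC/measurable_exists => i; exact: measurableC.
apply/seteqP; split=> z; first by move=> H [i]; apply.
by move=> /= H i; apply: contrapT => nP; apply: H; exists i.
Qed.

Lemma measurable_impl A B :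
  measurable A -> measurable B -> measurable [set z | A z -> B z].
Proof.
move=> mA mB; rewrite (_ : [set _ | _] = ~` A `|` B).
  by apply: measurableU => //; exact: measurableC.
apply/seteqP; split=> z /=; last by move=> [].
by move=> AB; have [/AB|] := pselect (A z); [right|left].
Qed.

Lemma measurable_Prop (Q : Prop) : measurable [set z : T | Q].
Proof.
have [q|nq] := pselect Q.
  by rewrite (_ : [set _ | _] = setT)//; apply/seteqP; split.
by rewrite (_ : [set _ | _] = set0)//; apply/seteqP; split.
Qed.

Lemma measurable_implP (Q : Prop) A : (Q -> measurable A) ->
  measurable [set z : T | Q -> A z].
Proof.
move=> QA; have [q|nq] := pselect Q.
  rewrite (_ : [set _ | _] = A); first exact: QA.
  by apply/seteqP; split=> z /=; [apply|].
by rewrite (_ : [set _ | _] = setT)//; apply/seteqP; split=> z //= _ /nq.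
Qed.

Lemma measurable_andP (Q : Prop) A : (Q -> measurable A) ->
  measurable [set z : T | Q /\ A z].
Proof.
move=> QA; have [q|nq] := pselect Q.
  rewrite (_ : [set _ | _] = A); first exact: QA.
  by apply/seteqP; split=> z /=; [case|].
by rewrite (_ : [set _ | _] = set0)//; apply/seteqP; split=> z //= [].
Qed.

End measurable_sets.

Section measurable_projections.
Context {d1 d2} {T1 : measurableType d1} {T2 : measurableType d2}.

Lemma measurable_preimage_fst (A : set T1) : measurable A ->
  measurable [set z : T1 * T2 | A z.1].
Proof.
by move=> mA; rewrite -[X in measurable X]setTI; exact: measurable_fst.
Qed.

Lemma measurable_preimage_snd (A : set T2) : measurable A ->
  measurable [set z : T1 * T2 | A z.2].
Proof.
by move=> mA; rewrite -[X in measurable X]setTI; exact: measurable_snd.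
Qed.

End measurable_projections.

Section borel_sets.
Context {T : ptopologicalType}.

Lemma open_borel (A : set T) : open A -> measurable (A : set (borel T)).
Proof. exact: sub_sigma_algebra. Qed.

Lemma closed_borel (A : set T) : closed A -> measurable (A : set (borel T)).
Proof.
move=> cA; rewrite -(setCK A); apply: measurableC.
by apply: open_borel; exact: closed_openC.
Qed.

End borel_sets.

Lemma ae_forall_countable (R : realType) (d : measure_display) (T : measurableType d)
    (m : {measure set T -> \bar R}) (I : countType) (Pr : I -> T -> Prop) :
  (forall i, {ae m, forall x, Pr i x}) -> {ae m, forall x, forall i, Pr i x}.
Proof.
move=> H.
have : m.-negligible (\bigcup_n (if unpickle n is Some i then ~` [set x | Pr i x] else set0)).
  apply: negligible_bigcup => n; case: unpickle => [i|]; last exact: negligible_set0.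
  exact: H.
apply: negligibleS => x /= /existsNP[i nP].
by exists (pickle i) => //; rewrite pickleK.
Qed.

(** * Rademacher's theorem for subsets of the line *)

Section rademacher.
Context {R : realType}.
Local Notation leb := (@lebesgue_measure R).

(* The Stieltjes measures of H and of x - H x add up to Lebesgue measure. *)
Lemma dominates_stieltjes (H : cumulative R R) :
  (forall x y, x <= y -> H y - H x <= y - x) ->
  lebesgue_stieltjes_measure H `<< leb.
Proof.
move=> H1.
have nd : {homo (fun x => x - H x) : x y / x <= y}.
  by move=> x y /H1; lra.
have cH : right_continuous H := cumulative_is_right_continuous H.
have rc : right_continuous (fun x => x - H x).
  move=> x; apply: cvgB; last exact: cH.
  exact: (cumulative_is_right_continuous (idfun : cumulative R R)).
pose K : cumulative R R := HB.pack (fun x => x - H x)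
  (isCumulative.Build R _ R (fun x => x - H x) nd rc).
apply/null_content_dominatesP => A mA.
move=> A0; pose m := measure_add (lebesgue_stieltjes_measure H)
  (lebesgue_stieltjes_measure K).
have mE X : m X = (lebesgue_stieltjes_measure H X + lebesgue_stieltjes_measure K X)%E.
  exact: measure_addE.
suff : forall X, ocitv X -> leb X = m X.
  move=> /lebesgue_measure_unique/(_ A mA) h.
  have : (lebesgue_stieltjes_measure H A + lebesgue_stieltjes_measure K A = 0)%E.
    by rewrite -mE -A0; exact/esym.
  by move=> /eqP; rewrite padde_eq0 ?measure_ge0// => /andP[/eqP].
move=> X oX; rewrite [RHS]mE.
have E (f : cumulative R R) : lebesgue_stieltjes_measure f X = wlength f X.
  rewrite /lebesgue_stieltjes_measure /measure_extension measurable_mu_extE//.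
rewrite /lebesgue_measure !E.
move: oX => /ocitvP[->|[[a b]/= ab ->]]; first by rewrite !wlength0 adde0.
rewrite !wlength_itv_bnd ?ltW// -EFinD/=; congr EFin; lra.
Qed.

(** On []-n, n]] the Stieltjes measure of [H] is finite and dominated by Lebesgue measure, so it has
    a Radon-Nikodym density. There [H] is, up to a constant, the indefinite integral of this
    density, which is differentiable almost everywhere. *)
Lemma ae_derivable_cumulative (H : cumulative R R) :
  (forall x y, x <= y -> H y - H x <= y - x) ->
  {ae leb, forall x, derivable H x 1}.
Proof.
move=> H1.
suff Hn (n : nat) : {ae leb, forall x, - n%:R < x < n%:R -> derivable H x 1}.
  have /ae_foralln : forall n : nat, {ae leb, forall x, - n%:R < x < n%:R -> derivable H x 1} by [].
  apply: filterS => x /(_ (Num.bound `|x|)); apply.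
  by rewrite -ltr_norml; apply: archi_boundP.
pose A : set R := `]- n%:R, n%:R]%classic.
pose nu := lebesgue_stieltjes_measure H.
have nnn : - n%:R <= n%:R :> R by rewrite lerNl (le_trans (y := 0))// ?oppr_le0.
have nuE (a b : R) : a <= b -> nu `]a, b]%classic = (H b - H a)%:E.
  move=> ab; rewrite /nu /lebesgue_stieltjes_measure /measure_extension.
  have mab : R.-ocitv.-measurable `]a, b]%classic by exact: is_ocitv.
  by rewrite (measurable_mu_extE _ mab); exact: wlength_itv_bnd.
have mA : measurable (A : set (measurableTypeR R)) by exact: measurable_itv.
have nuA : (nu A < +oo)%E by rewrite nuE// ltry.
pose m : {finite_measure set (measurableTypeR R) -> \bar R} :=
  mfrestr (f := lebesgue_stieltjes_measure H) mA nuA.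
have mleb : m `<< leb.
  apply/null_content_dominatesP => B mB B0; rewrite /m/= /mfrestr /mrestr.
  apply/(null_content_dominatesP _ _).1; [exact: dominates_stieltjes|exact: measurableI|].
  apply/eqP; rewrite -measure_le0 -B0; apply: le_measure; rewrite ?inE//.
  exact: measurableI.
pose g := Radon_Nikodym_SigmaFinite.f m leb.
have g0 x : (0 <= g x)%E by exact: Radon_Nikodym_SigmaFinite.f_ge0.
have gfin x : g x \is a fin_num by exact: Radon_Nikodym_SigmaFinite.f_fin_num.
have gi : leb.-integrable setT g by exact: Radon_Nikodym_SigmaFinite.f_integrable.
have gE B : measurable B -> m B = (\int[leb]_(x in B) g x)%E.
  exact: Radon_Nikodym_SigmaFinite.f_integral.
pose h : R -> R := fun x => fine (g x).
have gEf : EFin \o h = g by apply/funext => x /=; rewrite fineK.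
have hi : lebesgue_measure.-integrable [set: R] (EFin \o h).
  by rewrite gEf; exact: gi.
have li : locally_integrable [set: R] h := open_integrable_locally openT hi.
have hi' y : lebesgue_measure.-integrable [set` Interval (BRight (- n%:R)) (BRight y)] (EFin \o h).
  by apply: (integrableS measurableT) hi => //; exact: measurable_itv.
have := FTC1 hi' li.
apply: filterS; first exact: (ae_filter_ringOfSetsType leb).
move=> x + /andP[nx xn].
move=> /(_ _)[]; first by rewrite lte_fin.
move=> + _.
have -> : derivable H x 1 = derivable (H \- cst (H (- n%:R))) x 1.
  apply/propext; split=> dh; first exact: derivableB.
  by rewrite (_ : (H : R -> R) = (H \- cst (H (- n%:R))) \+ cst (H (- n%:R)));
    [exact: derivableD|apply/funext => y /=; lra].
apply: near_eq_derivable.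
near=> y.
have : y \in `]- n%:R, n%:R[.
  by near: y; apply: near_in_itvoo; rewrite in_itv/= nx xn.
rewrite in_itv/= => /andP[ny yn].
rewrite /Rintegral.
have sub : `]- n%:R, y] `<=` A.
  by apply: subset_itv; rewrite bnd_simp// ltW.
rewrite (_ : (\int[leb]_(t in _) _)%E = m `]- n%:R, y]%classic).
  have -> : m `]- n%:R, y]%classic = (H y - H (- n%:R))%:E.
    by rewrite /m/= /mfrestr /mrestr setIidl//; apply: nuE; exact: ltW.
  by [].
by rewrite gE; [apply: eq_integral => z _ /=; rewrite fineK|exact: measurable_itv].
Unshelve. all: by end_near. Qed.

(** Adding a multiple of the identity makes [h] nondecreasing: the slopes of [h + M id] lie between
    0 and [2 * M], and dividing by [2 * M] bounds them by 1. *)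
Lemma ae_derivable_lipschitz (h : R -> R) (L : R) :
  (forall x y, `|h x - h y| <= L * `|x - y|) ->
  {ae leb, forall x, derivable h x 1}.
Proof.
move=> hL; pose M := Num.max L 1.
have M0 : 0 < M by rewrite lt_max ltr01 orbT.
have hM x y : `|h x - h y| <= M * `|x - y|.
  by apply: (le_trans (hL x y)); rewrite ler_wpM2r// le_max lexx.
pose H x := (2 * M)^-1 * (h x + M * x).
have M2 : 0 < 2 * M by lra.
have nd : {homo H : x y / x <= y}.
  move=> x y xy; rewrite /H ler_pM2l ?invr_gt0//.
  have := hM x y; rewrite (distrC x) [`|y - x|]ger0_norm ?subr_ge0// ler_norml.
  by move=> /andP[]; lra.
have H1 x y : x <= y -> H y - H x <= y - x.
  move=> xy; rewrite /H -mulrBr mulrC ler_pdivrMr//.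
  have := hM x y; rewrite (distrC x) [`|y - x|]ger0_norm ?subr_ge0// ler_norml.
  by move=> /andP[]; lra.
have rc : right_continuous H.
  apply: right_continuousW => x.
  apply/cvgrPdist_le => e e0; near=> y.
  have -> : H x - H y = (2 * M)^-1 * (h x - h y + M * (x - y)) by rewrite /H; lra.
  rewrite normrM gtr0_norm ?invr_gt0// mulrC ler_pdivrMr//.
  rewrite (le_trans (ler_normD _ _))// normrM (gtr0_norm M0).
  have := hM x y.
  have : `|x - y| <= e by near: y; exact: cvgr_dist_le.
  move=> xye; have : M * `|x - y| <= M * e by rewrite ler_pM2l.
  by lra.
pose K : cumulative R R := HB.pack H (isCumulative.Build R _ R H nd rc).
have := @ae_derivable_cumulative K H1.
apply: filterS; first exact: (ae_filter_ringOfSetsType leb).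
move=> x dx.
have -> : h = (2 * M) \*: (K : R -> R) \- M \*: id.
  have hE z : h z = (2 * M) * H z - M * z.
    by rewrite /H mulrA divff ?mul1r ?gt_eqF//; lra.
  by apply/funext => y; exact: hE.
by apply: derivableB; apply: derivableZ.
Unshelve. all: by end_near. Qed.

(** McShane's formula: [H x] is the infimum of [h s + L * |x - s|] over [s] in [D]. *)
Lemma lipschitz_extension (D : set R) (h : R -> R) (L : R) : 0 <= L ->
  (forall s t, D s -> D t -> `|h s - h t| <= L * `|s - t|) ->
  exists2 H : R -> R, forall x y, `|H x - H y| <= L * `|x - y| &
    forall t, D t -> H t = h t.
Proof.
move=> L0 hL; have [->|/set0P[s0 Ds0]] := eqVneq D set0; last first.
- pose E x := [set h s + L * `|x - s| | s in D].
  have E0 x : E x !=set0 by exists (h s0 + L * `|x - s0|), s0.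
  have lbE x s : D s -> lbound (E x) (h s - L * `|x - s|).
    move=> Ds _ [t Dt <-]; have := hL s t Ds Dt; rewrite ler_norml => /andP[_].
    have := ler_distD x s t; rewrite (distrC s x) => /(ler_wpM2l L0).
    by rewrite mulrDr; lra.
  have hE x : has_lbound (E x) by exists (h s0 - L * `|x - s0|); exact: lbE.
  have Hle x y : inf (E x) <= inf (E y) + L * `|x - y|.
    rewrite -lerBlDr; apply: lb_le_inf => // _ [s Ds <-].
    rewrite lerBlDr; apply: (le_trans (y := h s + L * `|x - s|)).
      by apply: ge_inf => //; exists s.
    have := ler_distD y x s => /(ler_wpM2l L0).
    by rewrite mulrDr; lra.
  exists (fun x => inf (E x)).
    move=> x y; rewrite ler_norml; apply/andP; split.
      by have := Hle y x; rewrite (distrC y); lra.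
    by have := Hle x y; lra.
  move=> t Dt; apply/eqP; rewrite eq_le; apply/andP; split.
    apply: ge_inf => //; exists t => //; rewrite subrr normr0; lra.
  by apply: lb_le_inf => //; have := lbE t t Dt; rewrite subrr normr0 mulr0 subr0.
- exists (cst 0) => // x y; rewrite subrr normr0 mulr_ge0//.
Qed.

Lemma within_dnbhsP (D : set R) (t : R) (P : set R) :
  (within D t^') P <->
  exists2 d, 0 < d & forall s, D s -> 0 < `|s - t| < d -> P s.
Proof.
have -> : (within D t^') P = nbhs t (fun s => s != t -> D s -> P s) by [].
rewrite nbhs_ballP; split.
  move=> [d /= d0 H]; exists d => // s Ds /andP[st sd].
  apply: H => //; first by rewrite /ball/= distrC.
  by rewrite -subr_eq0 -normr_gt0.
move=> [d d0 H]; exists d => // s; rewrite /ball/= distrC => sd st Ds.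
by apply: H => //; rewrite normr_gt0 subr_eq0 st.
Qed.

Lemma limit_pointP_dist (D : set R) (t : R) : limit_point D t <->
  forall d, 0 < d -> exists2 s, D s & 0 < `|s - t| < d.
Proof.
split.
  move=> lp d d0; have [s [st Ds sd]] := lp _ (nbhsx_ballx t d d0).
  by exists s => //; rewrite normr_gt0 subr_eq0 st distrC.
move=> H A /nbhs_ballP[d /= d0 dA]; have [s Ds /andP[s0 sd]] := H d d0.
exists s; split => //; first by rewrite -subr_eq0 -normr_gt0.
by apply: dA; rewrite /ball/= distrC.
Qed.

Lemma cvg_withinP (D : set R) (t : R) (q : R -> R) (l : R) :
  q s @[s --> within D t^'] --> l <->
  forall e, 0 < e -> exists2 d, 0 < d &
    forall s, D s -> 0 < `|s - t| < d -> `|q s - l| <= e.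
Proof.
split.
  by move=> /cvgrPdist_le H e /H/within_dnbhsP[d d0 K]; exists d => // s Ds /(K _ Ds);
    rewrite /= distrC.
move=> H; apply/cvgrPdist_le => e /H[d d0 K]; apply/within_dnbhsP.
by exists d => // s Ds /(K _ Ds); rewrite distrC.
Qed.

Lemma within_proper (D : set R) (t : R) :
  limit_point D t -> ProperFilter (within D t^').
Proof.
move=> /limit_pointP_dist lp; split; last exact: within_filter.
by move=> /within_dnbhsP[d /lp[s Ds s0]] /(_ s Ds s0).
Qed.

Lemma derivable_inP (D : set R) (h : R -> R) (t : R) : derivable_in D h t <->
  [/\ D t, limit_point D t & exists l, forall e, 0 < e -> exists2 d, 0 < d &
    forall s, D s -> 0 < `|s - t| < d -> `|diff_quotient h t s - l| <= e].
Proof.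
split=> -[Dt lp].
  move=> /cvg_ex[l /cvg_withinP Hl]; split => //; by exists l.
by move=> [l /cvg_withinP Hl]; split => //; apply/cvg_ex; exists l.
Qed.

Lemma derive_inE (D : set R) (h : R -> R) (t l : R) : limit_point D t ->
  (forall e, 0 < e -> exists2 d, 0 < d &
    forall s, D s -> 0 < `|s - t| < d -> `|diff_quotient h t s - l| <= e) ->
  derive_in D h t = l.
Proof.
move=> /within_proper lp /cvg_withinP Hl.
by apply: cvg_lim => //; exact: Rhausdorff.
Qed.

Lemma derive_inP (D : set R) (h : R -> R) (t : R) : derivable_in D h t ->
  forall e, 0 < e -> exists2 d, 0 < d &
    forall s, D s -> 0 < `|s - t| < d -> `|diff_quotient h t s - derive_in D h t| <= e.
Proof.
move=> [Dt lp c]; exact/cvg_withinP.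
Qed.

Lemma derivable_in_derivable (D : set R) (h H : R -> R) (t : R) :
  D t -> limit_point D t -> (forall s, D s -> H s = h s) -> derivable H t 1 ->
  derivable_in D h t.
Proof.
move=> Dt lp Hh /cvg_ex[l /cvgrPdist_le Hl]; apply/derivable_inP; split => //.
exists l => e /Hl; rewrite near_withinE => /nbhs_ballP[d /= d0 K].
exists d => // s Ds /andP[s0 sd].
have := K (s - t); rewrite /ball/= sub0r normrN => /(_ sd).
rewrite -normr_gt0 => /(_ s0).
by rewrite /diff_quotient -!Hh// /GRing.scale/= mulr1 subrK mulrC distrC.
Qed.

(** If [t] were not a limit point of [D], small balls around [t] would meet [D] at most in [t], and
    the density would be 0. *)
Lemma density_limit_point (D : set R) (t : R) :
  density_point D t -> limit_point D t.
Proof.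
move=> dp; apply/limit_pointP_dist => d d0; apply: contrapT => /forall2NP H.
suff : (leb (D `&` ball t r) * (leb (ball t r))^-1)%E @[r --> 0^'+] --> (0 : \bar R)%E.
  move=> /(cvg_unique (@ereal_hausdorff R) dp) /eqP.
  by rewrite onee_eq0.
apply: cvg_near_cst; near=> r.
suff -> : leb (D `&` ball t r) = 0%E by rewrite mul0e.
have /subset_set1[->|->] : D `&` ball t r `<=` [set t].
- move=> s [Ds]; rewrite /ball/= distrC => sr; apply: contrapT => /eqP st.
  have [//|nst] := H s; apply: nst; rewrite normr_gt0 subr_eq0 st/=.
  by rewrite (lt_trans sr)//; near: r; exact: nbhs_right_lt.
- exact: measure0.
- exact: lebesgue_measure_set1.
Unshelve. all: by end_near. Qed.

Lemma ae_derivable_in (D : set R) (h : R -> R) (L : R) : measurable D ->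
  (forall s t, D s -> D t -> `|h s - h t| <= L * `|s - t|) ->
  {ae leb, forall t, D t -> derivable_in D h t}.
Proof.
(* The extension needs a nonnegative constant, and [L] may be negative when [D] has at most one
   point. *)
move=> mD hL; have M0 : 0 <= Num.max 0 L by rewrite le_max lexx.
have [s t Ds Dt|H HL HD] := @lipschitz_extension D h _ M0.
  by rewrite (le_trans (hL s t Ds Dt))// ler_wpM2r// le_max lexx orbT.
have := ae_derivable_lipschitz HL.
have := lebesgue_density mD.
apply: filterS2; first exact: (ae_filter_ringOfSetsType leb).
move=> t dt Ht Dt; apply: (derivable_in_derivable (H := H)) => //.
by apply: density_limit_point; rewrite /density_point; rewrite /= indicE mem_set in dt.
Qed.

End rademacher.

(** * Metric spaces, fragments and boxes *)

Section metric_facts.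
Context {R : realType}.

Lemma natSinv_lt (e : R) : 0 < e -> exists k : nat, k.+1%:R^-1 < e.
Proof.
move=> e0; have [k _ H] := near_infty_natSinv_lt (PosNum e0).
by exists k; apply: (H k) => /=.
Qed.

Lemma natSinv_le (m n : nat) : (m <= n)%N -> n.+1%:R^-1 <= m.+1%:R^-1 :> R.
Proof. by move=> mn; rewrite lef_pV2 ?posrE// ler_nat. Qed.

Lemma natSinv_gt0 (n : nat) : 0 < n.+1%:R^-1 :> R.
Proof. by rewrite invr_gt0. Qed.

Lemma dist_ballE (c r : R) : [set t : R | `|t - c| < r] = ball c r.
Proof. by apply/seteqP; split=> t; rewrite /ball/= distrC. Qed.

Lemma nbhs_mdist (X : metricType R) (x : X) (A : set X) :
  nbhs x A <-> exists2 e : R, 0 < e & forall y, mdist x y < e -> A y.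
Proof.
split=> [/nbhs_ballP[e /= e0 H]|[e e0 H]].
  by exists e => // y xy; apply: H; rewrite ballEmdist.
by apply/nbhs_ballP; exists e => //= y; rewrite ballEmdist => /H.
Qed.

Lemma nbhs_pair_mdist (X : metricType R) (p : R * X) (A : set (R * X)) :
  nbhs p A <-> exists2 e : R, 0 < e &
    forall q, `|p.1 - q.1| < e -> mdist p.2 q.2 < e -> A q.
Proof.
split=> [/nbhs_ballP[e /= e0 H]|[e e0 H]].
  by exists e => // q pq1 pq2; apply: H; split => //; rewrite ballEmdist.
apply/nbhs_ballP; exists e => //= q [/= pq1]; rewrite ballEmdist => pq2.
exact: H.
Qed.

Lemma open_mdist (X : metricType R) (x : X) (e : R) : open [set y | mdist x y < e].
Proof.
rewrite openE => y /= xy; apply/nbhs_mdist; exists (e - mdist x y); first by lra.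
by move=> z yz /=; have := metric_triangle x y z; lra.
Qed.

Lemma closed_pair_mdistP (X : metricType R) (A : set (R * X)) (p : R * X) : closed A ->
  (forall e : R, 0 < e -> exists q, [/\ A q, `|p.1 - q.1| < e & mdist p.2 q.2 < e]) ->
  A p.
Proof.
move=> cA H; apply: cA => B /nbhs_pair_mdist[e e0 HB].
by have [y [Ay xy1 xy2]] := H _ e0; exists y; split => //; exact: HB.
Qed.

Lemma complete_seq (V : completePseudoMetricType R) (u : nat -> V) :
  (forall n m, (n <= m)%N -> ball (u n) n.+1%:R^-1 (u m)) ->
  exists x : V, u n @[n --> \oo] --> x.
Proof.
move=> H; apply/cvg_ex; apply: cauchy_cvg; apply: cauchy_exP => e e0.
have [k ke] := natSinv_lt e0; exists (u k).
exists k => // n /= kn; apply: le_ball (H _ _ kn); exact: ltW.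
Qed.

Lemma dense_seq (X : completeMetricType R) : separable X ->
  exists d : nat -> X, forall x (e : R), 0 < e -> exists i, mdist x (d i) < e.
Proof.
move=> [D cD dD]; have [d dsurj] := pcard_surjP cD.
exists d => x e e0; have [||y [xy /dsurj[i _ iy]]] := dD [set y | mdist x y < e].
- by exists x; rewrite /= mdistxx.
- exact: open_mdist.
- by exists i; rewrite iy.
Qed.

End metric_facts.

Section fragment_facts.
Context {R : realType} {X : completeMetricType R}.
Implicit Types (g : frag X) (s t : R) (x y : X).

Local Notation hs g := (hyperspace_set (graph g)).

Lemma frag_lipschitz g : exists2 L : R, 0 <= L & forall p q : R * X,
  hs g p -> hs g q -> mdist p.2 q.2 <= L * `|p.1 - q.1|.
Proof.
have [L HL] := graph_lipschitz g; exists (Num.max 0 L); first by rewrite le_max lexx.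
move=> p q gp gq; apply: (le_trans (HL p q gp gq)).
by rewrite ler_wpM2r// le_max lexx orbT.
Qed.

Lemma fpointP g t : dom g t -> hs g (t, fpoint g t).
Proof. by move=> gt; exact: (@xgetPex _ point [set x | hs g (t, x)]). Qed.

(** Over equal times the Lipschitz bound on the graph leaves distance 0. *)
Lemma fpoint_uniq g t x : hs g (t, x) -> x = fpoint g t.
Proof.
move=> gx; have [L L0 HL] := frag_lipschitz g.
have := HL _ _ gx (fpointP (ex_intro _ x gx)); rewrite /= subrr normr0 mulr0 => xx.
by apply: mdist_positivity; apply/eqP; rewrite eq_le xx mdist_ge0.
Qed.

Lemma graphE g (p : R * X) : hs g p <-> dom g p.1 /\ p.2 = fpoint g p.1.
Proof.
case: p => t x; split=> /= [gx|[gt ->]]; last exact: fpointP.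
by split; [exists x|exact: fpoint_uniq].
Qed.

Lemma fpoint_lipschitz g : exists2 L : R, 0 <= L & forall s t,
  dom g s -> dom g t -> mdist (fpoint g s) (fpoint g t) <= L * `|s - t|.
Proof.
have [L L0 HL] := frag_lipschitz g; exists L => // s t gs gt.
exact: HL (fpointP gs) (fpointP gt).
Qed.

Lemma dom_closed g : closed (dom g). Proof. exact: graph_dom_closed. Qed.

Lemma dom_measurable g : measurable (dom g).
Proof. by apply: closed_measurable; exact: dom_closed. Qed.

End fragment_facts.

Section boxes.
Context {R : realType} {X : completeMetricType R}.
Variable d : nat -> X.
Hypothesis dP : forall x (e : R), 0 < e -> exists i, mdist x (d i) < e.

Definition box_index : Type := (rat * nat * nat)%type.
HB.instance Definition _ := Countable.on box_index.

Definition radius (j : box_index) : R := j.2.+1%:R^-1.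

Definition box (j : box_index) : set (R * X) :=
  [set p | `|p.1 - ratr j.1.1| < radius j /\ mdist p.2 (d j.1.2) < radius j].

(** Closed boxes absorb limits: a nesting [cbox j' <= box j] puts the limit of points of smaller and
    smaller boxes back into the open box [j]. *)
Definition cbox (j : box_index) : set (R * X) :=
  [set p | `|p.1 - ratr j.1.1| <= radius j /\ mdist p.2 (d j.1.2) <= radius j].

Lemma radius_gt0 j : 0 < radius j. Proof. exact: natSinv_gt0. Qed.

Lemma box_center j : box j (ratr j.1.1, d j.1.2).
Proof. by rewrite /box/= subrr normr0 mdistxx radius_gt0. Qed.

Lemma subset_box_cbox j : box j `<=` cbox j.
Proof. by move=> p [/ltW ? /ltW]. Qed.

Lemma open_box j : open (box j).
Proof.
rewrite openE => p [/= p1 p2]; apply/nbhs_pair_mdist.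
exists (Num.min (radius j - `|p.1 - ratr j.1.1|) (radius j - mdist p.2 (d j.1.2))).
  by rewrite lt_min !subr_gt0 p1.
move=> q; rewrite !lt_min => /andP[q1 _] /andP[_ q2]; split.
  by have := ler_distD p.1 q.1 (ratr j.1.1); rewrite (distrC q.1 p.1); lra.
by have := metric_triangle q.2 p.2 (d j.1.2); rewrite (metric_sym q.2 p.2); lra.
Qed.

Lemma nbhs_box j p : box j p -> nbhs p (box j).
Proof. by move=> jp; apply: open_nbhs_nbhs; split => //; exact: open_box. Qed.

Lemma cbox_dist j p q : cbox j p -> cbox j q ->
  `|p.1 - q.1| <= 2 * radius j /\ mdist p.2 q.2 <= 2 * radius j.
Proof.
move=> [p1 p2] [q1 q2]; split.
  by have := ler_distD (ratr j.1.1) p.1 q.1; rewrite (distrC (ratr _) q.1); lra.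
by have := metric_triangle p.2 (d j.1.2) q.2; rewrite (metric_sym (d _) q.2); lra.
Qed.

Lemma small_box p (e : R) : 0 < e ->
  exists j, [/\ box j p, radius j < e & forall q, cbox j q ->
    `|p.1 - q.1| < e /\ mdist p.2 q.2 < e].
Proof.
(* Two points of a closed box may be twice its radius apart, hence [e / 2]. *)
move=> e0; have [k ke] := @natSinv_lt _ (e / 2) ltac:(lra).
have k0 := @natSinv_gt0 R k.
have [q] : exists q : rat, ratr q \in `]p.1 - k.+1%:R^-1, p.1 + k.+1%:R^-1[.
  by apply: rat_in_itvoo; rewrite ltrBlDr -addrA ltrDl addr_gt0.
rewrite in_itv/= => /andP[q1 q2].
have [i pi] := dP p.2 k0.
have pj : box (q, i, k) p.
  split => //=; rewrite ltr_norml /radius/= ltrBlDl ltrBrDl; apply/andP.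
  by split; move: q1 q2; set r := (_^-1); lra.
exists (q, i, k); split => //; first by rewrite /radius/= (lt_trans ke)//; lra.
by move=> r /(cbox_dist (subset_box_cbox pj)); rewrite /radius/=; move: ke; set u := (_^-1); lra.
Qed.

Lemma open_box_sub (O : set (R * X)) p : open O -> O p ->
  exists j, box j p /\ cbox j `<=` O.
Proof.
rewrite openE => /[apply] /nbhs_pair_mdist[e e0 H].
have [j [jp _ Hj]] := small_box p e0.
by exists j; split => // q /Hj[]; exact: H.
Qed.

End boxes.

(** * Coding fragments in the Cantor space *)

Section coding.
Context {R : realType} {X : completeMetricType R}.
Variable d : nat -> X.
Hypothesis dP : forall x (e : R), 0 < e -> exists i, mdist x (d i) < e.

Local Notation hs g := (hyperspace_set (graph g)).
Local Notation box := (@box R X d).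
Local Notation cbox := (@cbox R X d).

Definition fcode : Type := prod_topology (fun _ : box_index => bool).
HB.instance Definition _ := Topological.on fcode.
HB.instance Definition _ := Pointed.on fcode.

Definition code_of (g : frag X) : fcode := fun j => `[< exists2 p, hs g p & box j p >].

(* These conditions characterise the codes of fragments with Lipschitz constant
   at most L. The second one, with the completeness of X, guarantees that every
   box of the code contains a point of code_graph c. *)
Definition coherent (L : nat) (c : fcode) :=
  [/\ exists j, c j,
      forall j k, c j -> exists j', [/\ c j', (k <= j'.2)%N & cbox j' `<=` box j],
      forall j j', c j -> box j `<=` box j' -> c j' &
      forall j j', c j -> c j' -> exists p q,
        [/\ box j p, box j' q & mdist p.2 q.2 <= L%:R * `|p.1 - q.1|]].

Lemma coherent_code_of g : exists L, coherent L (code_of g).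
Proof.
(* Rounding the Lipschitz constant up to a natural number makes the set of all codes a countable
   union over [L]. *)
have [L L0 HL] := frag_lipschitz g; exists (Num.bound L); split.
- have [p gp] := hyperspace_nonempty (graph g).
  have [j [jp _ _]] := small_box dP p ltr01.
  by exists j; apply/asboolP; exists p.
- move=> j k /asboolP[p gp jp].
  have [e e0 He] := (nbhs_pair_mdist _ _).1 (nbhs_box jp).
  have m0 : 0 < Num.min e k.+1%:R^-1 by rewrite lt_min e0 natSinv_gt0.
  have [j' [j'p j'k Hj']] := small_box dP p m0.
  exists j'; split.
  + by apply/asboolP; exists p.
  + move: j'k; rewrite lt_min => /andP[_]; rewrite /radius ltf_pV2 ?posrE// ltr_nat ltnS.
    exact: ltnW.
  + move=> q /Hj'[]; rewrite !lt_min => /andP[q1 _] /andP[q2 _].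
    exact: He.
- move=> j j' /asboolP[p gp jp] jj'; apply/asboolP; exists p => //; exact: jj'.
- move=> j j' /asboolP[p gp jp] /asboolP[q gq jq]; exists p, q; split => //.
  apply: (le_trans (HL _ _ gp gq)); rewrite ler_wpM2r// ltW//.
  exact: archi_boundP.
Qed.

(** Cantor's intersection argument: the radius of [js n] is at most [1/(n+1)], so the centres
    converge by completeness; the limit lies in every [cbox (js n.+1)], hence in every
    [box (js n)]. *)
Lemma box_cvg (js : nat -> box_index) :
  (forall n, (n <= (js n).2)%N) -> (forall n, cbox (js n.+1) `<=` box (js n)) ->
  exists p, forall n, box (js n) p.
Proof.
move=> jsn jsS.
have sub n m : (n <= m)%N -> box (js m) `<=` box (js n).
  elim: m => [|m IH]; first by rewrite leqn0 => /eqP ->.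
  rewrite leq_eqVlt => /predU1P[->//|]; rewrite ltnS => /IH nm.
  by move=> p /subset_box_cbox/jsS/nm.
have cb n m : (n <= m)%N -> box (js n) (ratr (js m).1.1, d (js m).1.2).
  by move=> /sub; apply; exact: box_center.
have rle n : radius (js n) <= n.+1%:R^-1 :> R by apply: natSinv_le; exact: jsn.
have [t tP] : exists t : R, ratr (js n).1.1 @[n --> \oo] --> t.
  apply: complete_seq => n m /cb[+ _] /=; rewrite /ball/= distrC => /lt_le_trans; apply.
  exact: rle.
have [x xP] : exists x : X, d (js n).1.2 @[n --> \oo] --> x.
  apply: complete_seq => n m /cb[_] /=; rewrite ballEmdist/= metric_sym => /lt_le_trans; apply.
  exact: rle.
exists (t, x) => n; apply: jsS; split => /=.
- apply/ler_addgt0Pr => e e0.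
  have [m nm tm] : exists2 m, (n.+1 <= m)%N & `|t - ratr (js m).1.1| < e.
    have [N _ HN] := (cvgrPdist_lt _ _).1 tP e e0.
    exists (maxn N n.+1); first by rewrite leq_maxr.
    by apply: HN; rewrite /= leq_maxl.
  have [/= + _] := cb _ _ nm.
  by have := ler_distD (ratr (js m).1.1) t (ratr (js n.+1).1.1); lra.
- apply/ler_addgt0Pr => e e0.
  have [m nm tm] : exists2 m, (n.+1 <= m)%N & mdist x (d (js m).1.2) < e.
    have [N _ HN] := metricType_numDomainType.cvgr_dist_lt xP e0.
    exists (maxn N n.+1); first by rewrite leq_maxr.
    by apply: HN; rewrite /= leq_maxl.
  have [/= _] := cb _ _ nm.
  by have := metric_triangle x (d (js m).1.2) (d (js n.+1).1.2); lra.
Qed.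

(** The closed set recovered from a code. For the code of a fragment it is the graph, because the
    graph is closed. *)
Definition code_graph (c : fcode) : set (R * X) := [set p | forall j, box j p -> c j].

Lemma code_graph_closed c : closed (code_graph c).
Proof.
move=> p clp j jp; have [q [cq jq]] := clp _ (nbhs_box jp).
exact: cq.
Qed.

(** Dependent choice in the second clause of [coherent] yields nested boxes of the code shrinking to
    a point [p]; the counter paired with each box forces the radii to 0. Every box around [p]
    contains a box of the sequence, so it belongs to the code by the third clause. *)
Lemma code_graph_hit L c j : coherent L c -> c j -> exists2 p, code_graph c p & box j p.
Proof.
move=> [_ Hr Hs _] cj.
pose T := {j | c j}.
have step (a : nat * T) : {b : nat * T | [/\ b.1 = a.1.+1, (a.1.+1 <= (sval b.2).2)%N &
    cbox (sval b.2) `<=` box (sval a.2)]}.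
  apply: cid; case: a => n [i ci] /=; have [i' [ci' ni' ii']] := Hr i n.+1 ci.
  by exists (n.+1, exist _ i' ci').
have [j0 [cj0 _ j0j]] := Hr j 0%N cj.
have [f [f0 fS]] := dependent_choice step (0%N, exist _ j0 cj0).
have f1 n : (f n).1 = n.
  by elim: n => [|n IH]; [rewrite f0|have [-> _ _] := fS n; rewrite IH].
pose js n := sval (f n).2.
have [p Hp] : exists p, forall n, box (js n) p.
  apply: box_cvg => n; last by have [_ _] := fS n.
  by case: n => // n; have [_ + _] := fS n; rewrite f1.
exists p; last by apply/j0j/subset_box_cbox; have := Hp 0%N; rewrite /js f0.
move=> i ip.
have [e e0 He] := (nbhs_pair_mdist _ _).1 (nbhs_box ip).
have [n ne] := @natSinv_lt _ (e / 2) ltac:(lra).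
apply: (Hs (js n)); first exact: (svalP (f n).2).
move=> q /subset_box_cbox jq.
have rn : radius (js n) <= n.+1%:R^-1 :> R.
  by apply: natSinv_le; case: n {ne jq} => // n; have [_ + _] := fS n; rewrite f1.
have [q1 q2] := cbox_dist (subset_box_cbox (Hp n)) jq.
have r2 : 2 * radius (js n) < e :> R by move: rn ne; set v := (_.+1%:R^-1); lra.
by apply: He; [apply: le_lt_trans q1 _|apply: le_lt_trans q2 _].
Qed.

Lemma code_graph_lipschitz L c : coherent L c -> forall p q,
  code_graph c p -> code_graph c q -> mdist p.2 q.2 <= L%:R * `|p.1 - q.1|.
Proof.
move=> [_ _ _ HL] p q cp cq; apply/ler_addgt0Pr => e e0.
(* Moving [p] and [q] by less than [e'] costs [2 * e'] in distance on the left and [L * (2 * e')] on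
   the right, which add up to [e]. *)
pose e' := e / (2 * (L%:R + 1)).
have L0 : 0 <= L%:R :> R by [].
have e'0 : 0 < e' by rewrite divr_gt0//; lra.
have [j [jp _ Hj]] := small_box dP p e'0.
have [j' [jq _ Hj']] := small_box dP q e'0.
have [p' [q' [/subset_box_cbox/Hj[p1 p2] /subset_box_cbox/Hj'[q1 q2] pq]]] := HL j j' (cp _ jp) (cq _ jq).
have := metric_triangle p.2 p'.2 q.2; have := metric_triangle p'.2 q'.2 q.2.
rewrite (metric_sym q'.2).
have := ler_distD p.1 p'.1 q'.1; have := ler_distD q.1 p.1 q'.1.
rewrite (distrC p'.1 p.1) => h1 h2 h3 h4.
have : L%:R * `|p'.1 - q'.1| <= L%:R * (`|p.1 - q.1| + 2 * e') by rewrite ler_wpM2l//; lra.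
have : e = 2 * e' + L%:R * (2 * e').
  by rewrite /e'; field; rewrite gt_eqF//; lra.
lra.
Qed.

Lemma code_graph_dom_closed L c : coherent L c ->
  closed [set t : R | exists x, code_graph c (t, x)].
Proof.
move=> /code_graph_lipschitz HL t clt.
have L0 : 0 <= L%:R :> R by [].
(* With this precision the times of [u n] and [u m], for [m >= n], differ by less than
   [1/((L+1)(n+1))]. The Lipschitz bound then makes the points of [X] a Cauchy sequence at the rate
   [1/(n+1)], and its limit lies over [t]. *)
have /choice[u uP] n : exists p, code_graph c p /\ `|p.1 - t| < (L%:R + 1)^-1 * (2^-1 * n.+1%:R^-1).
  have e0 : 0 < (L%:R + 1)^-1 * (2^-1 * n.+1%:R^-1) :> R.
    by rewrite !mulr_gt0 ?invr_gt0// ltr_wpDl.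
  have [s [[x sx]]] := clt _ (nbhsx_ballx t _ e0).
  by rewrite /ball/= distrC => st; exists (s, x).
have [x xP] : exists x : X, (fun n => (u n).2) @ \oo --> x.
  apply: complete_seq => n m nm; rewrite ballEmdist/=.
  have [cn un] := uP n; have [cm um] := uP m.
  apply: le_lt_trans (HL _ _ cn cm) _.
  have : `|(u m).1 - t| < (L%:R + 1)^-1 * (2^-1 * n.+1%:R^-1).
    apply: lt_le_trans um _; rewrite !ler_pM2l ?invr_gt0// ?natSinv_le//.
  have := ler_distD t (u n).1 (u m).1; rewrite (distrC t) => h1 h2.
  have h : `|(u n).1 - (u m).1| < (L%:R + 1)^-1 * n.+1%:R^-1.
    by move: un h1 h2; set r : R := n.+1%:R^-1; lra.
  apply: le_lt_trans (_ : _ <= (L%:R + 1) * `|(u n).1 - (u m).1|) _.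
    by rewrite ler_wpM2r// lerDl.
  by rewrite -ltr_pdivlMl// ltr_wpDl.
exists x; apply: (closed_pair_mdistP (@code_graph_closed c)) => e e0.
have [N _ HN] := metricType_numDomainType.cvgr_dist_lt xP e0.
have [k ke] := natSinv_lt e0.
exists (u (maxn N k)); have [cu ut] := uP (maxn N k); split => //=.
  rewrite distrC (lt_trans ut)// (le_lt_trans _ ke)// -[leRHS]mul1r ler_pM ?invr_ge0 ?mulr_ge0 ?invr_ge0//.
    by rewrite invf_le1 ?ltr_wpDl// lerDr.
  rewrite -[leRHS]mul1r ler_pM ?invr_ge0// ?natSinv_le ?leq_maxr//.
  by rewrite invf_le1// ler1n.
by apply: HN; rewrite /= leq_maxl.
Qed.

(** What is found among coherent codes can be lifted back to fragments. *)
Lemma coherent_surj L c : coherent L c -> exists g, code_of g = c.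
Proof.
move=> cc; have [[j0 cj0] _ _ _] := cc.
have [p0 cp0 _] := code_graph_hit cc cj0.
have ne : code_graph c !=set0 by exists p0.
pose H := Hyperspace (@code_graph_closed c) ne.
have lipH : exists L : R, forall p q : R * X,
    hyperspace_set H p -> hyperspace_set H q -> mdist p.2 q.2 <= L * `|p.1 - q.1|.
  by exists L%:R; exact: code_graph_lipschitz.
exists (@Frag R X H lipH (code_graph_dom_closed cc)).
apply/funext => j; apply/idP/idP => [/asboolP[p /=]|cj]; first by move=> /(_ j); apply.
by apply/asboolP; have [p cp jp] := code_graph_hit cc cj; exists p.
Qed.

End coding.

(** * Projecting Borel sets of pairs (fragment, point) *)

Section projection.
Context {R : realType} {X : completeMetricType R}.
Variable d : nat -> X.
Hypothesis dP : forall x (e : R), 0 < e -> exists i, mdist x (d i) < e.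

Local Notation hs g := (hyperspace_set (graph g)).
Local Notation box := (@box R X d).
Local Notation cbox := (@cbox R X d).
Local Notation code_of := (@code_of R X d).
Local Notation fX := (borel (frag X) * borel X)%type.

(** Sets of fragments prescribed by finitely many bits of the code. There are countably many of
    them, and they turn out to form a base finer than the Fell topology. *)
Definition fell_net (s s' : seq box_index) : set (frag X) :=
  [set g | (forall j, j \in s -> code_of g j) /\ (forall j, j \in s' -> ~ code_of g j)].

Lemma fell_netS s s' t t' : {subset s <= t} -> {subset s' <= t'} ->
  fell_net t t' `<=` fell_net s s'.
Proof. by move=> st st' g [h h']; split=> j; [move=> /st/h|move=> /st'/h']. Qed.

Lemma fell_net_subbase (g : frag X) (B : set (hyperspace (R * X)%type)) :
  fell_subbase B -> B (graph g) ->
  exists s s', fell_net s s' g /\ (fell_net s s' `<=` (@graph R X) @^-1` B).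
Proof.
move=> [[V oV <-]|[K cK <-]].
- move=> [p [gp Vp]]; have [j [jp jV]] := open_box_sub dP oV Vp.
  exists [:: j], [::]; split; first by split=> // k; rewrite inE => /eqP ->; apply/asboolP; exists p.
  move=> g' [/(_ j) + _]; rewrite inE eqxx => /(_ isT)/asboolP[q gq jq].
  by exists q; split => //; exact/jV/subset_box_cbox.
- move=> /= gK.
  (* finitely many of the boxes missed by g cover K *)
  have cov : K `<=` \bigcup_(j in [set j | ~ code_of g j]) box j.
    move=> p Kp; have ngp : (~` hs g) p by move=> gp; have : (hs g `&` K) p by []; rewrite gK.
    have [j [jp jg]] := open_box_sub dP (closed_openC (@hyperspace_closed _ (graph g))) ngp.
    exists j => //; move=> /asboolP[q gq /subset_box_cbox/jg]; exact.
  pose RX : ptopologicalType :=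
    HB.pack (R * X)%type (isPointed.Build (R * X)%type (0, point)).
  have : cover_compact (K : set RX).
    by have := (@compact_cover RX) => <-; exact: cK.
  move=> /(_ _ [set j | ~ code_of g j] box).
  case=> [j _|//|D' D'g cD']; first exact: open_box.
  exists [::], (finmap.enum_fset D'); split.
    by split=> // j /D'g; rewrite inE.
  move=> g' [_ ng'] /=; rewrite -subset0 => p [gp /cD'[j /= jD' jp]].
  by apply: (ng' j jD'); apply/asboolP; exists p.
Qed.

(** An open set contains, around [g], a finite intersection of subbasic sets; concatenating lists of
    bits intersects the corresponding nets. *)
Lemma fell_net_open (W : set (frag X)) (g : frag X) : open W -> W g ->
  exists s s', fell_net s s' g /\ fell_net s s' `<=` W.
Proof.
move=> [W' oW' <-]; case: oW' => D' HD' <- [A D'A Ag].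
have [F FD AE] := HD' A D'A.
suff [s [s' [gs ss]]] : exists s s', fell_net s s' g /\
    (forall B, B \in (finmap.enum_fset F) -> fell_net s s' `<=` (@graph R X) @^-1` B).
  exists s, s'; split => // g' g's; exists A; first exact: D'A.
  by suff : A (graph g') by []; rewrite -AE => B BF; exact: (ss B BF g' g's).
have : forall B, B \in (finmap.enum_fset F) -> fell_subbase B by move=> B /FD/set_mem.
have : forall B, B \in (finmap.enum_fset F) -> B (graph g) by move=> B BF; move: Ag; rewrite -AE; exact.
elim: (finmap.enum_fset F) => [|B F' IH] Fg Fs; first by exists [::], [::]; split => //.
have [||s [s' [gs ss]]] := IH.
- by move=> C CF; apply: Fg; rewrite inE CF orbT.
- by move=> C CF; apply: Fs; rewrite inE CF orbT.
have [|t [t' [gt tt]]] := @fell_net_subbase g B _ (Fg B (mem_head _ _)).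
  exact: (Fs B (mem_head _ _)).
exists (s ++ t), (s' ++ t'); split.
  by split=> j; rewrite mem_cat => /orP[]; move: j; [case: gs|case: gt|case: gs|case: gt].
move=> C; rewrite inE => /predU1P[->|CF].
  apply: subset_trans tt; apply: fell_netS => j; rewrite mem_cat => ->; exact: orbT.
apply: subset_trans (ss C CF); apply: fell_netS => j; rewrite mem_cat => -> //.
Qed.

(** As [X] is separable, these sets generate the Borel sets of the product of the Cantor space with
    [X]. Having only two kinds of generators keeps the induction over measurable sets short. *)
Definition cylinders : set (set (fcode * X)) :=
  [set [set z : fcode * X | z.1 j] | j in [set: box_index]] `|`
  [set [set z : fcode * X | B z.2] | B in @open X].

Definition codeX := g_sigma_algebraType cylinders.

Definition code_pair (z : fX) : codeX := (code_of z.1, z.2).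

Lemma measurable_bit j : measurable [set z : codeX | z.1 j].
Proof. by apply: sub_sigma_algebra; left; exists j. Qed.

(** Every clause of [coherent] quantifies over countable types; the parts that do not mention the
    code are constant propositions. *)
Lemma measurable_coherent : measurable [set z : codeX | exists L, coherent d L z.1].
Proof.
apply: measurable_exists => L.
have E : 
  [set z : codeX | exists j, z.1 j] `&`
  [set z : codeX | forall j k, z.1 j -> exists j',
      ((k <= j'.2)%N /\ cbox j' `<=` box j) /\ z.1 j'] `&`
  [set z : codeX | forall j j', z.1 j -> (box j `<=` box j' -> z.1 j')] `&`
  [set z : codeX | forall j j', z.1 j -> z.1 j' -> exists p q,
        [/\ box j p, box j' q & mdist p.2 q.2 <= L%:R * `|p.1 - q.1|]] =
  [set z : codeX | coherent d L z.1].
  apply/seteqP; split=> z.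
    move=> [[[h1 h2] h3] h4]; split => //.
    by move=> j k /h2-/(_ k)[j' [[? ?] ?]]; exists j'.
  move=> [h1 h2 h3 h4]; split => //; split; last exact: h3.
  by split=> // j k /h2-/(_ k)[j' [? ? ?]]; exists j'.
suff : measurable ([set z : codeX | exists j, z.1 j] `&`
  [set z : codeX | forall j k, z.1 j -> exists j',
      ((k <= j'.2)%N /\ cbox j' `<=` box j) /\ z.1 j'] `&`
  [set z : codeX | forall j j', z.1 j -> (box j `<=` box j' -> z.1 j')] `&`
  [set z : codeX | forall j j', z.1 j -> z.1 j' -> exists p q,
        [/\ box j p, box j' q & mdist p.2 q.2 <= L%:R * `|p.1 - q.1|]]) by rewrite E.
apply: measurableI; [apply: measurableI; [apply: measurableI|]|].
- by apply: measurable_exists => j; exact: measurable_bit.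
- apply: measurable_forall => j; apply: measurable_forall => k.
  apply: measurable_impl; first exact: measurable_bit.
  apply: measurable_exists => j'; apply: measurable_andP => _; exact: measurable_bit.
- apply: measurable_forall => j; apply: measurable_forall => j'.
  apply: measurable_impl; first exact: measurable_bit.
  apply: measurable_implP => _; exact: measurable_bit.
- apply: measurable_forall => j; apply: measurable_forall => j'.
  do 2 (apply: measurable_impl; first exact: measurable_bit).
  exact: measurable_Prop.
Qed.

Definition code_sets : set (set fX) :=
  preimage_set_system setT code_pair (@measurable _ codeX).

(* The product Borel sets are measurable for the sigma-algebra induced by the
   coding, hence depend only on the code. *)
Definition codeT := g_sigma_algebraType code_sets.

Lemma code_setsE (A : set codeT) : measurable A -> code_sets A.
Proof.
apply: smallest_sub => //.
exact: sigma_algebra_preimage (@sigma_algebra_measurable _ codeX).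
Qed.

Lemma measurable_code_pair (E : set codeX) : measurable E ->
  measurable (code_pair @^-1` E : set codeT).
Proof. by move=> mE; apply: sub_sigma_algebra; exists E => //; rewrite setTI. Qed.

(** A Fell open set is the union of the nets that it contains, and there are only countably many
    nets. *)
Lemma measurable_fst_codeT : measurable_fun [set: codeT] (fst : codeT -> borel (frag X)).
Proof.
apply: (@measurability _ _ codeT (borel (frag X)) setT _ (@open (frag X))) => // _ [W oW <-]; rewrite setTI.
rewrite (_ : fst @^-1` W = [set z : codeT | exists ss : seq box_index * seq box_index,
    fell_net ss.1 ss.2 `<=` W /\ fell_net ss.1 ss.2 z.1]); last first.
  apply/seteqP; split=> z /=; last by move=> [ss [sW /sW]].
  by move=> /(fell_net_open oW)[s [s' [zs sW]]]; exists (s, s').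
apply: measurable_exists => -[s s'] /=; apply: measurable_andP => _.
apply: measurableI.
- apply: measurable_forall => j; apply: measurable_implP => _.
  exact: (measurable_code_pair (measurable_bit j)).
- apply: measurable_forall => j; apply: measurable_implP => _.
  apply: measurableC; exact: (measurable_code_pair (measurable_bit j)).
Qed.

Lemma measurable_snd_codeT : measurable_fun [set: codeT] (snd : codeT -> borel X).
Proof.
apply: (@measurability _ _ codeT (borel X) setT _ (@open X)) => // _ [W oW <-]; rewrite setTI.
have mW : measurable ([set z : codeX | W z.2]).
  by apply: sub_sigma_algebra; right; exists W.
exact: (measurable_code_pair mW).
Qed.

Lemma measurable_codeP (G : set fX) : measurable G ->
  exists2 E : set codeX, measurable E & G = code_pair @^-1` E.
Proof.
move=> mG; have := measurable_fun_pair measurable_fst_codeT measurable_snd_codeT.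
move=> /(_ measurableT G mG); rewrite setTI => /code_setsE[E mE].
rewrite setTI => EG; exists E => //; rewrite EG.
by apply/seteqP; split=> -[].
Qed.

Lemma open_hit (V : set (R * X)) : open V ->
  open [set g : frag X | hs g `&` V !=set0].
Proof.
move=> oV; exists [set G : hyperspace (R * X)%type | G `&` V !=set0]; last by [].
exists [set [set G : hyperspace (R * X)%type | G `&` V !=set0]]; last by rewrite bigcup_set1.
by move=> _ ->; apply: (@finI_from1 _ _ (@fell_subbase (R * X)%type) id); left; exists V.
Qed.

Lemma measurable_hit (V : set (R * X)) : open V ->
  measurable [set g : borel (frag X) | hs g `&` V !=set0].
Proof. by move=> oV; apply: sub_sigma_algebra; exact: open_hit. Qed.

(** A bit of the code says that the graph meets an open box, which is an open condition in the Fell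
    topology. *)
Lemma measurable_fun_code_pair : measurable_fun [set: fX] code_pair.
Proof.
apply: (@measurability _ _ fX codeX setT _ cylinders) => // _ [_ [[j _ <-]|[W oW <-]] <-];
  rewrite setTI.
- rewrite (_ : _ @^-1` _ = fst @^-1` [set g : borel (frag X) | hs g `&` box j !=set0]).
    rewrite -[X in measurable X]setTI; apply: measurable_fst => //.
    by apply: measurable_hit; exact: open_box.
  apply/seteqP; split=> -[g x] /=; first by move=> /asboolP[p gp jp]; exists p.
  by move=> [p [gp jp]]; apply/asboolP; exists p.
- rewrite (_ : _ @^-1` _ = snd @^-1` (W : set (borel X)))//.
  rewrite -[X in measurable X]setTI; apply: measurable_snd => //.
  exact: sub_sigma_algebra.
Qed.

Lemma compact_fcode : compact [set: fcode].
Proof.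
have := @tychonoff box_index (fun=> bool) (fun=> setT) (fun=> bool_compact).
by rewrite (_ : [set f | _] = setT)//; apply/seteqP; split.
Qed.

(** Projection along a compact factor is closed: the codes paired in [C] with points near [x]
    generate a proper filter, and a cluster point [c] of it gives a point [(c, x)] of [C]. *)
Lemma closed_snd (C : set (fcode * X)) : closed C -> closed (snd @` C).
Proof.
move=> cC x clx.
pose F := filter_from (nbhs x) (fun B => [set c : fcode | exists2 y, B y & C (c, y)]).
have FF : ProperFilter F.
  apply: filter_from_proper; last first.
    by move=> B /clx[_ [[[c y] Ccy <-] By]]; exists c, y.
  apply: filter_from_filter; first by exists setT; exact: filterT.
  move=> B B' xB xB'; exists (B `&` B'); first exact: filterI.
  by move=> c [y [By B'y] Cy]; split; exists y.
have [c [_ Fc]] := compact_fcode FF (@filterT _ F _).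
exists (c, x) => //; apply: cC => B [[B1 B2] /= [cB1 xB2] B12].
have FB2 : F [set c : fcode | exists2 y, B2 y & C (c, y)] by exists B2.
have [c' [[y B2y Ccy] B1c']] := Fc _ _ FB2 cB1.
by exists (c', y); split => //; apply: B12.
Qed.

(** * Inner regularity with respect to closed sets *)

Section regularity.
Variable M : {measure set fX -> \bar R}.
Hypothesis Mfin : (M setT < +oo)%E.

(** Regularity for the image of [M] under the coding. Measurability of [C] is asked for separately
    because the sigma-algebra is generated by [cylinders], not by the closed sets of the product. *)
Definition inner_closed (E : set codeX) := measurable E /\
  forall e : R, 0 < e -> exists C : set (fcode * X),
    [/\ closed C, measurable (C : set codeX), C `<=` E &
        (M (code_pair @^-1` (E `\` C)) <= e%:E)%E].

Lemma measurable_pre (E : set codeX) : measurable E -> measurable (code_pair @^-1` E).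
Proof.
by move=> mE; rewrite -[X in measurable X]setTI; apply: measurable_fun_code_pair.
Qed.

Lemma inner_closed_closed (C : set codeX) :
  closed (C : set (fcode * X)) -> measurable C -> inner_closed C.
Proof.
move=> cC mC; split=> // e e0; exists C; split => //.
by rewrite setDv preimage_set0 measure0 lee_fin ltW.
Qed.

Lemma measurable_pre_le (A B : set codeX) : measurable A -> measurable B ->
  A `<=` B -> (M (code_pair @^-1` A) <= M (code_pair @^-1` B))%E.
Proof.
move=> mA mB AB; apply: le_measure; rewrite ?inE; [exact: measurable_pre|exact: measurable_pre|].
exact: preimage_subset.
Qed.

Lemma pre_bigcup_le (A : nat -> set codeX) (e : R) : 0 < e -> (forall n, measurable (A n)) ->
  (forall n, (M (code_pair @^-1` A n) <= (e / 2 ^+ n.+1)%:E)%E) ->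
  (M (code_pair @^-1` \bigcup_n A n) <= e%:E)%E.
Proof.
move=> e0 mA Ae; rewrite preimage_bigcup.
apply: (le_trans (measure_sigma_subadditive _ _ _ (@subset_refl _ _))).
- by move=> n; exact: measurable_pre.
- by rewrite -preimage_bigcup; apply: measurable_pre; exact: bigcupT_measurable.
apply: le_trans (epsilon_trick0 xpredT (ltW e0)).
by apply: lee_nneseries => // n _; rewrite natrX; exact: Ae.
Qed.

(** The union of all the [C n] loses at most [e / 2] but need not be closed. The finite unions [D N]
    are closed, and as [M] is finite, their losses decrease to that of the whole union, so some
    [D N] loses at most [e]. *)
Lemma inner_closed_bigcup (A : nat -> set codeX) :
  (forall n, inner_closed (A n)) -> inner_closed (\bigcup_n A n).
Proof.
move=> iA; have mA n : measurable (A n) by case: (iA n).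
have mU : measurable (\bigcup_n A n) by exact: bigcupT_measurable.
split=> // e e0.
have e2 : 0 < e / 2 by lra.
have /choice[C CP] n : exists C : set codeX, [/\ closed (C : set (fcode * X)), measurable C,
    C `<=` A n & (M (code_pair @^-1` (A n `\` C)) <= (e / 2 / 2 ^+ n.+1)%:E)%E].
  by apply: (iA n).2; rewrite divr_gt0 ?exprn_gt0.
have cC n : closed (C n : set (fcode * X)) by case: (CP n).
have mC n : measurable (C n) by case: (CP n).
pose D N : set codeX := \bigcup_(n < N) C n.
have mD N : measurable (D N) by exact: bigcup_measurable.
pose G N := \bigcup_n A n `\` D N.
have mG N : measurable (G N) by exact: measurableD.
have GI : (M (\bigcap_N (code_pair @^-1` G N)) <= (e / 2)%:E)%E.
  rewrite -preimage_bigcap.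
  apply: (le_trans (y := M (code_pair @^-1` \bigcup_n (A n `\` C n)))).
    apply: measurable_pre_le; [exact: bigcapT_measurable| |].
      by apply: bigcupT_measurable => n; exact: measurableD.
    move=> z zG; have [[n _ Anz] _] := zG 0%N I.
    exists n => //; split => // Cnz; have [_] := zG n.+1 I; apply.
    by exists n => /=.
  apply: pre_bigcup_le => // n; first exact: measurableD.
  by case: (CP n).
have : M (code_pair @^-1` G N) @[N --> \oo] --> M (\bigcap_N (code_pair @^-1` G N)).
  apply: nonincreasing_cvg_mu => //.
  - apply: le_lt_trans Mfin; apply: le_measure; rewrite ?inE//; exact: measurable_pre.
  - by move=> N; exact: measurable_pre.
  - by apply: bigcapT_measurable => N; exact: measurable_pre.
  - move=> m n mn; apply/subsetPset => z [Uz nD]; split=> // -[k /= km Ckz].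
    by apply: nD; exists k => //=; exact: leq_trans km mn.
move=> Gcvg.
have [N GN] : exists N, (M (code_pair @^-1` G N) <= e%:E)%E.
  apply: contrapT => /forallNP H.
  have : (e%:E <= M (\bigcap_N (code_pair @^-1` G N)))%E.
    apply: (cvge_to_ge Gcvg); near=> N.
    by have /negP := H N; rewrite -ltNge => /ltW.
  by move=> /le_trans/(_ GI); rewrite lee_fin; lra.
exists (D N); split => //.
- rewrite /D (_ : \bigcup_(n < N) C n = \big[setU/set0]_(n < N) C n); last exact: bigcup_mkord.
  by apply: closed_bigsetU => n _; exact: cC.
- by move=> z [n _ Cnz]; exists n => //; case: (CP n) => _ _ + _; apply.
Unshelve. all: by end_near. Qed.

Lemma inner_closed_bigcap (A : nat -> set codeX) :
  (forall n, inner_closed (A n)) -> inner_closed (\bigcap_n A n).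
Proof.
move=> iA; have mA n : measurable (A n) by case: (iA n).
split=> [|e e0]; first exact: bigcapT_measurable.
have /choice[C CP] n : exists C : set codeX, [/\ closed (C : set (fcode * X)), measurable C,
    C `<=` A n & (M (code_pair @^-1` (A n `\` C)) <= (e / 2 ^+ n.+1)%:E)%E].
  by apply: (iA n).2; rewrite divr_gt0 ?exprn_gt0.
have mC n : measurable (C n) by case: (CP n).
exists (\bigcap_n C n); split.
- by apply: closed_bigI => n _; case: (CP n).
- exact: bigcapT_measurable.
- by move=> z Cz n _; have [_ _ + _] := CP n; apply; exact: Cz.
apply: (le_trans (y := M (code_pair @^-1` \bigcup_n (A n `\` C n)))).
  apply: measurable_pre_le.
  - by apply: measurableD; exact: bigcapT_measurable.
  - by apply: bigcupT_measurable => n; exact: measurableD.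
  - move=> z [Az nC]; apply: contrapT => H; apply: nC => n _; apply: contrapT => nC.
    by apply: H; exists n => //; split => //; exact: Az.
by apply: pre_bigcup_le => // n; [exact: measurableD|case: (CP n)].
Qed.

Lemma closed_bit j (b : bool) : closed [set z : fcode * X | z.1 j = b].
Proof.
apply: (@closed_comp _ _ (fun z : fcode * X => z.1 j) [set b]).
  move=> z _; apply: (@continuous_comp _ _ _ fst (fun c : fcode => c j)); first exact: cvg_fst.
  exact: (@proj_continuous _ (fun=> bool) j).
exact: discrete_closed.
Qed.

Lemma measurable_open_snd (B : set X) : open B -> measurable [set z : codeX | B z.2].
Proof. by move=> oB; apply: sub_sigma_algebra; right; exists B. Qed.

Lemma measurable_closed_snd (B : set X) : closed B -> measurable [set z : codeX | B z.2].
Proof.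
move=> /closed_openC/measurable_open_snd/measurableC.
by congr (measurable _); apply/seteqP; split=> z /= => [/contrapT|? []].
Qed.

Lemma closed_snd_pre (B : set X) : closed B -> closed [set z : fcode * X | B z.2].
Proof. by move=> cB; apply: (@closed_comp _ _ snd B) => // z _; exact: cvg_snd. Qed.

(** The sets that are regular together with their complements form a sigma-algebra, so it is enough
    to check the cylinders. Bits are clopen conditions. *)
Lemma inner_closed_measurable (E : set codeX) : measurable E -> inner_closed E.
Proof.
move=> mE; suff : (inner_closed E /\ inner_closed (~` E)) by case.
move: E mE; apply: smallest_sub.
  split.
  - split; first by apply: inner_closed_closed => //; exact: closed0.
    by rewrite setC0; apply: inner_closed_closed => //; exact: closedT.
  - by move=> A [iA iCA]; rewrite setTD setCK.
  - move=> A iA; split; first by apply: inner_closed_bigcup => n; case: (iA n).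
    by rewrite setC_bigcup; apply: inner_closed_bigcap => n; case: (iA n).
move=> _ [[j _ <-]|[B oB <-]].
- have cl : closed [set z : fcode * X | z.1 j].
    exact: (@closed_bit j true).
  split.
    apply: inner_closed_closed; first exact: cl.
    exact: measurable_bit.
  rewrite (_ : ~` _ = [set z : fcode * X | z.1 j = false]).
    apply: inner_closed_closed; first exact: closed_bit.
    rewrite (_ : [set z | _] = ~` [set z : codeX | z.1 j]).
      by apply: measurableC; exact: measurable_bit.
    by apply/seteqP; split=> z /=; [move=> ->|move=> /negP/negbTE].
  by apply/seteqP; split=> z /=; [move=> /negP/negbTE|move=> ->].
(* [Fn n] consists of the points at distance at least [1/(n+1)] from the complement of [B]; these
   closed sets exhaust the open set [B]. *)
- pose Fn n := [set x : X | forall y, ~ B y -> n.+1%:R^-1 <= mdist x y :> R].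
  have cF n : closed (Fn n).
    move=> x clx y nBy; apply/ler_addgt0Pl => e e0.
    have [z [Fz xz]] := clx _ ((nbhs_mdist _ _).2 (ex_intro2 _ _ e e0 (fun y => id))).
    have := Fz y nBy; have := metric_triangle z x y; rewrite (metric_sym z x).
    by move: xz; set r : R := n.+1%:R^-1 => /= xz; lra.
  split.
    rewrite (_ : [set z | _] = \bigcup_n [set z : codeX | Fn n z.2]).
      apply: inner_closed_bigcup => n; apply: inner_closed_closed.
        exact: closed_snd_pre.
      exact: measurable_closed_snd.
    apply/seteqP; split=> [[c x] /= Bx|[c x] [n _ /= Fnx]]; last first.
      by apply: contrapT => /Fnx; rewrite mdistxx leNgt natSinv_gt0.
    have [e e0 He] := (nbhs_mdist _ _).1 (open_nbhs_nbhs (conj oB Bx)).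
    have [n ne] := natSinv_lt e0.
    exists n => // y nBy /=; rewrite leNgt; apply/negP => xy; apply: nBy.
    by apply: He; exact: lt_trans ne.
  apply: inner_closed_closed; first exact: (closed_snd_pre (open_closedC oB)).
  by apply: measurableC; exact: measurable_open_snd.
Qed.

Lemma closed_inner_projection (G : set fX) (e : R) : measurable G -> 0 < e ->
  exists K : set X, [/\ closed K, K `<=` snd @` G &
    (M (G `&` [set z | ~ K z.2]) <= e%:E)%E].
Proof.
move=> mG e0; have [E mE GE] := measurable_codeP mG.
(* Intersecting with the coherent codes loses nothing, as codes of fragments are coherent, and makes
   every point of the closed set [C] below come from a fragment. *)
have mE' : measurable (E `&` [set z : codeX | exists L, coherent d L z.1]).
  by apply: measurableI => //; exact: measurable_coherent.
have [C [cC mC CE Ce]] := (inner_closed_measurable mE').2 e e0.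
exists (snd @` C); split; first exact: closed_snd.
- move=> _ [[c x] /CE[Ecx [L /(coherent_surj dP)[g gc]]] <-]; exists (g, x) => //.
  by rewrite GE /= /preimage/= /code_pair/= gc.
apply: le_trans Ce; apply: le_measure; rewrite ?inE.
- apply: measurableI => //.
  rewrite (_ : [set z | _] = snd @^-1` (~` (snd @` C) : set (borel X)))//.
  rewrite -[X in measurable X]setTI; apply: measurable_snd => //.
  by apply: sub_sigma_algebra; apply: closed_openC; exact: closed_snd.
- by apply: measurable_pre; exact: measurableD.
- move=> z [Gz nK]; split; last by move=> Cz; apply: nK; exists (code_pair z).
  split; first by move: Gz; rewrite GE.
  exact: coherent_code_of.
Qed.

End regularity.
End projection.

(** * Measures on a product obtained by integrating a kernel *)

Section disintegration.
Context {d1 d2} {T1 : measurableType d1} {T2 : measurableType d2} {R : realType}.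
Variables (P : {measure set T1 -> \bar R}) (k : T1 -> {measure set T2 -> \bar R}).
Hypothesis mk : forall B, measurable B -> measurable_fun setT (k ^~ B).
Hypothesis kfin : forall x, (k x setT < +oo)%E.

Lemma measurable_fun_section (E : set (T1 * T2)) : measurable E ->
  measurable_fun setT (fun x => k x (xsection E x)).
Proof.
pose kk : R.-ker T1 ~> T2 := HB.pack k (isKernel.Build _ _ _ _ _ k mk).
move=> mE.
have [] := @measurable_prod_subset_xsection_kernel _ _ _ _ _ kk setT measurableT _ E mE.
  move=> x; exists (fine (k x setT) + 1) => B mB; rewrite /mrestr setIT.
  apply: (le_lt_trans (y := k x setT)); first by apply: le_measure; rewrite ?inE.
  rewrite EFinD fineK ?ltey_eq; last by rewrite ge0_fin_numE.
  by rewrite lteDl ?lte_fin// ge0_fin_numE.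
move=> _; apply: eq_measurable_fun => x _.
by rewrite /mrestr setIT.
Qed.

(** Sigma-additivity is that of each [k x] on sections, followed by the exchange of a sum and an
    integral of nonnegative functions. *)
Lemma disintegration : exists M : {measure set (T1 * T2) -> \bar R},
  forall E, M E = (\int[P]_x k x (xsection E x))%E.
Proof.
pose m (E : set (T1 * T2)) := (\int[P]_x k x (xsection E x))%E.
have m0 : m set0 = 0%E.
  by rewrite /m; apply: integral0_eq => x _; rewrite xsection0.
have m_ge0 E : (0 <= m E)%E by apply: integral_ge0.
have m_sigma : semi_sigma_additive m.
  move=> F mF tF mUF.
  have -> : m (\bigcup_n F n) = (\sum_(n <oo) m (F n))%E.
    rewrite /m -integral_nneseries//; last by move=> n; exact: measurable_fun_section.
    apply: eq_integral => x _; rewrite xsection_bigcup.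
    apply/esym/cvg_lim => //; apply: measure_semi_sigma_additive.
    - by move=> n; exact: measurable_xsection.
    - exact: trivIset_xsection.
    - by apply: bigcupT_measurable => n; exact: measurable_xsection.
  by apply: is_cvg_nneseries.
pose mm : {measure set (T1 * T2)%type -> \bar R} :=
  HB.pack m (isMeasure.Build _ _ R m m0 m_ge0 m_sigma).
by exists mm.
Qed.

End disintegration.

(** * A Borel set of full measure inside a projection *)

Section full_projection.
Context {R : realType} {X : completeMetricType R}.
Variables (mu : {measure set (borel X) -> \bar R})
  (P : {measure set (borel (frag X)) -> \bar R})
  (nu : frag X -> {measure set (borel X) -> \bar R}).
Hypothesis sepX : separable X.
Hypothesis mnu : forall B : set (borel X), measurable B ->
  measurable_fun [set: borel (frag X)] (fun g => nu g B).
Hypothesis muE : forall B : set (borel X), measurable B -> mu B = (\int[P]_g nu g B)%E.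

(** The sets are the balls of radius [1/(k+1)] around a dense sequence; those of infinite measure
    are replaced by the empty set, and local finiteness ensures that the others still cover [X]. *)
Lemma finite_cover : (forall x : X, exists V : set X, [/\ open V, V x & (mu V < +oo)%E]) ->
  exists A : nat -> set (borel X), [/\ forall n, measurable (A n),
    forall n, (mu (A n) < +oo)%E & \bigcup_n A n = setT].
Proof.
move=> loc; have [d dP] := dense_seq sepX.
pose B (n : nat) : set (borel X) := if (unpickle n : option (nat * nat)%type) is Some ik then
  [set y | mdist (d ik.1) y < ik.2.+1%:R^-1 :> R] else set0.
have mB n : measurable (B n).
  rewrite /B; case: unpickle => [ik|]; last exact: measurable0.
  by apply: sub_sigma_algebra; exact: open_mdist.
exists (fun n => if (mu (B n) < +oo)%E then B n else set0); split.
- by move=> n; case: ifPn.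
- by move=> n; case: ifPn => //; rewrite measure0.
apply/seteqP; split=> // x _.
have [V [oV Vx muV]] := loc x.
have [e e0 He] := (nbhs_mdist _ _).1 (open_nbhs_nbhs (conj oV Vx)).
have [j je] := @natSinv_lt _ (e / 2) ltac:(lra).
have [i xi] := dP x _ (@natSinv_gt0 R j).
have BV : B (pickle (i, j)) `<=` V.
  rewrite /B pickleK => y /= iy; apply: He.
  by have := metric_triangle x (d i) y; move: je xi iy; set r : R := j.+1%:R^-1; lra.
exists (pickle (i, j)) => //; rewrite ifT; first by rewrite /B pickleK /= metric_sym.
apply: le_lt_trans muV; apply: le_measure; rewrite ?inE//.
exact: sub_sigma_algebra.
Qed.

(** [Y] is a union of closed inner approximations of the projection, so each [M n] vanishes on the
    part of [G] not lying over [Y]. Since almost every [nu g] is carried by the section of [G], it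
    follows that [nu g] vanishes on [A n] minus [Y] for almost every [g], and integration gives the
    claim for [mu]. *)
Lemma full_projection (G : set (borel (frag X) * borel X)) :
  (forall x : X, exists V : set X, [/\ open V, V x & (mu V < +oo)%E]) ->
  measurable G ->
  {ae P, forall g, nu g (~` xsection G g) = 0%E} ->
  exists Y : set (borel X), [/\ measurable Y, Y `<=` snd @` G & mu (~` Y) = 0%E].
Proof.
move=> /finite_cover[A [mA muA UA]] mG aeG.
have [d dP] := dense_seq sepX.
(* The restrictions of nu g to A n, replaced by 0 on the P-null set of g with
   nu g (A n) infinite, form a kernel of finite measures. *)
pose nf n g := (nu g (A n) < +oo)%E.
pose kr n g : {measure set (borel X) -> \bar R} := mrestr (nu g) (mA n).
pose kz : {measure set (borel X) -> \bar R} := mzero.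
pose k n (g : borel (frag X)) := if nf n g then kr n g else kz.
have kE n g B : k n g B = if nf n g then nu g (B `&` A n) else 0%E.
  by rewrite /k; case: ifP.
have mk n B : measurable B -> measurable_fun setT (k n ^~ B).
  move=> mB; rewrite (_ : k n ^~ B =
    (fun g : borel (frag X) => if nf n g then nu g (B `&` A n) else 0%E)); last first.
    by apply/funext => g; exact: kE.
  apply: measurable_fun_ifT => //.
    apply: measurable_fun_lte => //; exact: mnu.
  by apply: mnu; exact: measurableI.
have kfin n g : (k n g setT < +oo)%E by rewrite kE setTI; case: ifP.
have kle n g B : measurable B -> (k n g B <= nu g (B `&` A n))%E.
  by rewrite kE; case: ifP => // _ _; exact: measure_ge0.
have /choice[M ME] n : exists M : {measure set (borel (frag X) * borel X)%type -> \bar R},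
    forall E, M E = (\int[P]_g k n g (xsection E g))%E.
  by apply: disintegration; [exact: mk|exact: kfin].
have xT g : xsection [set: borel (frag X) * borel X] g = setT.
  by apply/seteqP; split=> x //= _; rewrite /xsection/= inE.
have Mfin n : (M n setT < +oo)%E.
  apply: le_lt_trans (muA n); rewrite ME muE//; apply: ge0_le_integral => //.
  - exact: (measurable_fun_section (mk n) (kfin n) measurableT).
  - exact: mnu.
  - by move=> g _; rewrite xT; apply: le_trans (kle n g _ measurableT) _; rewrite setTI.
have /choice[K KP] (nm : nat * nat) : exists K : set X, [/\ closed K, K `<=` snd @` G &
    (M nm.1 (G `&` [set z | ~ K z.2]) <= (nm.2.+1%:R^-1)%:E)%E].
  by apply: (closed_inner_projection dP (Mfin nm.1)) => //; exact: natSinv_gt0.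
pose Y : set (borel X) := [set x | exists nm, K nm x].
have mY : measurable Y.
  by apply: measurable_exists => nm; apply: closed_borel; case: (KP nm).
exists Y; split=> //; first by move=> x [nm Kx]; have [_ + _] := KP nm; apply.
have mGY : measurable (G `&` [set z | (~` Y) z.2]).
  apply: measurableI => //.
  by apply: measurable_preimage_snd; exact: measurableC.
have MY n : M n (G `&` [set z | (~` Y) z.2]) = 0%E.
  apply/eqP; rewrite -measure_le0; apply/lee_addgt0Pr => e e0; rewrite add0e.
  have [m me] := natSinv_lt e0.
  have [cK _ Km] := KP (n, m).
  apply: (le_trans _ (le_trans Km _)); last by rewrite lee_fin ltW.
  apply: le_measure; rewrite ?inE//.
    apply: measurableI => //.
    apply: (@measurable_preimage_snd _ _ _ (borel X) (~` K (n, m))).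
    by apply: measurableC; exact: closed_borel.
  by move=> z [Gz nY]; split=> // Kz; apply: nY; exists (n, m).
have muAY n : mu (A n `&` ~` Y) = 0%E.
  rewrite muE; last by apply: measurableI => //; exact: measurableC.
  (* The integral of [nu g (A n)] is [mu (A n)], which is finite; so the kernel was replaced by 0
     only on a null set of fragments. *)
  have ae1 : {ae P, forall g, nu g (A n) \is a fin_num}.
    have /integrable_ae : P.-integrable setT (fun g => nu g (A n)).
      apply/integrableP; split; first exact: mnu.
      under eq_integral do rewrite gee0_abs//.
      by rewrite -muE.
    by move=> /(_ measurableT); apply: filterS => g; apply.
  have ae2 : {ae P, forall g, k n g (xsection (G `&` [set z | (~` Y) z.2]) g) = 0%E}.
    have := MY n; rewrite ME => I0.
    have mks := measurable_fun_section (mk n) (kfin n) mGY.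
    have := (ae_eq_integral_abs P measurableT mks).1.
    under eq_integral do rewrite gee0_abs//.
    by move=> /(_ I0); apply: filterS => g; apply.
  have ae0 : ae_eq P setT (fun g => nu g (A n `&` ~` Y)) (cst 0%E).
    move: aeG ae1 ae2; apply: filterS3; first exact: (ae_filter_ringOfSetsType P).
    move=> g G0 fing k0 _ /=.
    have mGg : measurable (xsection G g) by exact: measurable_xsection.
    apply/eqP; rewrite -measure_le0.
    apply: (le_trans (y := nu g ((xsection G g `&` ~` Y `&` A n) `|` ~` xsection G g))).
      apply: le_measure; rewrite ?inE.
      - by apply: measurableI => //; exact: measurableC.
      - apply: measurableU; last exact: measurableC.
        by apply: measurableI => //; apply: measurableI => //; exact: measurableC.
      - move=> x [Ax nYx]; have [Gx|nGx] := pselect (xsection G g x); [left|right] => //.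
    apply: le_trans (measureU2 _ _ _) _.
    - by apply: measurableI => //; apply: measurableI => //; exact: measurableC.
    - exact: measurableC.
    rewrite [X in (_ + X)%E](_ : _ = 0%E); last exact: G0.
    rewrite adde0; move: k0; rewrite kE /nf -ge0_fin_numE// fing.
    rewrite (_ : xsection (G `&` _) g = xsection G g `&` ~` Y).
      by move=> k0; rewrite [leLHS]k0.
    by apply/seteqP; split=> x; rewrite /xsection /= !inE.
  rewrite (ae_eq_integral (cst 0%E) _ measurableT) ?integral0//.
  by apply: mnu; apply: measurableI => //; exact: measurableC.
apply/eqP; rewrite -measure_le0 -(setTI (~` Y)) -UA setI_bigcupl.
apply: (le_trans (measure_sigma_subadditive _ _ _ (@subset_refl _ _))).
- by move=> n; apply: measurableI => //; exact: measurableC.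
- by apply: bigcupT_measurable => n; apply: measurableI => //; exact: measurableC.
by rewrite eseries0// => n _ _; exact: muAY.
Qed.

End full_projection.

(** * Density points and approximate continuity *)

Section density.
Context {R : realType}.
Local Notation leb := (@lebesgue_measure R).

Lemma le_leb (A B : set R) : measurable A -> measurable B -> A `<=` B ->
  (leb A <= leb B)%E.
Proof. by move=> mA mB AB; apply: le_measure; rewrite ?inE. Qed.

Lemma leb_ball_gt0 (t r : R) : 0 < r ->
  leb (ball t r) = (r *+ 2)%:E /\ leb (ball t r) \is a fin_num.
Proof. by move=> r0; rewrite lebesgue_measure_ball ?ltW. Qed.

(** The density quotient is at most 1, so only lower bounds matter; and the measure of [A] in a ball
    grows with the radius, so rational radii suffice. This expresses density by countably many
    conditions. *)
Lemma density_pointP (A : set R) (t : R) : measurable A -> density_point A t <->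
  forall n, exists m, forall q : rat, 0 < (ratr q : R) < (m.+1%:R^-1 : R) ->
    (((1 - n.+1%:R^-1) * (ratr q *+ 2))%:E <= leb (A `&` ball t (ratr q)))%E.
Proof.
move=> mA.
have mAb r : measurable (A `&` ball t r) by apply: measurableI => //; exact: measurable_ball.
have fAb r : leb (A `&` ball t r) \is a fin_num.
  have [r0|r0] := ltP 0 r.
    rewrite ge0_fin_numE//; apply: (@le_lt_trans _ _ (leb (ball t r))).
      by apply: le_leb => //; exact: measurable_ball.
    by rewrite (leb_ball_gt0 t r0).1 ltry.
  by rewrite (_ : ball t r = set0) ?setI0 ?measure0//; exact/ball0.
have leAb r s : r <= s -> (leb (A `&` ball t r) <= leb (A `&` ball t s))%E.
  by move=> rs; apply: le_leb => //; apply: setIS; exact: le_ball.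
have E r : 0 < r -> (leb (A `&` ball t r) * (leb (ball t r))^-1)%E =
    (fine (leb (A `&` ball t r)) / (r *+ 2))%:E.
  move=> r0; rewrite (leb_ball_gt0 t r0).1 inver gt_eqF ?mulrn_wgt0//.
  by rewrite -[X in (X * _)%E](fineK (fAb r)) -EFinM.
split.
  move=> dp n.
  have [e /= e0 He] : (\forall r \near (0 : R)^'+, 
      ((1 - n.+1%:R^-1)%:E <= leb (A `&` ball t r) * (leb (ball t r))^-1)%E).
    have n1 : nbhs (1%:E : \bar R) [set y | ((1 - n.+1%:R^-1)%:E < y)%E].
      apply: open_nbhs_nbhs; split; first exact: open_ereal_gt_ereal.
      by rewrite /= lte_fin ltrBlDr ltrDl natSinv_gt0.
    by near=> r; apply: ltW; near: r; exact: (dp _ n1).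
  have [m me] := natSinv_lt e0; exists m => q /andP[q0 qm].
  have := He (ratr q); rewrite /= sub0r normrN gtr0_norm// => /(_ (lt_trans qm me) q0).
  rewrite E// lee_fin ler_pdivlMr ?mulrn_wgt0// -lee_fin fineK//.
move=> H.
suff : (fun r => (fine (leb (A `&` ball t r)) / (r *+ 2))%:E) r @[r --> 0^'+] --> 1%:E.
  apply: cvg_trans; apply: near_eq_cvg; near=> r; rewrite E//.
apply: cvg_EFin; first by near=> r.
apply/cvgrPdist_le => e e0.
have [n ne] := natSinv_lt e0; have [m Hm] := H n.
near=> r.
have r0 : 0 < r by near: r; exact: nbhs_right_gt.
have rm : r < m.+1%:R^-1 by near: r; apply: nbhs_right_lt; exact: natSinv_gt0.
rewrite /= ger0_norm; last first.
  rewrite subr_ge0 ler_pdivrMr ?mulrn_wgt0// mul1r -lee_fin fineK//.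
  rewrite -(leb_ball_gt0 t r0).1; apply: le_leb => //; exact: measurable_ball.
rewrite lerBlDr -lerBlDl ler_pdivlMr ?mulrn_wgt0//.
apply: (le_trans (y := (1 - n.+1%:R^-1) * (r *+ 2))).
  apply: ler_wpM2r; first by rewrite mulrn_wge0// ltW.
  by rewrite lerD2l lerN2 ltW.
apply/ler_addgt0Pr => d d0.
(* Passing from [r] to the rational radius [q] shortens the ball by less than [d]. *)
have [q] : exists q : rat, ratr q \in `]Num.max 0 (r - d / 2), r[.
  by apply: rat_in_itvoo; rewrite gt_max r0/=; lra.
rewrite in_itv/= gt_max => /andP[/andP[q0 qd] qr].
have := Hm q; rewrite q0 (lt_trans qr rm) => /(_ isT).
move=> /le_trans/(_ (leAb _ _ (ltW qr))).
rewrite -(fineK (fAb r)) lee_fin => h.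
have n1 : n.+1%:R^-1 <= 1 :> R by rewrite invf_le1// ler1n.
have n0 := @natSinv_gt0 R n.
move: n1 n0 h; set a : R := n.+1%:R^-1; set u : R := ratr q in qd qr *.
set v := fine _; rewrite /= !mulr2n => a1 a0 h.
suff : (1 - a) * (r - u) <= d / 2 by nra.
have : (1 - a) * (r - u) <= 1 * (r - u) by rewrite ler_wpM2r//; lra.
by lra.
Unshelve. all: by end_near. Qed.

Lemma sub_density_point (A B : set R) (t : R) : measurable A -> measurable B ->
  A `<=` B -> density_point A t -> density_point B t.
Proof.
move=> mA mB AB /density_pointP-/(_ mA) H; apply/density_pointP => // n.
have [m Hm] := H n; exists m => q /Hm/le_trans; apply.
by apply: le_leb; [apply: measurableI => //; exact: measurable_ball..|exact: setSI].
Qed.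

Context {dO} {O : measurableType dO}.
Implicit Types B E : set (O * R).

Lemma measurable_density B : measurable B ->
  measurable [set z : O * R | density_point (xsection B z.1) z.2].
Proof.
move=> mB.
have -> : [set z : O * R | density_point (xsection B z.1) z.2] =
  [set z : O * R | forall n, exists m, forall q : rat, 0 < (ratr q : R) < (m.+1%:R^-1 : R) ->
    (((1 - n.+1%:R^-1) * (ratr q *+ 2))%:E <= leb (xsection B z.1 `&` ball z.2 (ratr q)))%E].
  by apply/seteqP; split=> z /=; move/density_pointP => H;
    [apply: H|apply: H]; exact: measurable_xsection.
apply: measurable_forall => n; apply: measurable_exists => m.
apply: measurable_forall => q; apply: measurable_implP => _.
(* The section of [C] at [(w, t)] is the section of [B] at [w] intersected with the ball around [t],
   so its Lebesgue measure is a measurable function of [(w, t)]. *)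
pose C : set ((O * R) * R) := [set w | B (w.1.1, w.2)] `&` [set w | `|w.1.2 - w.2| < ratr q].
have mC : measurable C.
  apply: measurableI.
    have : measurable_fun [set: (O * R) * R] (fun w : (O * R) * R => (w.1.1, w.2)).
      apply: measurable_fun_pair; last exact: measurable_snd.
      by apply: measurableT_comp; [exact: measurable_fst|exact: measurable_fst].
    by move=> /(_ measurableT B mB); rewrite setTI.
  have : measurable_fun [set: (O * R) * R] (fun w : (O * R) * R => `|w.1.2 - w.2|).
    apply: measurableT_comp => //; apply: measurable_funB; last exact: measurable_snd.
    by apply: measurableT_comp; [exact: measurable_snd|exact: measurable_fst].
  move=> /(_ measurableT `]-oo, ratr q[%classic (measurable_itv _)); rewrite setTI.
  by congr (measurable _); apply/seteqP; split=> w /=; rewrite in_itv.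
have mf := measurable_fun_xsection leb mC.
rewrite [X in measurable X](_ : _ = setT `&`
    (leb \o xsection C) @^-1` `[((1 - n.+1%:R^-1) * (ratr q *+ 2))%:E, +oo[%classic); last first.
  rewrite setTI; apply/seteqP; split=> -[w t] /=; rewrite in_itv/= andbT;
  rewrite (_ : xsection B w `&` ball t (ratr q) = xsection C (w, t))//;
  by apply/seteqP; split=> s; rewrite /xsection/= !inE /C /ball.
by apply: mf => //; exact: emeasurable_itv.
Qed.

(** The classical fact that a measurable function is approximately continuous almost everywhere,
    with a parameter in [O], so as to obtain a jointly measurable set of good points. *)
Lemma ap_continuous_thick E (h : O * R -> R) : measurable E -> measurable_fun E h ->
  exists Q : set (O * R), [/\ measurable Q,
    forall z, Q z -> ap_continuous (xsection E z.1) (fun s => h (z.1, s)) z.2 &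
    forall w, leb.-negligible [set t | E (w, t) /\ ~ Q (w, t)]].
Proof.
move=> mE mh.
pose B (q : rat * rat) := E `&` h @^-1` `]ratr q.1, ratr q.2[%classic.
have mB q : measurable (B q) by apply: mh => //; exact: measurable_itv.
(* h is approximately continuous at a density point of all the B q containing it *)
pose Q := E `&` [set z | forall q, B q z -> density_point (xsection (B q) z.1) z.2].
exists Q; split.
- apply: measurableI => //; apply: measurable_forall => q; apply: measurable_impl => //.
  exact: measurable_density.
- move=> [w t] [/= Ewt Hwt]; split; first by rewrite /xsection/= inE.
  move=> e e0.
  have [q1] : exists q : rat, ratr q \in `]h (w, t) - e, h (w, t)[.
    by apply: rat_in_itvoo; lra.
  have [q2] : exists q : rat, ratr q \in `]h (w, t), h (w, t) + e[.
    by apply: rat_in_itvoo; lra.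
  rewrite !in_itv/= => /andP[h1 h2] /andP[h3 h4].
  have Bt : B (q1, q2) (w, t) by split => //=; rewrite in_itv/= h4.
  apply: sub_density_point (Hwt _ Bt).
  + exact: measurable_xsection.
  + rewrite (_ : _ `&` _ = xsection (E `&` h @^-1` `]h (w, t) - e, h (w, t) + e[%classic) w).
      by apply: measurable_xsection; apply: mh => //; exact: measurable_itv.
    apply/seteqP; split=> s; rewrite /xsection/= !inE/= in_itv/= ltr_norml => -[Es k];
      by split => //; move: k; lra.
  + move=> s; rewrite /xsection/= !inE => -[Es /=]; rewrite in_itv/= => /andP[k1 k2].
    by split => //; rewrite ltr_norml; lra.
- move=> w.
  have dq q : leb.-negligible [set t | B q (w, t) /\ ~ density_point (xsection (B q) w) t].
    have := @lebesgue_density R (xsection (B q) w) (measurable_xsection _ (mB q)).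
    apply: negligibleS => t /= [Bt nd] /= dp; apply: nd.
    by move: dp; rewrite indicE mem_set// /xsection/= inE.
  have : leb.-negligible (\bigcup_n (if unpickle n is Some q then
      [set t | B q (w, t) /\ ~ density_point (xsection (B q) w) t] else set0)).
    by apply: negligible_bigcup => n; case: unpickle => // *; exact: negligible_set0.
  apply: negligibleS => t /= [Et /not_andP[//|/existsNP[q /not_implyP[Bq nd]]]].
  by exists (pickle q); [exact: I|rewrite pickleK].
Qed.

End density.

(** * Measurability of derivatives along fragments *)

Section fragment_measurability.
Context {R : realType} {X : completeMetricType R}.
Variable d : nat -> X.
Hypothesis dP : forall x (e : R), 0 < e -> exists i, mdist x (d i) < e.

Local Notation hs g := (hyperspace_set (graph g)).
Local Notation box := (@box R X d).
Local Notation fR := (borel (frag X) * R)%type.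

(** The Borel conditions available on a fragment are that its graph meets an open set. Moving the
    time window to a rational centre turns the statement into countably many of these. *)
Lemma measurable_near_dom (W : set X) : open W -> measurable [set z : fR |
  forall e : R, 0 < e -> exists s, [/\ dom z.1 s, `|s - z.2| < e & W (fpoint z.1 s)]].
Proof.
move=> oW.
rewrite [X in measurable X](_ : _ = [set z : fR | forall n : nat, exists q : rat,
    [set z : fR | `|z.2 - ratr q| < n.+1%:R^-1] z /\
    [set z : fR | [set g | hs g `&` [set p | `|p.1 - ratr q| < n.+1%:R^-1 /\ W p.2] !=set0] z.1] z]).
  apply: measurable_forall => n; apply: measurable_exists => q; apply: measurableI.
    apply: (@measurable_preimage_snd _ _ _ _ [set t : R | `|t - ratr q| < n.+1%:R^-1]).
    by rewrite dist_ballE; exact: measurable_ball.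
  apply: measurable_preimage_fst; apply: measurable_hit.
  apply: openI.
    apply: (@open_comp _ _ fst [set t : R | `|t - ratr q| < n.+1%:R^-1]).
      by move=> z _; exact: cvg_fst.
    by rewrite dist_ballE; exact: ball_open.
  by apply: (@open_comp _ _ snd W) => // z _; exact: cvg_snd.
apply/seteqP; split=> -[g t] /= H.
- move=> n; have [s [gs st Ws]] := H _ (@natSinv_gt0 R n).
  have [q] : exists q : rat, ratr q \in `](Num.max s t) - n.+1%:R^-1, (Num.min s t) + n.+1%:R^-1[.
    apply: rat_in_itvoo; move: (@natSinv_gt0 R n) st; set r : R := n.+1%:R^-1 => r0.
    by rewrite ltr_norml => /andP[]; rewrite /Num.max /Num.min; case: (ltP s t); lra.
  rewrite in_itv/= => /andP[]; rewrite ltrBlDr gt_max => /andP[h1 h2].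
  rewrite -ltrBlDr lt_min => /andP[h3 h4].
  move: h1 h2 h3 h4; set r : R := n.+1%:R^-1; set u : R := ratr q => h1 h2 h3 h4.
  exists q; rewrite -/r -/u; split; first by rewrite ltr_norml; lra.
  exists (s, fpoint g s); split; first exact: fpointP.
  by split => //=; rewrite -/r -/u ltr_norml; lra.
- move=> e e0; have [n ne] := @natSinv_lt _ (e / 2) ltac:(lra).
  have [q [h1 [[s x] [gs [/= h2 Wx]]]]] := H n.
  have [/= gs' xE] := (graphE g _).1 gs.
  exists s; split => //; last by rewrite -xE.
  have := ler_distD (ratr q) s t; rewrite (distrC (ratr q) t).
  by move: h1 h2 ne; set r : R := n.+1%:R^-1; lra.
Qed.

Lemma measurable_dom : measurable [set z : fR | dom z.1 z.2].
Proof.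
rewrite (_ : [set _ | _] = [set z : fR | forall e : R, 0 < e ->
  exists s, [/\ dom z.1 s, `|s - z.2| < e & setT (fpoint z.1 s)]]).
  by apply: measurable_near_dom; exact: openT.
apply/seteqP; split=> -[g t] /= H.
  by move=> e e0; exists t; rewrite subrr normr0.
apply: (@dom_closed _ _ g) => B /nbhs_ballP[e /= e0 eB].
have [s [gs st _]] := H e e0; exists s; split => //; apply: eB.
by rewrite /ball/= distrC.
Qed.

(** Times near [t] whose points lie in a ball put the point at [t] in the closed ball, by the
    Lipschitz bound. So [W] is exhausted by the balls around the dense sequence whose closed
    versions lie in [W]. *)
Lemma measurable_dom_fpoint_open (W : set X) : open W ->
  measurable [set z : fR | dom z.1 z.2 /\ W (fpoint z.1 z.2)].
Proof.
move=> oW.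
pose B (j : nat * nat) := [set y | mdist (d j.1) y < j.2.+1%:R^-1 :> R].
rewrite (_ : [set _ | _] = [set z : fR | dom z.1 z.2] `&` [set z : fR | exists j : nat * nat,
  (forall y, mdist (d j.1) y <= j.2.+1%:R^-1 -> W y) /\
  [set z : fR | forall e : R, 0 < e ->
    exists s, [/\ dom z.1 s, `|s - z.2| < e & B j (fpoint z.1 s)]] z]).
  apply: measurableI; first exact: measurable_dom.
  apply: measurable_exists => j; apply: measurable_andP => _.
  by apply: measurable_near_dom; exact: open_mdist.
apply/seteqP; split=> -[g t] /=.
- move=> [gt Wt]; split => //.
  have [e e0 He] := (nbhs_mdist _ _).1 (open_nbhs_nbhs (conj oW Wt)).
  have [n ne] := @natSinv_lt _ (e / 2) ltac:(lra).
  have [i it] := dP (fpoint g t) (@natSinv_gt0 R n).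
  exists (i, n); split => /=.
    move=> y iy; apply: He; have := metric_triangle (fpoint g t) (d i) y.
    by move: ne it iy; set r : R := n.+1%:R^-1; lra.
  by move=> e' e'0; exists t; rewrite subrr normr0 /B/= metric_sym.
- move=> [gt [[i n] [/= HW H]]]; split => //; apply: HW.
  have [L L0 HL] := fpoint_lipschitz g.
  apply/ler_addgt0Pr => e e0.
  have L1 : 0 < L + 1 by lra.
  have [s [gs st /= Bs]] := H (e / (L + 1)) ltac:(by rewrite divr_gt0).
  have := metric_triangle (d i) (fpoint g s) (fpoint g t).
  have : (L + 1) * `|s - t| <= e by rewrite -ler_pdivlMl// mulrC ltW.
  have := HL _ _ gs gt; have := normr_ge0 (s - t); move: Bs; rewrite /B/=.
  by set r : R := n.+1%:R^-1; lra.
Qed.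

Lemma measurable_fun_fpoint :
  measurable_fun [set z : fR | dom z.1 z.2] (fun z : fR => fpoint z.1 z.2 : borel X).
Proof.
apply: (@measurability _ _ fR (borel X) _ _ (@open X)) => // _ [W oW <-].
exact: measurable_dom_fpoint_open.
Qed.

Lemma measurable_dom_fpoint (B : set (borel X)) : measurable B ->
  measurable [set z : fR | dom z.1 z.2 /\ B (fpoint z.1 z.2)].
Proof. by move=> mB; apply: measurable_fun_fpoint => //; exact: measurable_dom. Qed.

(** [V] is a union of products of two boxes. The first box constrains the point at time [z.2]; the
    existence of [s] becomes the condition that the graph meets the second box. *)
Lemma measurable_ex_graph (V : set ((R * X) * (R * X))) : open V ->
  measurable [set z : fR | dom z.1 z.2 /\
    exists s, dom z.1 s /\ V ((z.2, fpoint z.1 z.2), (s, fpoint z.1 s))].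
Proof.
move=> oV.
rewrite (_ : [set _ | _] = [set z : fR | exists j j', (box j `*` box j' `<=` V) /\
  ([set z : fR | dom z.1 z.2 /\ mdist (fpoint z.1 z.2) (d j.1.2) < radius j] `&`
  [set z : fR | `|z.2 - ratr j.1.1| < radius j] `&`
  [set z : fR | [set g | hs g `&` box j' !=set0] z.1]) z]).
  apply: measurable_exists => j; apply: measurable_exists => j'.
  apply: measurable_andP => _; apply: measurableI; first apply: measurableI.
  - apply: (measurable_dom_fpoint_open (W := [set y | mdist y (d j.1.2) < radius j])).
    rewrite (_ : [set y | _] = [set y | mdist (d j.1.2) y < radius j]).
      exact: open_mdist.
    by apply/seteqP; split=> y; rewrite /= metric_sym.
  - apply: (@measurable_preimage_snd _ _ _ _ [set t : R | `|t - ratr j.1.1| < radius j]).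
    by rewrite dist_ballE; exact: measurable_ball.
  - by apply: measurable_preimage_fst; apply: measurable_hit; exact: open_box.
apply/seteqP; split=> -[g t] /=.
- move=> [gt [s [gs Vts]]].
  have [[A B] /= [nA nB] ABV] := open_nbhs_nbhs (conj oV Vts).
  have [e e0 He] := (nbhs_pair_mdist _ _).1 nA.
  have [e' e'0 He'] := (nbhs_pair_mdist _ _).1 nB.
  have [j [jt _ Hj]] := small_box dP (t, fpoint g t) e0.
  have [j' [js _ Hj']] := small_box dP (s, fpoint g s) e'0.
  exists j, j'; split.
    move=> [p q] [/= /subset_box_cbox/Hj[p1 p2] /subset_box_cbox/Hj'[q1 q2]].
    by apply: ABV; split => /=; [exact: He|exact: He'].
  case: jt => /= jt1 jt2; split => //.
  by exists (s, fpoint g s); split => //; exact: fpointP.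
- move=> [j [j' [jV [[[gt jt2] jt1] [[s x] [gs js]]]]]].
  have [/= gs' xE] := (graphE g _).1 gs; subst x.
  by split => //; exists s; split => //; apply: jV.
Qed.

(** * Difference quotients along fragments *)

Section derivative.
Variable f : X -> R.
Hypothesis fL : lipschitz_fun f.

Lemma lipschitz_fun_continuous : continuous f.
Proof.
move=> x; have [L HL] := fL; apply/cvgrPdist_le => e e0.
apply/nbhs_mdist; exists (e / (`|L| + 1)).
  by rewrite divr_gt0// ltr_wpDl.
move=> y; rewrite ltr_pdivlMr ?ltr_wpDl// => xy.
apply: (le_trans (HL x y)); apply: (le_trans _ (ltW xy)).
rewrite mulrC ler_wpM2l ?mdist_ge0//.
by apply: (le_trans (ler_norm _)); rewrite lerDl.
Qed.

(** The inequality that the difference quotient exceeds [b], multiplied by the square of the time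
    increment. Without the division the expression is continuous on all pairs, and its positivity is
    an open condition. *)
Let F b (w : (R * X) * (R * X)) : R :=
  (f w.2.2 - f w.1.2 - b * (w.2.1 - w.1.1)) * (w.2.1 - w.1.1).

Lemma open_quotient b (r : R) :
  open [set w : (R * X) * (R * X) | 0 < `|w.2.1 - w.1.1| < r /\ 0 < F b w].
Proof.
have c11 : continuous (fun w : (R * X) * (R * X) => w.1.1).
  by move=> w; apply: (@continuous_comp _ _ _ fst fst); exact: cvg_fst.
have c21 : continuous (fun w : (R * X) * (R * X) => w.2.1).
  by move=> w; apply: (@continuous_comp _ _ _ snd fst); [exact: cvg_snd|exact: cvg_fst].
have cf12 : continuous (fun w : (R * X) * (R * X) => f w.1.2).
  move=> w; apply: (@continuous_comp _ _ _ (fun w : (R * X) * (R * X) => w.1.2) f).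
    by apply: (@continuous_comp _ _ _ fst snd); [exact: cvg_fst|exact: cvg_snd].
  exact: lipschitz_fun_continuous.
have cf22 : continuous (fun w : (R * X) * (R * X) => f w.2.2).
  move=> w; apply: (@continuous_comp _ _ _ (fun w : (R * X) * (R * X) => w.2.2) f).
    by apply: (@continuous_comp _ _ _ snd snd); exact: cvg_snd.
  exact: lipschitz_fun_continuous.
have cd : continuous (fun w : (R * X) * (R * X) => w.2.1 - w.1.1).
  by move=> w; apply: cvgB; [exact: c21|exact: c11].
rewrite (_ : [set w | _] = (fun w : (R * X) * (R * X) => `|w.2.1 - w.1.1|) @^-1` `]0, r[%classic
    `&` F b @^-1` `]0, +oo[%classic); last first.
  apply/seteqP; split=> w /=; rewrite !in_itv/= andbT => -[? ?]; split => //.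
apply: openI; apply: open_comp.
- by move=> w _; apply: cvg_norm; exact: cd.
- exact: interval_open.
- move=> w _; apply: cvgM; last exact: cd.
  apply: cvgB; first by apply: cvgB; [exact: cf22|exact: cf12].
  by apply: cvgM; [exact: cvg_cst|exact: cd].
- exact: interval_open.
Qed.

(** Statements about derivatives are reduced to these sets: the negation bounds by [b] all
    difference quotients at scale [r], and bounds from below come from [\- f]. *)
Definition quotient_gt (b r : R) : set fR := [set z : fR | dom z.1 z.2 /\
  exists s, [/\ dom z.1 s, 0 < `|s - z.2| < r & b < diff_quotient (f \o fpoint z.1) z.2 s]].

Lemma quotient_gtE b (h : R -> R) (s t : R) : 0 < `|s - t| ->
  (b < diff_quotient h t s) = (0 < (h s - h t - b * (s - t)) * (s - t)).
Proof.
rewrite normr_gt0 /diff_quotient => st.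
have -> : (h s - h t - b * (s - t)) * (s - t) = ((h s - h t) / (s - t) - b) * (s - t) ^+ 2.
  by field.
by rewrite pmulr_lgt0 ?exprn_even_gt0// subr_gt0.
Qed.

Lemma measurable_quotient_gt b r : measurable (quotient_gt b r).
Proof.
rewrite (_ : quotient_gt b r = [set z : fR | dom z.1 z.2 /\
    exists s, dom z.1 s /\ [set w : (R * X) * (R * X) | 0 < `|w.2.1 - w.1.1| < r /\ 0 < F b w]
     ((z.2, fpoint z.1 z.2), (s, fpoint z.1 s))]).
  by apply: measurable_ex_graph; exact: open_quotient.
apply/seteqP; split=> -[g t] /= [gt [s]].
- move=> [gs str]; have /andP[st _] := str; rewrite quotient_gtE// => H.
  by split => //; exists s.
- move=> [gs [/= str H]]; split => //; exists s; split => //; have /andP[st _] := str.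
  by rewrite quotient_gtE.
Qed.

End derivative.

Lemma lipschitz_funN (f : X -> R) : lipschitz_fun f -> lipschitz_fun (\- f).
Proof. by move=> [L HL]; exists L => x y; rewrite /= -opprD normrN. Qed.

Lemma lipschitz_fun_cst (c : R) : lipschitz_fun (fun _ : X => c).
Proof. by exists 0 => x y; rewrite subrr normr0 mul0r. Qed.

Lemma diff_quotientN (h : R -> R) (s t : R) :
  diff_quotient (\- h) t s = - diff_quotient h t s.
Proof. by rewrite /diff_quotient -mulNr opprD. Qed.

(** The Cauchy criterion: the approximate value [c] depends on [e], so it can be taken rational, and
    no quantifier over the limit remains. *)
Lemma cauchy_derivable_in (D : set R) (h : R -> R) (t : R) : D t -> limit_point D t ->
  (forall e, 0 < e -> exists c, exists2 r, 0 < r &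
    forall s, D s -> 0 < `|s - t| < r -> `|diff_quotient h t s - c| < e) ->
  derivable_in D h t.
Proof.
move=> Dt lp H; split => //; have FP := within_proper lp.
apply: cauchy_cvg; apply: cauchy_exP => e e0; have [c [r r0 Hr]] := H e e0.
exists c; apply/within_dnbhsP; exists r => // s Ds str.
by rewrite /ball/= distrC; exact: Hr.
Qed.

Definition quotient_within (f : X -> R) (n : nat) (q : rat) (m : nat) : set fR :=
  [set z : fR | ~ quotient_gt f (ratr q + n.+1%:R^-1) m.+1%:R^-1 z /\
    ~ quotient_gt (\- f) (- ratr q + n.+1%:R^-1) m.+1%:R^-1 z].

Lemma quotient_withinP f n q m (z : fR) : dom z.1 z.2 -> quotient_within f n q m z <->
  forall s, dom z.1 s -> 0 < `|s - z.2| < m.+1%:R^-1 ->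
    `|diff_quotient (f \o fpoint z.1) z.2 s - ratr q| <= n.+1%:R^-1.
Proof.
move=> zt; split.
- move=> [n1 n2] s gs st; rewrite ler_norml; apply/andP; split.
    rewrite lerBrDl leNgt; apply/negP => h; apply: n2; split => //; exists s; split => //.
    rewrite (_ : (\- f) \o _ = \- (f \o fpoint z.1))// diff_quotientN ltrNr.
    by rewrite opprD opprK.
  rewrite lerBlDl leNgt; apply/negP => h; apply: n1; split => //; by exists s.
- move=> H; split=> -[_ [s [gs st]]]; apply/negP; rewrite -leNgt.
    by have := H s gs st; rewrite ler_norml => /andP[_]; rewrite lerBlDl.
  rewrite (_ : (\- f) \o _ = \- (f \o fpoint z.1))// diff_quotientN.
  have := H s gs st; rewrite ler_norml => /andP[+ _]; rewrite lerBrDl.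
  by rewrite -[in X in _ -> X](opprK n.+1%:R^-1) -opprD lerN2.
Qed.

(* For f = 0 and b = -1 the inequality in quotient_gt always holds. *)
Lemma limit_point_domP g t : dom g t -> limit_point (dom g) t <->
  forall n, quotient_gt (fun _ : X => 0) (-1) n.+1%:R^-1 (g, t).
Proof.
move=> gt; have q0 s : diff_quotient ((fun _ : X => 0) \o fpoint g) t s = 0.
  by rewrite /diff_quotient/= subrr mul0r.
split.
  move=> /limit_pointP_dist H n; split => //=; have [s gs st] := H _ (@natSinv_gt0 R n).
  by exists s; split => //; rewrite q0 oppr_lt0.
move=> H; apply/limit_pointP_dist => e e0; have [n ne] := natSinv_lt e0.
have [_ [s [/= gs /andP[st1 st2] _]]] := H n; exists s => //.
by rewrite st1 (lt_trans st2).
Qed.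

Lemma fderivableE (f : X -> R) : [set z : fR | fderivable z.1 f z.2] =
  [set z : fR | dom z.1 z.2] `&`
  [set z : fR | forall n, quotient_gt (fun _ : X => 0) (-1) n.+1%:R^-1 z] `&`
  [set z : fR | forall n, exists q m, quotient_within f n q m z].
Proof.
apply/seteqP; split=> -[g t] /=.
- move=> /derivable_inP[gt lp [l Hl]].
  split; first by split => //; apply/limit_point_domP.
  move=> n; have n0 := @natSinv_gt0 R n.
  have [r r0 Hr] := Hl (n.+1%:R^-1 / 2) ltac:(by rewrite divr_gt0).
  have [m mr] := natSinv_lt r0.
  have [q] : exists q : rat, ratr q \in `]l - n.+1%:R^-1 / 2, l + n.+1%:R^-1 / 2[.
    by apply: rat_in_itvoo; rewrite ltrBlDr -addrA ltrDl addr_gt0 ?divr_gt0.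
  rewrite in_itv/= => /andP[q1 q2].
  exists q, m; apply/quotient_withinP => // s gs /andP[st1 st2].
  have := Hr s gs; rewrite st1 (lt_trans st2 mr) => /(_ isT).
  rewrite !ler_norml => /andP[h1 h2]; move: q1 q2 h1 h2.
  by set a : R := n.+1%:R^-1; lra.
- move=> [[gt lp] H]; apply: cauchy_derivable_in => //; first exact/limit_point_domP.
  move=> e e0; have [n ne] := natSinv_lt e0; have [q [m /quotient_withinP-/(_ gt) Hq]] := H n.
  exists (ratr q), m.+1%:R^-1; first exact: natSinv_gt0.
  by move=> s gs st; apply: le_lt_trans ne; exact: Hq.
Qed.

Lemma measurable_fderivable (f : X -> R) : lipschitz_fun f ->
  measurable [set z : fR | fderivable z.1 f z.2].
Proof.
move=> fL; rewrite fderivableE; apply: measurableI; first apply: measurableI.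
- exact: measurable_dom.
- apply: measurable_forall => n; apply: measurable_quotient_gt; exact: lipschitz_fun_cst.
- apply: measurable_forall => n; apply: measurable_exists => q; apply: measurable_exists => m.
  apply: measurableI; apply: measurableC; apply: measurable_quotient_gt => //.
  exact: lipschitz_funN.
Qed.

(** The right-hand side says that all difference quotients at scale [1/(m+1)] are at least
    [a + 1/(n+1)]; this margin keeps the inequality strict in the limit. *)
Lemma fderive_gtP (f : X -> R) g t (a : R) : fderivable g f t ->
  a < fderive g f t <-> exists n m, ~ quotient_gt (\- f) (- (a + n.+1%:R^-1)) m.+1%:R^-1 (g, t).
Proof.
move=> df; have [gt lp _] := df; have Hd := derive_inP df; rewrite -/(fderive g f t) in Hd *.
split.
- move=> al; have [n na] := @natSinv_lt _ ((fderive g f t - a) / 2) ltac:(lra).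
  have [r r0 Hr] := Hd ((fderive g f t - a) / 2) ltac:(lra).
  have [m mr] := natSinv_lt r0; exists n, m => -[_ [s [/= gs /andP[st1 st2]]]].
  rewrite (_ : (\- f) \o _ = \- (f \o fpoint g))// diff_quotientN ltrN2.
  have := Hr s gs; rewrite st1 (lt_trans st2 mr) => /(_ isT).
  rewrite ler_norml => /andP[+ _]; rewrite -/(fderive g f t); move: na.
  by set b : R := n.+1%:R^-1; lra.
- move=> [n [m H]]; rewrite ltNge; apply/negP => la.
  have n0 := @natSinv_gt0 R n.
  have [r r0 Hr] := Hd (n.+1%:R^-1 / 2) ltac:(by rewrite divr_gt0).
  have rm : 0 < Num.min r m.+1%:R^-1 by rewrite lt_min r0 natSinv_gt0.
  have [s gs /andP[st1 st2]] := (limit_pointP_dist _ _).1 lp _ rm.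
  move: st2; rewrite lt_min => /andP[str stm].
  apply: H; split => //; exists s; split => //; first by rewrite st1 stm.
  rewrite (_ : (\- f) \o _ = \- (f \o fpoint g))// diff_quotientN ltrN2 /=.
  have := Hr s gs; rewrite st1 str => /(_ isT); rewrite ler_norml => /andP[_].
  move: n0 la; rewrite -/(fderive g f t).
  by set b : R := n.+1%:R^-1; lra.
Qed.

Lemma measurable_fun_fderive (f : X -> R) : lipschitz_fun f ->
  measurable_fun [set z : fR | fderivable z.1 f z.2] (fun z : fR => fderive z.1 f z.2).
Proof.
move=> fL; apply: (@measurability _ _ _ _ _ _ (@RGenOInfty.G R)).
  exact: RGenOInfty.measurableE.
move=> _ [_ [a ->] <-].
rewrite (_ : _ `&` _ = [set z : fR | fderivable z.1 f z.2] `&`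
  [set z : fR | exists n m, ~ quotient_gt (\- f) (- (a + n.+1%:R^-1)) m.+1%:R^-1 z]).
  apply: measurableI; first exact: measurable_fderivable.
  apply: measurable_exists => n; apply: measurable_exists => m; apply: measurableC.
  by apply: measurable_quotient_gt; exact: lipschitz_funN.
apply/seteqP; split=> -[g t] [/= df]; rewrite ?in_itv/= ?andbT => H; split => //=.
  exact/fderive_gtP.
exact/fderive_gtP.
Qed.

End fragment_measurability.

(** * Genericity almost everywhere *)

Section thick.
Context {R : realType} {X : completeMetricType R}.
Variable d : nat -> X.
Hypothesis dP : forall x (e : R), 0 < e -> exists i, mdist x (d i) < e.

Local Notation leb := (@lebesgue_measure R).
Local Notation fR := (borel (frag X) * R)%type.

(** The almost everywhere notion for genericity. Null sets of times are required for every fragment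
    and not for almost every one, so the same set [Q] serves for all the measures [P_k]. *)
Definition thick (Pr : frag X -> R -> Prop) := exists Q : set fR,
  [/\ measurable Q, forall g t, Q (g, t) -> Pr g t &
      forall g, leb.-negligible [set t | dom g t /\ ~ Q (g, t)]].

Lemma sub_thick (Pr Pr' : frag X -> R -> Prop) : (forall g t, Pr g t -> Pr' g t) ->
  thick Pr -> thick Pr'.
Proof. by move=> sPr [Q [mQ QP nQ]]; exists Q; split => // g t /QP/sPr. Qed.

Lemma thick_forall (I : countType) (Pr : I -> frag X -> R -> Prop) :
  (forall i, thick (Pr i)) -> thick (fun g t => forall i, Pr i g t).
Proof.
move=> /choice[Q QP]; exists [set z | forall i, Q i z]; split.
- by apply: measurable_forall => i; case: (QP i).
- by move=> g t H i; have [_ + _] := QP i; apply; exact: H.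
move=> g.
have : leb.-negligible (\bigcup_n (if unpickle n is Some i then
    [set t | dom g t /\ ~ Q i (g, t)] else set0)).
  apply: negligible_bigcup => n; case: unpickle => [i|]; last exact: negligible_set0.
  by case: (QP i).
apply: negligibleS => t /= [gt /existsNP[i nQ]].
by exists (pickle i); [by []|rewrite pickleK].
Qed.

Lemma thickT : thick (fun _ _ => True).
Proof.
exists setT; split => // g.
by apply: negligibleS (negligible_set0 _) => t [_ []].
Qed.

Lemma thick_and (Pr Pr' : frag X -> R -> Prop) :
  thick Pr -> thick Pr' -> thick (fun g t => Pr g t /\ Pr' g t).
Proof.
move=> tP tP'; apply: (@sub_thick (fun g t => forall b : bool, (if b then Pr else Pr') g t)).
  by move=> g t H; split; [exact: (H true)|exact: (H false)].
by apply: thick_forall => -[].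
Qed.

Lemma thick_countable (T : Type) (K : set T) (Pr : T -> frag X -> R -> Prop) :
  countable K -> (forall x, K x -> thick (Pr x)) ->
  thick (fun g t => forall x, K x -> Pr x g t).
Proof.
move=> /countable_injP[f finj] H.
apply: (@sub_thick (fun g t => forall n x, K x -> f x = n -> Pr x g t)).
  by move=> g t H' x Kx; exact: (H' (f x)).
apply: thick_forall => n.
have [[x [Kx fx]]|nx] := pselect (exists x, K x /\ f x = n).
  apply: sub_thick (H x Kx) => g t Px y Ky fy.
  by rewrite (finj y x) ?inE// fx.
apply: sub_thick thickT => g t _ x Kx fx.
by exfalso; apply: nx; exists x.
Qed.

Lemma thick_ap_continuous (E : set fR) (h : fR -> R) : measurable E -> measurable_fun E h ->
  (forall g, leb.-negligible [set t | dom g t /\ ~ E (g, t)]) ->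
  thick (fun g t => ap_continuous [set s | E (g, s)] (fun s => h (g, s)) t).
Proof.
move=> mE mh nE; have [Q [mQ QP nQ]] := ap_continuous_thick mE mh.
exists Q; split => //.
  move=> g t /QP /=; rewrite (_ : xsection E g = [set s | E (g, s)])//.
  by apply/seteqP; split=> s; rewrite /xsection/= inE.
move=> g; apply: negligibleS (negligibleU (nE g) (nQ g)) => t /= [gt nQt].
by have [Et|nEt] := pselect (E (g, t)); [right|left].
Qed.

Lemma thick_density : thick (fun g t => dom g t /\ density_point (dom g) t).
Proof.
have mD := @measurable_dom R X.
have sD (g : frag X) : xsection [set z : fR | dom z.1 z.2] g = dom g.
  by apply/seteqP; split=> s; rewrite /xsection/= inE.
exists ([set z : fR | dom z.1 z.2] `&`
  [set z : fR | density_point (xsection [set z : fR | dom z.1 z.2] z.1) z.2]); split.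
- by apply: measurableI => //; exact: measurable_density.
- by move=> g t [/= gt]; rewrite sD.
- move=> g; apply: negligibleS (lebesgue_density (dom_measurable g)) => t /= [gt nd] dp.
  apply: nd; split => //; rewrite sD.
  by move: dp; rewrite indicE mem_set.
Qed.

Lemma fderivable_ae (f : X -> R) (g : frag X) : lipschitz_fun f ->
  leb.-negligible [set t | dom g t /\ ~ fderivable g f t].
Proof.
move=> [K HK]; have [L L0 HL] := fpoint_lipschitz g.
have := @ae_derivable_in R (dom g) (f \o fpoint g) (`|K| * L) (dom_measurable g).
have H s t : dom g s -> dom g t ->
    `|(f \o fpoint g) s - (f \o fpoint g) t| <= `|K| * L * `|s - t|.
  move=> gs gt; apply: (le_trans (HK _ _)); rewrite -mulrA.
  apply: (@le_trans _ _ (`|K| * mdist (fpoint g s) (fpoint g t))).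
    by rewrite ler_wpM2r ?mdist_ge0// ler_norm.
  by rewrite ler_wpM2l//; exact: HL.
move=> /(_ H); apply: negligibleS => t /= [gt nd] /(_ gt).
exact: nd.
Qed.

Lemma thick_fderive (f : X -> R) : lipschitz_fun f ->
  thick (fun g t => ap_continuous (fderivable g f) (fderive g f) t).
Proof.
move=> fL; apply: (@thick_ap_continuous [set z : fR | fderivable z.1 f z.2]
  (fun z : fR => fderive z.1 f z.2)).
- exact: (measurable_fderivable dP).
- exact: (measurable_fun_fderive dP).
- by move=> g; exact: fderivable_ae.
Qed.

Lemma thick_comp (u : borel X -> R) : measurable_fun setT u ->
  thick (fun g t => ap_continuous (dom g) (u \o fpoint g) t).
Proof.
move=> mu; apply: (@thick_ap_continuous [set z : fR | dom z.1 z.2]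
  (fun z : fR => u (fpoint z.1 z.2))).
- exact: measurable_dom.
- apply: (@measurable_comp _ _ _ _ _ _ setT u) => //.
  exact: (measurable_fun_fpoint dP).
- move=> g; apply: negligibleS (negligible_set0 _) => t /= [gt]; exact.
Qed.

Lemma lipschitz_pseudometric (rho : X -> X -> R) (K : R) (x : X) : pseudometric rho ->
  (forall x y, rho x y <= K * mdist x y) ->
  forall y z, `|rho y x - rho z x| <= K * mdist y z.
Proof.
move=> [r0 rxx rC rT] rK y z; rewrite ler_norml; apply/andP; split.
  by have := rT z y x; have := rK z y; rewrite (metric_sym z); lra.
by have := rT y z x; have := rK y z; lra.
Qed.

Lemma fderive_le (f : X -> R) (K L : R) (g : frag X) (t : R) : 0 <= K ->
  (forall y z, `|f y - f z| <= K * mdist y z) ->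
  (forall s t, dom g s -> dom g t -> mdist (fpoint g s) (fpoint g t) <= L * `|s - t|) ->
  fderivable g f t -> `|fderive g f t| <= K * L.
Proof.
move=> K0 fK gL df; have [gt lp _] := df; apply/ler_addgt0Pr => e e0.
have [r r0 Hr] := derive_inP df e0.
have [s gs str] := (limit_pointP_dist _ _).1 lp _ r0.
have := Hr s gs str; have /andP[st0 _] := str.
have : `|diff_quotient (f \o fpoint g) t s| <= K * L.
  rewrite /diff_quotient normrM normfV ler_pdivrMr// -mulrA.
  by apply: (le_trans (fK _ _)); rewrite ler_wpM2l//; exact: gL.
rewrite -/(fderive g f t) distrC => h1 h2.
by have := ler_normD (fderive g f t - diff_quotient (f \o fpoint g) t s)
  (diff_quotient (f \o fpoint g) t s); rewrite subrK; lra.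
Qed.

(** A supremum over a nonempty bounded set exceeds [a] exactly when some term does, which is a
    countable union. Boundedness holds because the derivatives are at most [|K| * L], where [L] is a
    Lipschitz constant of the fragment. *)
Lemma thick_sup (rho : X -> X -> R) (K : R) (D : set X) : pseudometric rho ->
  (forall x y, rho x y <= K * mdist x y) -> countable D -> D !=set0 ->
  thick (fun g t => ap_continuous [set s | forall x, D x -> fderivable g (rho^~ x) s]
    (fun s => sup [set `|fderive g (rho^~ x) s| | x in D]) t).
Proof.
move=> prho rK cD [x0 Dx0].
have rK' x y : rho x y <= `|K| * mdist x y.
  by apply: (le_trans (rK x y)); rewrite ler_wpM2r ?mdist_ge0// ler_norm.
have rL x : lipschitz_fun (rho^~ x) by exists `|K|; exact: lipschitz_pseudometric.
have [e esurj] := pcard_surjP cD.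
(* The enumeration [e] reaches all of [D] but may also take values outside [D], whence the guards
   [D (e n)]. *)
have De x : D x -> exists2 n, D (e n) & e n = x.
  by move=> Dx; have [n _ en] := esurj x Dx; exists n => //; rewrite en.
pose E : set fR := [set z | forall x, D x -> fderivable z.1 (rho^~ x) z.2].
pose h (z : fR) := sup [set `|fderive z.1 (rho^~ x) z.2| | x in D].
have mE : measurable E.
  rewrite (_ : E = [set z : fR | forall n, D (e n) -> [set z : fR | fderivable z.1 (rho^~ (e n)) z.2] z]).
    apply: measurable_forall => n; apply: measurable_implP => _.
    exact: (measurable_fderivable dP).
  apply/seteqP; split=> -[g t] /= H; first by move=> n Dn; exact: H.
  by move=> x /De[n Dn <-]; exact: H.
apply: (@thick_ap_continuous E h) => //.
- apply: (@measurability _ _ _ _ _ _ (@RGenOInfty.G R)).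
    exact: RGenOInfty.measurableE.
  move=> _ [_ [a ->] <-].
  rewrite (_ : _ `&` _ = E `&` [set z : fR | exists n, D (e n) /\
      (E `&` (fun z : fR => `|fderive z.1 (rho^~ (e n)) z.2|) @^-1` `]a, +oo[%classic) z]).
    apply: measurableI => //; apply: measurable_exists => n; apply: measurable_andP => Dn.
    have : measurable_fun E (fun z : fR => `|fderive z.1 (rho^~ (e n)) z.2|).
      apply: measurableT_comp => //.
      apply: (measurable_funS (measurable_fderivable dP (rL (e n)))).
        by move=> z; apply.
      exact: (measurable_fun_fderive dP).
    by apply => //; exact: measurable_itv.
  apply/seteqP; split=> -[g t] /= [Egt].
    rewrite in_itv/= andbT => /sup_gt.
    move=> []; first by exists `|fderive g (rho^~ x0) t|, x0.
    move=> _ [x /De[n Dn <-] <-] ax; split=> //; exists n; split => //; split => //=.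
    by rewrite in_itv/= ax.
  move=> [n [Dn [_]]]; rewrite !in_itv/= !andbT => an; split => //.
  apply: (lt_le_trans an); apply: ub_le_sup; last by exists (e n).
  have [L L0 HL] := fpoint_lipschitz g.
  exists (`|K| * L) => _ [x Dx <-]; apply: fderive_le => //; last exact: Egt.
  exact: lipschitz_pseudometric.
- move=> g.
  have : leb.-negligible (\bigcup_n [set t | dom g t /\ ~ fderivable g (rho^~ (e n)) t]).
    by apply: negligible_bigcup => n; exact: fderivable_ae.
  apply: negligibleS => t /= [gt /existsNP[x /not_implyP[Dx nd]]].
  by have [n Dn en] := De x Dx; exists n => //=; rewrite en.
Qed.

Lemma thick_generic (F C : set (X -> R)) (S : set (X -> X -> R)) (D : set X)
    (I : countType) (N : I -> nat) (U : I -> set X) (phi : forall a : I, X -> 'rV[R]_(N a)) :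
  generic_data F C S D U phi -> thick (generic F C S D).
Proof.
move=> [[cF [Fl _]] [cC [Cm _]] [cS [Sp _]] [cD dD]].
have D0 : D !=set0.
  by have [||x [_ Dx]] := dD setT; [exists point|exact: openT|exists x].
apply: (@sub_thick (fun g t => (dom g t /\ density_point (dom g) t) /\
    (forall f, F f -> ap_continuous (fderivable g f) (fderive g f) t) /\
    (forall u, C u -> ap_continuous (dom g) (u \o fpoint g) t) /\
    (forall x, D x -> forall rho, S rho ->
      ap_continuous (fderivable g (rho^~ x)) (fderive g (rho^~ x)) t) /\
    (forall rho, S rho -> ap_continuous
          [set s | forall x, D x -> fderivable g (rho^~ x) s]
          (fun s => sup [set `|fderive g (rho^~ x) s| | x in D]) t))).
  by move=> g t [? [? [? [H ?]]]]; split => // x rho Dx Srho; exact: H.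
apply: thick_and; first exact: thick_density.
apply: thick_and.
  by apply: thick_countable => // f /Fl; exact: thick_fderive.
apply: thick_and.
  by apply: thick_countable => // u /Cm[mu _]; exact: thick_comp.
apply: thick_and.
  apply: thick_countable => // x Dx; apply: thick_countable => // rho /Sp[prho [K rK]].
  apply: thick_fderive; exists K; exact: lipschitz_pseudometric.
by apply: thick_countable => // rho /Sp[prho [K rK]]; exact: thick_sup rK _ _.
Qed.

End thick.

(** * Almost every point lies on a good fragment *)

Section hausdorff_null.
Context {R : realType} {X : completeMetricType R}.
Local Notation leb := (@lebesgue_measure R).

Lemma diam_ge0 (E : set X) : (0 <= diam E)%E.
Proof. by apply: ereal_sup_ubound; left. Qed.

Lemma diam_le (E : set X) (r : R) : 0 <= r ->
  (forall x y, E x -> E y -> mdist x y <= r) -> (diam E <= r%:E)%E.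
Proof.
move=> r0 H; apply: ge_ereal_sup => _ [->|[x Ex [y Ey <-]]].
  by rewrite lee_fin.
by rewrite lee_fin; exact: H.
Qed.

Lemma hausdorff1_pre_ge0 (delta : R) (A : set X) : (0 <= hausdorff1_pre delta A)%E.
Proof.
apply: le_ereal_inf_tmp => _ [E _ <-]; apply: nneseries_ge0 => k _ _.
exact: diam_ge0.
Qed.

(** Lebesgue measure is the outer measure built from lengths of half-open intervals; an empty member
    of a cover is written []0, 0]]. *)
Lemma null_cover (A : set R) (e : R) : leb.-negligible A -> 0 < e ->
  exists I : nat -> R * R, [/\ forall k, (I k).1 <= (I k).2,
    A `<=` \bigcup_k `](I k).1, (I k).2]%classic &
    (\sum_(k <oo) ((I k).2 - (I k).1)%:E <= e%:E)%E].
Proof.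
move=> [B [mB B0 AB]] e0.
have : (leb B < e%:E)%E by rewrite [leb B]B0 lte_fin.
rewrite /lebesgue_measure /lebesgue_stieltjes_measure /measure_extension /mu_ext.
move=> /ereal_inf_lt[_ [F [mF BF] <-] Fe].
have /choice[I IP] k : exists I : R * R, I.1 <= I.2 /\ F k = `]I.1, I.2]%classic.
  have /ocitvP[->|[[a b] /= ab ->]] := mF k; last by exists (a, b); split => //; exact: ltW.
  by exists (0, 0); split => //=; rewrite set_itvoc0.
exists I; split.
- by move=> k; case: (IP k).
- move=> x /AB/BF[k _]; rewrite (IP k).2 => Fx; by exists k.
- apply: le_trans (ltW Fe); apply: lee_nneseries => k _.
    by rewrite lee_fin subr_ge0; case: (IP k).
  have [Ik ->] := IP k; rewrite le_eqVlt; apply/orP; left; apply/eqP/esym.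
  exact: wlength_itv_bnd.
Qed.

Lemma hausdorff1_fpoint_null (g : frag X) (A : set R) : leb.-negligible A ->
  A `<=` dom g -> hausdorff1 (fpoint g @` A) = 0%E.
Proof.
move=> A0 Ag; have [L L0 HL] := fpoint_lipschitz g.
apply/eqP; rewrite eq_le; apply/andP; split; last first.
  apply: (le_trans (hausdorff1_pre_ge0 1 (fpoint g @` A))).
  by apply: ereal_sup_ubound; exists 1 => //=.
apply: ge_ereal_sup => _ [delta /= delta0 <-].
apply/lee_addgt0Pr => e e0; rewrite add0e.
have L1 : 0 < L + 1 by lra.
(* After stretching by [L + 1] the intervals have total length at most [e], and each of them, being
   bounded by the total, has length at most [delta]. *)
have e'0 : 0 < Num.min e delta / (L + 1) by rewrite divr_gt0// lt_min e0.
have [I [Ile AI Isum]] := null_cover A0 e'0.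
have I0 k : 0 <= (I k).2 - (I k).1 by rewrite subr_ge0.
have dE k : (diam (fpoint g @` (A `&` `](I k).1, (I k).2]%classic)) <=
    ((L + 1) * ((I k).2 - (I k).1))%:E)%E.
  apply: diam_le; first by rewrite mulr_ge0// ltW.
  move=> _ _ [s [As /= Is] <-] [t [At /= It] <-].
  apply: (le_trans (HL _ _ (Ag _ As) (Ag _ At))).
  apply: (le_trans (y := L * ((I k).2 - (I k).1))); last by rewrite ler_wpM2r//; lra.
  rewrite ler_wpM2l// ler_norml; move: Is It; rewrite !in_itv/= => /andP[? ?] /andP[? ?].
  by apply/andP; split; lra.
have Ile' k : (I k).2 - (I k).1 <= Num.min e delta / (L + 1).
  rewrite -lee_fin; apply: le_trans Isum.
  have /(_ k.+1) := @nneseries_lim_ge R (fun k => ((I k).2 - (I k).1)%:E) xpredT 0%N.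
  move=> /(_ (fun i _ _ => I0 i)); apply: le_trans.
  by rewrite big_nat_recr//= leeDr// sume_ge0// => i _; rewrite lee_fin.
apply: (@le_trans _ _ (\sum_(k <oo) diam (fpoint g @` (A `&` `](I k).1, (I k).2]%classic)))%E).
  apply: ereal_inf_lbound; exists (fun k => fpoint g @` (A `&` `](I k).1, (I k).2]%classic)) => //.
  split.
    by move=> _ [t At <-]; have [k _ Ik] := AI _ At; exists k => //; exists t.
  move=> k; apply: (le_trans (dE k)); rewrite lee_fin mulrC -ler_pdivlMr//.
  apply: (le_trans (Ile' k)); rewrite ler_pM2r ?invr_gt0//.
  by rewrite ge_min lexx orbT.
apply: (@le_trans _ _ (\sum_(k <oo) ((L + 1)%:E * ((I k).2 - (I k).1)%:E))%E).
  apply: lee_nneseries => [k *|k *]; first exact: diam_ge0.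
  by rewrite -EFinM.
rewrite nneseriesZl; last by move=> k _; rewrite lee_fin.
apply: (@le_trans _ _ ((L + 1)%:E * (Num.min e delta / (L + 1))%:E)%E).
  by apply: lee_wpmul2l => //; rewrite lee_fin ltW.
rewrite -EFinM lee_fin mulrC divfK ?gt_eqF//.
by rewrite ge_min lexx.
Qed.

End hausdorff_null.

(** * Measurable choice of a passage time *)

Section first_hit.
Context {R : realType} {X : completeMetricType R}.
Variable d : nat -> X.
Hypothesis dP : forall x (e : R), 0 < e -> exists i, mdist x (d i) < e.

Local Notation hs g := (hyperspace_set (graph g)).
Local Notation leb := (@lebesgue_measure R).
Local Notation fX := (borel (frag X) * borel X)%type.
Local Notation fR := (borel (frag X) * R)%type.

Definition hits (a b : R) : set fX :=
  [set z | exists t, [/\ dom z.1 t, a <= t <= b & fpoint z.1 t = z.2]].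

(** Passages up to an error [1/(k+1)] in time and space are countable combinations of open
    conditions. Approximate passage times accumulate, because the part of the domain in
    [[a - 1, b + 1]] is compact, and an accumulation point is an exact passage. *)
Lemma measurable_hits a b : measurable (hits a b).
Proof.
pose r k : R := k.+1%:R^-1.
pose W i k := [set p : R * X | (a - r k < p.1 < b + r k) /\ mdist (d i) p.2 < r k].
have oW i k : open (W i k).
  apply: openI.
    apply: (@open_comp _ _ fst [set t : R | a - r k < t < b + r k]).
      by move=> z _; exact: cvg_fst.
    have := @interval_open R (BRight (a - r k)) (BLeft (b + r k)).
    by rewrite set_itvE/=; apply.
  apply: (@open_comp _ _ snd [set y | mdist (d i) y < r k]).
    by move=> z _; exact: cvg_snd.
  exact: open_mdist.
rewrite [X in measurable X](_ : _ = [set z : fX | forall k : nat, exists i : nat,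
    [set z : fX | [set x | mdist (d i) x < r k] z.2] z /\
    [set z : fX | [set g | hs g `&` W i k !=set0] z.1] z]).
  apply: measurable_forall => k; apply: measurable_exists => i; apply: measurableI.
    by apply: measurable_preimage_snd; apply: open_borel; exact: open_mdist.
  by apply: measurable_preimage_fst; exact: measurable_hit.
apply/seteqP; split=> -[g x] /=.
- move=> [t [gt /andP[at_ tb] tx]] k; have [i xi] := dP x (@natSinv_gt0 R k).
  exists i; split; first by rewrite metric_sym.
  exists (t, fpoint g t); split; first exact: fpointP.
  have := @natSinv_gt0 R k; rewrite -/(r k) => rk.
  by split => /=; [lra|rewrite tx metric_sym].
- move=> H.
  have /choice[t tP] k : exists t, [/\ dom g t, a - r k < t < b + r k & mdist (fpoint g t) x < 2 * r k].
    have [i [ix [[t y] [gt [/= abt iy]]]]] := H k; have [/= gt' yE] := (graphE g _).1 gt.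
    exists t; split => //; rewrite -yE.
    by have := metric_triangle y (d i) x; rewrite (metric_sym y (d i)); lra.
  have r1 k : r k <= 1 by rewrite /r invf_le1// ler1n.
  have [L L0 HL] := fpoint_lipschitz g.
  pose A := `[a - 1, b + 1]%classic `&` dom g.
  have cA : compact A by apply: compact_closedI; [exact: segment_compact|exact: dom_closed].
  have FA : (t @ \oo) A.
    exists 0%N => // k _; have [gt abt _] := tP k; split => //=.
    by rewrite in_itv/=; have := r1 k; lra.
  have [s [[_ gs] cs]] := cA _ _ FA.
  have near_s e : 0 < e -> exists k, r k < e /\ `|s - t k| < e.
    move=> e0; have [n ne] := natSinv_lt e0.
    have Fn : (t @ \oo) [set t k | k in [set k | (n <= k)%N]].
      by exists n => // k /= nk; exists k.
    have [_ [[k /= nk <-] sk]] := cs _ _ Fn (nbhsx_ballx s e e0).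
    by exists k; split => //; apply: le_lt_trans ne; exact: natSinv_le.
  exists s; split => //.
    apply/andP; split; apply/ler_addgt0Pr => e e0.
      have [k [rk]] := near_s (e / 2) ltac:(lra).
      by have [_ ? _] := tP k; rewrite ltr_norml; lra.
    have [k [rk]] := near_s (e / 2) ltac:(lra).
    by have [_ ? _] := tP k; rewrite ltr_norml; lra.
  apply: mdist_positivity; apply/eqP; rewrite eq_le mdist_ge0 andbT.
  apply/ler_addgt0Pr => e e0; rewrite add0r.
  (* The distance is at most [L * |s - t k|] plus the error [2 * r k] of the approximate passage,
     whence [L + 2]. *)
  have e'0 : 0 < e / (L + 2) by rewrite divr_gt0//; lra.
  have [k [rk sk]] := near_s _ e'0; have [gt _ tx] := tP k.
  have := metric_triangle (fpoint g s) (fpoint g (t k)) x; have := HL _ _ gs gt.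
  have : L * `|s - t k| <= L * (e / (L + 2)) by rewrite ler_wpM2l// ltW.
  have -> : L * (e / (L + 2)) = e - 2 * (e / (L + 2)) by field; rewrite gt_eqF//; lra.
  by move: rk sk tx; set u := e / (L + 2); lra.
Qed.

Lemma measurable_fpoint_image (g : frag X) (a b : R) :
  measurable (fpoint g @` (dom g `&` `[a, b]) : set (borel X)).
Proof.
rewrite (_ : _ @` _ = xsection (hits a b) g).
  by apply: measurable_xsection; exact: measurable_hits.
apply/seteqP; split=> x; rewrite /xsection/= inE.
  by move=> [t [gt /=]]; rewrite in_itv/= => abt tx; exists t.
by move=> [t [/= gt abt tx]]; exists t => //; split => //=; rewrite in_itv.
Qed.

(* A fragment may pass several times through a point; taking the first passage
   in [-b, b] selects one of them measurably. When there is none the infimum of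
   the empty set gives 0. *)
Definition first_hit (b : R) (z : fX) : R :=
  inf [set t | [/\ dom z.1 t, - b <= t <= b & fpoint z.1 t = z.2]].

(** The infimum is attained, since the domain is closed and the fragment is continuous on it. *)
Lemma first_hitP b z : hits (- b) b z ->
  [/\ dom z.1 (first_hit b z), - b <= first_hit b z <= b &
    fpoint z.1 (first_hit b z) = z.2].
Proof.
case: z => g x [t0 /= [gt0 abt0 tx0]].
set T := [set t | [/\ dom g t, - b <= t <= b & fpoint g t = x]].
have hT : has_inf T by split; [exists t0|exists (- b) => t [_ /andP[]]].
rewrite /first_hit/= -/T.
have [L L0 HL] := fpoint_lipschitz g.
have nT e : 0 < e -> exists2 t, T t & inf T <= t < inf T + e.
  move=> e0; have [t Tt te] := inf_adherent e0 hT; exists t => //; rewrite te andbT.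
  by apply: ge_inf => //; exact: hT.2.
have gT : dom g (inf T).
  apply: (@dom_closed _ _ g) => B /nbhs_ballP[e /= e0 eB].
  have [t [gt _ _] /andP[h1 h2]] := nT e e0; exists t; split => //; apply: eB.
  by rewrite /ball/= ltr_norml; lra.
split => //.
  apply/andP; split; first by apply: lb_le_inf; [exists t0|move=> t [_ /andP[]]].
  apply: (@le_trans _ _ t0); last by case/andP: abt0.
  by apply: ge_inf => //; exact: hT.2.
apply: mdist_positivity; apply/eqP; rewrite eq_le mdist_ge0 andbT.
apply/ler_addgt0Pr => e e0; rewrite add0r.
have L1 : 0 < L + 1 by lra.
have [t [gt _ <-] /andP[h1 h2]] := nT (e / (L + 1)) ltac:(by rewrite divr_gt0).
apply: (le_trans (HL _ _ gT gt)); rewrite ler0_norm; last by lra.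
have : L * (t - inf T) <= (L + 1) * (t - inf T) by rewrite ler_wpM2r//; lra.
have : (L + 1) * (t - inf T) <= e by rewrite -ler_pdivlMl//; rewrite mulrC; lra.
by rewrite opprB; lra.
Qed.

Lemma measurable_first_hit b : measurable_fun setT (first_hit b).
Proof.
apply: (@measurability _ _ _ _ _ _ (@RGenOInfty.G R)).
  exact: RGenOInfty.measurableE.
move=> _ [_ [c ->] <-]; rewrite setTI.
(* The first passage is later than [c] when there is a passage in [[-b, b]] but none up to
   [min c b]; without any passage the value is 0, and the condition reads [c < 0]. *)
rewrite [X in measurable X](_ : _ = (hits (- b) b `&` ~` hits (- b) (Num.min c b)) `|`
    (~` hits (- b) b `&` [set z : fX | c < 0])).
  apply: measurableU; apply: measurableI; try (apply: measurableC); try exact: measurable_hits.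
  exact: measurable_Prop.
apply/seteqP; split=> z /=; rewrite in_itv/= andbT.
- move=> cz; have [hz|nhz] := pselect (hits (- b) b z); [left|right].
    split => // -[t [zt /andP[bt]]]; rewrite le_min => /andP[tc tb] tz.
    move: cz; rewrite ltNge => /negP; apply; apply: le_trans tc.
    apply: ge_inf; first by exists (- b) => s [_ /andP[]].
    by split => //; rewrite bt.
  split => //; move: cz; rewrite /first_hit (_ : [set t | _] = set0) ?inf0//.
  by apply/seteqP; split => // t [? ? ?]; apply: nhz; exists t.
- move=> [[hz nh]|[nh c0]]; last first.
    rewrite /first_hit (_ : [set t | _] = set0) ?inf0//.
    by apply/seteqP; split => // t [? ? ?]; apply: nh; exists t.
  have [zt /andP[bt tb] tz] := first_hitP hz.
  rewrite ltNge; apply/negP => tc; apply: nh; exists (first_hit b z); split => //.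
  by rewrite bt le_min tc.
Qed.

Section good_points.
Variables (mu : {measure set (borel X) -> \bar R})
  (P : {measure set (borel (frag X)) -> \bar R})
  (nu : frag X -> {measure set (borel X) -> \bar R}).
Hypothesis sepX : separable X.
Hypothesis albP : alberti mu P nu.

Lemma alberti_image (g : frag X) (B : set (borel X)) : measurable B ->
  (forall t, dom g t -> ~ B (fpoint g t)) -> nu g B = 0%E.
Proof.
move=> mB nB; have [_ _ ac _ _] := albP; apply: (ac g B) => // B' mB' B'B.
rewrite (_ : _ `&` _ = fpoint g @` set0).
  apply: hausdorff1_fpoint_null => //; exact: negligible_set0.
rewrite image_set0; apply/seteqP; split => // x [/B'B Bx [t gt tx]].
by apply: (nB t gt); rewrite tx.
Qed.

(** It is enough that each point of [B] on the fragment is reached at one time of the null set [A],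
    whatever the other passages: the part of the image in [B] is then a Lipschitz image of a null
    set. *)
Lemma alberti_null (g : frag X) (A : set R) (B : set (borel X)) : measurable B ->
  leb.-negligible A -> (forall t, dom g t -> B (fpoint g t) -> exists s,
    [/\ A s, dom g s & fpoint g s = fpoint g t]) -> nu g B = 0%E.
Proof.
move=> mB A0 AB; have [_ _ ac _ _] := albP; apply: (ac g B) => // B' mB' B'B.
rewrite (_ : _ `&` _ = fpoint g @` (A `&` [set t | dom g t /\ B' (fpoint g t)])).
  apply: hausdorff1_fpoint_null; last by move=> t [_ []].
  by apply: negligibleS A0 => t [].
apply/seteqP; split => x.
  move=> [B'x [t gt tx]]; have [|s [As gs st]] := AB t gt; first by rewrite tx; exact: B'B.
  by exists s; rewrite ?st//; split => //; split => //; rewrite st tx.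
by move=> [t [At [gt B't]] <-]; split => //; exists t.
Qed.

(** The definition of [alberti] gives measurability for the traces of [B] on the images of
    [[-n, n]]. As [nu g] does not charge the complement of the image of [g], these traces exhaust
    [B] up to a null set, and the values converge monotonically. *)
Lemma alberti_measurable (B : set (borel X)) : measurable B ->
  measurable_fun [set: borel (frag X)] (fun g => nu g B).
Proof.
move=> mB; have [_ _ _ _ H] := albP.
pose A (g : frag X) (n : nat) : set (borel X) :=
  B `&` (fpoint g @` (dom g `&` `[- n%:R, n%:R])).
have mA g n : measurable (A g n).
  by apply: measurableI => //; exact: measurable_fpoint_image.
have nd (g : frag X) : nondecreasing_seq (A g).
  move=> m n mn; apply/subsetPset => x [Bx [t [gt /=]]].
  rewrite in_itv/= => /andP[h1 h2] tx; split => //; exists t => //; split => //=.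
  have : m%:R <= n%:R :> R by rewrite ler_nat.
  by rewrite in_itv/=; lra.
have lim g : nu g (A g n) @[n --> \oo] --> nu g B.
  have -> : nu g B = nu g (\bigcup_n A g n).
    have mU : measurable (\bigcup_n A g n) by exact: bigcupT_measurable.
    have mBU : measurable (B `\` \bigcup_n A g n) by exact: measurableD.
    have UB : \bigcup_n A g n `<=` B by move=> x [n _ []].
    have BU0 : nu g (B `\` \bigcup_n A g n) = 0%E.
      apply: alberti_image => // t gt [Bt]; apply.
      exists (Num.bound `|t|) => //; split => //; exists t => //; split => //=.
      have : `|t| <= (Num.bound `|t|)%:R :> R by apply/ltW/archi_boundP.
      by rewrite in_itv/= ler_norml.
    have /setDUK <- := UB.
    rewrite measureU// ?setDIK//.
    by rewrite [X in (_ + X)%E]BU0 adde0.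
  apply: nondecreasing_cvg_mu => //; exact: bigcupT_measurable.
apply: (emeasurable_fun_cvg (fun n (g : borel (frag X)) => nu g (A g n))).
  by move=> n; apply: H => //; rewrite lerNl (@le_trans _ _ 0)// oppr_le0.
by move=> g _; exact: lim.
Qed.

(** [Q] is tested at the first passage in [[-n, n]], which keeps [G] measurable. A point of a
    fragment that fails the test for every [n] is reached at some time outside [Q], so for almost
    every fragment the failing points are negligible. *)
Lemma good_points (Q : set fR) : measurable Q ->
  (forall x : X, exists V : set X, [/\ open V, V x & (mu V < +oo)%E]) ->
  {ae P, forall g, leb.-negligible [set t | dom g t /\ ~ Q (g, t)]} ->
  exists Y : set (borel X), [/\ measurable Y, mu (~` Y) = 0%E &
    forall x, Y x -> exists g t, [/\ Q (g, t), dom g t & fpoint g t = x]].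
Proof.
move=> mQ loc aeQ; have [_ _ _ muE _] := albP.
pose good (n : nat) : set fX := hits (- n%:R) n%:R `&`
  [set z | Q (z.1, first_hit n%:R z)].
pose G : set fX := [set z | exists n, good n z].
have mG : measurable G.
  apply: measurable_exists => n; apply: measurableI; first exact: measurable_hits.
  have := @measurable_fun_pair _ _ _ _ _ _ fst (first_hit n%:R) measurable_fst
    (measurable_first_hit n%:R).
  by move=> /(_ measurableT Q mQ); rewrite setTI.
have [|Y [mY YG Y0]] := full_projection sepX alberti_measurable muE loc mG.
  move: aeQ; apply: filterS; first exact: (ae_filter_ringOfSetsType P).
  move=> g nQ.
  apply: (@alberti_null g [set t | dom g t /\ ~ Q (g, t)]) => //.
    by apply: measurableC; exact: measurable_xsection.
  move=> t gt nG.
  have hz : hits (- (Num.bound `|t|)%:R) (Num.bound `|t|)%:R (g, fpoint g t).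
    exists t; split => //=; rewrite -ler_norml.
    by apply/ltW/archi_boundP.
  have [/= gs abs st] := first_hitP hz.
  exists (first_hit (Num.bound `|t|)%:R (g, fpoint g t)); split => //; split => // Qs.
  apply: nG; rewrite /xsection/= inE; exists (Num.bound `|t|); split => //.
exists Y; split => // x /YG[[g y] [n [hz Qz]] /= <-].
have [/= gs _ st] := first_hitP hz.
by exists g, (first_hit n%:R (g, y)).
Qed.

End good_points.
End first_hit.

(** * Approximating directions by cones *)

Section directions.
Context {R : realType} {n : nat}.
Implicit Types u v x y : 'rV[R]_n.

Lemma dotr_ge0 x : 0 <= dot x x.
Proof. by apply: sumr_ge0 => i _; rewrite -expr2 sqr_ge0. Qed.

Lemma norm2_ge0 x : 0 <= norm2 x.
Proof. exact: sqrtr_ge0. Qed.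

Lemma sqr_norm2 x : norm2 x ^+ 2 = dot x x.
Proof. by rewrite sqr_sqrtr// dotr_ge0. Qed.

Lemma norm2_coord x i : `|x 0 i| <= norm2 x.
Proof.
rewrite -(ler_pXn2r (n := 2))// ?nnegrE ?norm2_ge0// sqr_norm2 real_normK ?num_real//.
rewrite /dot (bigD1 i)//= -expr2 lerDl sumr_ge0// => j _.
by rewrite -expr2 sqr_ge0.
Qed.

Lemma dotZl (a : R) x y : dot (a *: x) y = a * dot x y.
Proof. by rewrite /dot mulr_sumr; apply: eq_bigr => i _; rewrite mxE mulrA. Qed.

Lemma dotC x y : dot x y = dot y x.
Proof. by apply: eq_bigr => i _; rewrite mulrC. Qed.

Lemma dotDl x y v : dot (x + y) v = dot x v + dot y v.
Proof. by rewrite /dot -big_split; apply: eq_bigr => i _; rewrite mxE mulrDl. Qed.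

Lemma dotDr x y v : dot x (y + v) = dot x y + dot x v.
Proof. by rewrite dotC dotDl (dotC y) (dotC v). Qed.

Lemma dotZr (a : R) x y : dot x (a *: y) = a * dot x y.
Proof. by rewrite dotC dotZl dotC. Qed.

Lemma norm2Z (a : R) x : 0 <= a -> norm2 (a *: x) = a * norm2 x.
Proof.
move=> a0; rewrite /norm2 dotZl dotC dotZl mulrA -expr2 sqrtrM ?sqr_ge0//.
by rewrite sqrtr_sqr ger0_norm.
Qed.

Lemma norm2_eq0 x : norm2 x = 0 -> x = 0.
Proof.
move=> x0; apply/rowP => i; rewrite mxE; apply/eqP; rewrite -normr_le0 -x0.
exact: norm2_coord.
Qed.

Lemma dot_delta x j : dot x (delta_mx 0 j) = x 0 j.
Proof.
rewrite /dot (bigD1 j)//= mxE !eqxx mulr1 big1 ?addr0// => i ij.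
by rewrite mxE eqxx (negbTE ij) mulr0.
Qed.

Lemma tan_gt0_pihalf (t : R) : 0 < t < pi / 2 -> 0 < tan t.
Proof.
move=> /andP[t0 t2]; rewrite /tan divr_gt0//; last by apply: cos_gt0_pihalf; lra.
by apply: sin_gt0_pi; have := pi_gt0 R; lra.
Qed.

(** After division by [dot v x] the component along [v] is [v] itself, and what remains is the
    orthogonal part, of norm less than [tan t]. *)
Lemma cone_scale v (t : R) x : 0 < tan t -> cone v t x ->
  0 < dot v x /\ forall i, `|(dot v x)^-1 * x 0 i - v 0 i| < tan t.
Proof.
move=> t0; rewrite /cone/= => H.
have p0 : 0 < dot v x.
  by rewrite -(pmulr_rgt0 _ t0); apply: le_lt_trans H; exact: norm2_ge0.
split => // i; have := norm2_coord (x - dot v x *: v) i; rewrite !mxE => h.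
have -> : (dot v x)^-1 * x 0 i - v 0 i = (dot v x)^-1 * (x 0 i - dot v x * v 0 i).
  by field; rewrite gt_eqF.
rewrite normrM gtr0_norm ?invr_gt0// mulrC ltr_pdivrMr//.
exact: le_lt_trans h H.
Qed.

Lemma nbhs_rowP u (B : set 'rV[R]_n) : nbhs u B <->
  exists2 e : R, 0 < e & forall y, (forall i, `|u 0 i - y 0 i| < e) -> B y.
Proof.
split=> [/nbhs_ballP[e /= e0 H]|[e e0 H]].
  by exists e => // y uy; apply: H; split => // i j; rewrite ord1; exact: uy.
apply/nbhs_ballP; exists e => //= y uy; apply: H => i.
exact: (uy.2 0 i).
Qed.

(** The points are the normalisations of [u + t m e_j]. They are distinct: the nonzero coordinate
    [i] determines the norm [a m], and then coordinate [j] determines [t m]. *)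
Lemma sphere_perturb u (e : R) (i j : 'I_n) : sphere u -> i != j -> u 0 i != 0 -> 0 < e ->
  exists f : nat -> 'rV[R]_n, [/\ injective f, forall m, sphere (f m) &
    forall m l, `|u 0 l - f m 0 l| < e].
Proof.
move=> su ij ui0 e0.
(* [t m <= 1/8] keeps the norm [a m] above 1/2, and [t m <= e/8] makes the displacement, at most
   [2 * t m / a m], smaller than [e]. *)
pose t (m : nat) : R := Num.min 1 e / 8 * m.+1%:R^-1.
have m0 : 0 < Num.min 1 e by rewrite lt_min ltr01.
have t0 m : 0 < t m by rewrite mulr_gt0 ?invr_gt0// divr_gt0.
have te m : t m <= Num.min 1 e / 8.
  by apply: ler_piMr; [rewrite divr_ge0// ltW|rewrite invf_le1// ler1n].
have t1 m : t m <= 1 / 8.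
  by apply: (le_trans (te m)); rewrite ler_pM2r// ge_min lexx.
have te' m : t m <= e / 8.
  by apply: (le_trans (te m)); rewrite ler_pM2r// ge_min lexx orbT.
pose w m := u + t m *: delta_mx 0 j.
have dw m : dot (w m) (w m) = 1 + 2 * t m * u 0 j + t m ^+ 2.
  rewrite /w dotDl !dotDr !dotZl !dotZr [dot (delta_mx 0 j) u]dotC !dot_delta mxE !eqxx.
  by rewrite -sqr_norm2 su expr1n /=; ring.
have uj : `|u 0 j| <= 1 by rewrite -su; exact: norm2_coord.
pose a m := norm2 (w m).
have a2 m : a m ^+ 2 = 1 + 2 * t m * u 0 j + t m ^+ 2 by rewrite sqr_norm2 dw.
have a0 m : 0 <= a m by exact: norm2_ge0.
have a1 m : `|a m - 1| <= t m.
  have := t0 m; have := t1 m; have := a2 m; have := a0 m; move: uj; rewrite !ler_norml.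
  move=> /andP[u1 u2] am aE tm1 tm0.
  have h1 : t m * u 0 j <= t m by rewrite ler_piMr// ltW.
  have h2 : - t m <= t m * u 0 j by rewrite -mulrN1 ler_pM2l.
  by apply/andP; split; nra.
have ap m : 1 / 2 < a m.
  by have := a1 m; have := t1 m; rewrite ler_norml; lra.
have wl m l : w m 0 l = u 0 l + t m * (l == j)%:R by rewrite !mxE eqxx.
exists (fun m => (a m)^-1 *: w m); split.
- move=> m m' /rowP fE.
  have am := ap m; have am' := ap m'.
  have aa : a m = a m'.
    have := fE i; rewrite !mxE (negbTE ij) andbF mulr0n !mulr0 !addr0 => /(mulIf ui0).
    exact: invr_inj.
  have fE' : (a m)^-1 * w m 0 j = (a m')^-1 * w m' 0 j.
    by have := fE j; rewrite [LHS]mxE [RHS]mxE.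
  have an0 : (a m')^-1 != 0 by rewrite invr_eq0 gt_eqF//; lra.
  move: fE'; rewrite aa => /(mulfI an0); rewrite !wl eqxx !mulr1 => /addrI.
  rewrite /t => /mulfI; rewrite gt_eqF ?divr_gt0// => /(_ isT)/invr_inj/eqP.
  by rewrite eqr_nat => /eqP[].
- move=> m; rewrite /sphere/= norm2Z ?invr_ge0// mulVf// gt_eqF//.
  by have := ap m; lra.
- move=> m l; rewrite mxE wl.
  have am := ap m; have ul : `|u 0 l| <= 1 by rewrite -su; exact: norm2_coord.
  have an0 : a m != 0 by rewrite gt_eqF//; lra.
  have -> : u 0 l - (a m)^-1 * (u 0 l + t m * (l == j)%:R) =
      (u 0 l * (a m - 1) - t m * (l == j)%:R) / a m by field.
  rewrite normrM normfV (ger0_norm (a0 m)) ltr_pdivrMr; last by lra.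
  apply: (le_lt_trans (ler_normB _ _)); rewrite (normrM (u 0 l)) (normrM (t m)).
  have h1 : `|u 0 l| * `|a m - 1| <= 1 * t m by apply: ler_pM.
  have h2 : `|t m| * `|(l == j)%:R| <= t m.
    have tm := ltW (t0 m); rewrite (ger0_norm tm) ler_piMr//.
    by case: (l == j); rewrite ?normr1 ?normr0.
  have h3 : e / 2 < e * a m by rewrite ltr_pM2l//; lra.
  by have := te' m; lra.
Qed.

Lemma approx_direction (v : nat -> 'rV[R]_n) (theta : nat -> R) (G : set 'rV[R]_n) :
  (forall k, sphere (v k)) -> sphere `<=` closure (range v) ->
  (forall k, 0 < theta k < pi / 2) -> theta k @[k --> \oo] --> 0 ->
  (forall k, exists2 c, G c & cone (v k) (theta k) c) ->
  forall u, sphere u -> forall e, 0 < e ->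
    exists s c, [/\ 0 <= s, G c & forall i, `|s * c 0 i - u 0 i| < e].
Proof.
move=> sv cl th th0 HG u su e e0.
have conek k : exists s c, [/\ 0 <= s, G c & forall i, `|s * c 0 i - v k 0 i| < tan (theta k)].
  have [c Gc cc] := HG k; have [p0 H] := cone_scale (tan_gt0_pihalf (th k)) cc.
  by exists (dot (v k) c)^-1, c; split => //; rewrite invr_ge0 ltW.
have [[i0 ui0]|nu] := pselect (exists i, u 0 i != 0); last first.
  exfalso; have : u = 0.
    apply/rowP => i; rewrite mxE; apply/eqP; apply: contrapT => /negP ui.
    by apply: nu; exists i.
  move=> u0; move: su; rewrite /sphere/= u0 /norm2 (_ : dot 0 0 = 0) ?sqrtr0.
    by move/eqP; rewrite eq_sym oner_eq0.
  by rewrite /dot big1// => i _; rewrite mxE mul0r.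
(* In dimension at least 2 there are infinitely many points of the sphere near
   u, which makes it possible to avoid the v k with k small. In dimension 1 the
   sphere has two points, but every cone is then a half-line. *)
have [[j ij]|n1] := pselect (exists j, i0 != j).
  have [K HK] : exists K, forall k, (K <= k)%N -> tan (theta k) < e / 2.
    have : tan (theta k) @[k --> \oo] --> tan (0 : R).
      apply: continuous_cvg th0; apply: continuous_tan; rewrite cos0; exact: oner_neq0.
    rewrite tan0 => /cvgrPdist_lt/(_ (e / 2)) [|K _ HK]; first by lra.
    by exists K => k /HK; rewrite /= sub0r normrN => /(le_lt_trans (ler_norm _)).
  have [|f [finj fs fu]] := @sphere_perturb u (e / 4) _ _ su ij ui0; first by lra.
  pose A := v @` `I_K.
  have finA : finite_set A by apply: finite_image; exact: finite_II.
  have [m fm] : exists m, ~ A (f m).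
    apply: contrapT => /forallNP H; apply: infinite_nat.
    rewrite (_ : [set: nat] = f @^-1` A); last first.
      by apply/seteqP; split=> // m _; apply: contrapT; exact: H.
    by apply: finite_preimage => // ? ? _ _; exact: finj.
  have oA : nbhs (f m) (~` A).
    apply: open_nbhs_nbhs; split => //; apply: closed_openC.
    apply: (accessible_finite_set_closed.1 _ A finA).
    by apply: hausdorff_accessible; exact: norm_hausdorff.
  have nb : nbhs (f m) (~` A `&` [set y | forall i, `|f m 0 i - y 0 i| < e / 4]).
    by apply: filterI => //; apply/nbhs_rowP; exists (e / 4); first by lra.
  have [_ [[k _ <-] [nAk fk]]] := cl _ (fs m) _ nb.
  have Kk : (K <= k)%N by rewrite leqNgt; apply/negP => kK; apply: nAk; exists k.
  have [s [c [s0 Gc H]]] := conek k.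
  exists s, c; split => // i.
  have := H i; have := HK k Kk; have := fk i; have := fu m i.
  have := ler_distD (v k 0 i) (s * c 0 i) (u 0 i).
  have := ler_distD (f m 0 i) (v k 0 i) (u 0 i).
  by rewrite (distrC (v k 0 i) (f m 0 i)) (distrC (f m 0 i) (u 0 i)); lra.
have i0E i : i = i0 by apply: contrapT => ii; apply: n1; exists i; apply/eqP => i0i; apply: ii.
have d1 x y : dot x y = x 0 i0 * y 0 i0.
  by rewrite /dot (bigD1 i0)//= big1 ?addr0// => i; rewrite (i0E i) eqxx.
have nb : nbhs u [set y | forall i, `|u 0 i - y 0 i| < 1].
  by apply/nbhs_rowP; exists 1.
have [_ [[k _ <-] uk]] := cl _ su _ nb.
have vk2 : v k 0 i0 ^+ 2 = 1 by rewrite expr2 -d1 -sqr_norm2 sv expr1n.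
have u2 : u 0 i0 ^+ 2 = 1 by rewrite expr2 -d1 -sqr_norm2 su expr1n.
have vku : v k 0 i0 = u 0 i0.
  have := uk i0; rewrite /= ltr_norml => /andP[h1 h2]; apply/eqP.
  have /eqP : v k 0 i0 ^+ 2 = u 0 i0 ^+ 2 by rewrite vk2 u2.
  rewrite eqf_sqr => /orP[//|/eqP vu].
  (* If [v k] were [- u], its distance 2 to [u] would be less than 1. *)
  have : 4 * (u 0 i0 ^+ 2) < 1 by nra.
  by rewrite u2; lra.
have [c Gc cc] := HG k; have [p0 _] := cone_scale (tan_gt0_pihalf (th k)) cc.
exists (dot (v k) c)^-1, c; split; rewrite ?invr_ge0 ?ltW// => i.
rewrite (i0E i) d1 vku.
move: p0; rewrite d1 vku => p0.
have c0 : c 0 i0 != 0 by apply/eqP => c0; move: p0; rewrite c0 mulr0 ltxx.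
have -> : (u 0 i0 * c 0 i0)^-1 * c 0 i0 - u 0 i0 = (1 - u 0 i0 ^+ 2) / u 0 i0.
  by field; rewrite ui0 c0.
by rewrite u2 subrr mul0r normr0.
Qed.

End directions.

(** * First order expansions *)

Section small.
Context {R : realType} {X : metricType R}.
Implicit Types (f h : X -> R) (x : X).

Definition small_at f x := forall e : R, 0 < e ->
  \forall y \near x, `|f y - f x| <= e * mdist x y.

Lemma small_at_lin f h x (c : R) : small_at f x -> small_at h x ->
  small_at (fun y => c * f y + h y) x.
Proof.
move=> sf sh e e0.
have c0 : 0 < `|c| + 1 by rewrite ltr_wpDl.
have d0 : 0 < e / 2 / (`|c| + 1) by rewrite !divr_gt0.
have e20 : 0 < e / 2 by rewrite divr_gt0.
near=> y.
have -> : c * f y + h y - (c * f x + h x) = c * (f y - f x) + (h y - h x) by ring.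
apply: (le_trans (ler_normD _ _)); rewrite normrM.
have h1 : `|f y - f x| <= e / 2 / (`|c| + 1) * mdist x y by near: y; exact: sf.
have h2 : `|h y - h x| <= e / 2 * mdist x y by near: y; exact: sh.
have h3 : `|c| * `|f y - f x| <= (`|c| + 1) * (e / 2 / (`|c| + 1) * mdist x y).
  by apply: ler_pM => //; rewrite lerDl.
have h4 : (`|c| + 1) * (e / 2 / (`|c| + 1) * mdist x y) = e / 2 * mdist x y.
  by field; rewrite gt_eqF.
by rewrite h4 in h3; lra.
Unshelve. all: by end_near. Qed.

Lemma small_at0 x (c : R) : small_at (fun _ => c) x.
Proof.
by move=> e e0; near=> y; rewrite subrr normr0 mulr_ge0 ?mdist_ge0// ltW.
Unshelve. all: by end_near. Qed.

Lemma Lip_eq0P f x : Lip f x = 0%E <-> small_at f x.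
Proof.
split.
- move=> L0 e e0.
  have : (Lip f x < e%:E)%E by rewrite L0 lte_fin.
  rewrite /Lip /limf_esup => /ereal_inf_lt[_ [V [/= d d0 dV] <-] Ve].
  apply/nbhs_mdist; exists d => // y xyd.
  have [xy0|xy0] := eqVneq (mdist x y) 0.
    by have -> : x = y by [exact: mdist_positivity]; rewrite subrr normr0 mdistxx mulr0.
  have xyp : 0 < mdist x y by rewrite lt_def xy0 mdist_ge0.
  (* The radius [mdist x y] turns the quotient by the radius into the quotient by the distance. *)
  have Vxy : V (mdist x y).
    by apply: dV => //=; rewrite sub0r normrN ger0_norm ?mdist_ge0.
  rewrite -ler_pdivrMr// -lee_fin; apply: (le_trans _ (ltW Ve)).
  apply: (@le_trans _ _ (ereal_sup
    [set (`|f y0 - f x| / mdist x y)%:E | y0 in [set y0 | mdist x y0 <= mdist x y]])).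
    by apply: ereal_sup_ubound; exists y => /=.
  by apply: ereal_sup_ubound; exists (mdist x y).
- move=> sf; apply/eqP; rewrite eq_le; apply/andP; split.
    apply/lee_addgt0Pr => e e0; rewrite add0e.
    have /nbhs_mdist[d d0 H] := sf e e0.
    apply: (@le_trans _ _ (ereal_sup ((fun r : R =>
        ereal_sup [set (`|f y - f x| / r)%:E | y in [set y | mdist x y <= r]]) @`
      [set r | 0 < r < d]))).
      apply: ereal_inf_lbound; exists [set r | 0 < r < d] => //.
      exists d => //= r; rewrite /= sub0r normrN => rd r0.
      by rewrite r0/=; apply: le_lt_trans rd; exact: ler_norm.
    apply: ge_ereal_sup => _ [r /andP[r0 rd] <-]; apply: ge_ereal_sup => _ [y /= xy <-].
    rewrite lee_fin ler_pdivrMr//; apply: (le_trans (H y (le_lt_trans xy rd))).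
    by rewrite ler_pM2l.
  apply: le_ereal_inf_tmp => _ [V [/= d d0 dV] <-].
  (* For nonnegativity of the limit superior, any radius in [V] and the centre [x] itself contribute
     the value 0. *)
  have Vd : V (d / 2).
    apply: dV => /=; last by rewrite divr_gt0.
    by rewrite sub0r normrN gtr0_norm ?divr_gt0//; move: d0 => /=; lra.
  apply: le_trans (ereal_sup_ubound (ex_intro2 _ _ _ Vd erefl)).
  apply: ereal_sup_ubound; exists x; last by rewrite subrr normr0 mul0r.
  by rewrite /= mdistxx divr_ge0// ltW.
Qed.

Lemma differentiable_wrtP n (psi : X -> 'rV[R]_n) f x : differentiable_wrt psi f x <->
  exists A, small_at (fun y => f y - dot A (psi y)) x.
Proof.
have E A y : f y - dot A (psi y) - (f x - dot A (psi x)) = f y - f x - dot A (psi y - psi x).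
  by rewrite dotDr -(scaleN1r (psi x)) dotZr; ring.
split=> -[A H]; exists A => e /H; apply: filterS => y.
  by rewrite E.
by rewrite -E.
Qed.

Lemma small_at_dot n (F : 'I_n -> X -> R) (A : 'rV[R]_n) x : (forall i, small_at (F i) x) ->
  small_at (fun y => \sum_(i < n) A 0 i * F i y) x.
Proof.
move=> sF; elim: (index_enum _) => [|i r IH].
  by under eq_fun do rewrite big_nil; exact: small_at0.
by under eq_fun do rewrite big_cons; apply: small_at_lin.
Qed.

Lemma differentiable_wrt_trans n m (psi : X -> 'rV[R]_n) (psi' : X -> 'rV[R]_m) f x :
  (forall i, differentiable_wrt psi' (fun y => psi y 0 i) x) ->
  differentiable_wrt psi f x -> differentiable_wrt psi' f x.
Proof.
move=> H /differentiable_wrtP[A sA]; apply/differentiable_wrtP.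
have /choice[B HB] i := (differentiable_wrtP _ _ _).1 (H i).
exists (\sum_i A 0 i *: B i).
have -> : (fun y => f y - dot (\sum_i A 0 i *: B i) (psi' y)) =
  (fun y => 1 * (\sum_i A 0 i * (psi y 0 i - dot (B i) (psi' y))) + (f y - dot A (psi y))).
  apply/funext => y; rewrite mul1r.
  have -> : dot (\sum_i A 0 i *: B i) (psi' y) = \sum_i A 0 i * dot (B i) (psi' y).
    rewrite /dot; under eq_bigr do rewrite summxE mulr_suml.
    rewrite exchange_big; apply: eq_bigr => i _; rewrite mulr_sumr.
    by apply: eq_bigr => j _; rewrite mxE mulrA.
  under [in RHS]eq_bigr do rewrite mulrBr.
  by rewrite sumrB /dot; ring.
by apply: small_at_lin sA; exact: small_at_dot.
Qed.

Lemma differentiable_wrt_lin n (psi : X -> 'rV[R]_n) f h (c : R) x :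
  differentiable_wrt psi f x -> differentiable_wrt psi h x ->
  differentiable_wrt psi (fun y => c * f y + h y) x.
Proof.
move=> /differentiable_wrtP[A sA] /differentiable_wrtP[B sB]; apply/differentiable_wrtP.
exists (c *: A + B).
have -> : (fun y => c * f y + h y - dot (c *: A + B) (psi y)) =
    (fun y => c * (f y - dot A (psi y)) + (h y - dot B (psi y))).
  by apply/funext => y; rewrite dotDl dotZl; ring.
exact: small_at_lin.
Qed.

Lemma differentiable_wrt_coord n (psi : X -> 'rV[R]_n) i x :
  differentiable_wrt psi (fun y => psi y 0 i) x.
Proof.
apply/differentiable_wrtP; exists (delta_mx 0 i).
under eq_fun do rewrite dotC dot_delta subrr.
exact: small_at0.
Qed.

Lemma differentiable_wrt_dot n (psi : X -> 'rV[R]_n) A x :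
  differentiable_wrt psi (fun y => dot A (psi y)) x.
Proof.
by apply/differentiable_wrtP; exists A; under eq_fun do rewrite subrr; exact: small_at0.
Qed.

Lemma lipschitz_fun_lin f h (c : R) : lipschitz_fun f -> lipschitz_fun h ->
  lipschitz_fun (fun y => c * f y + h y).
Proof.
move=> [L HL] [M HM]; exists (`|c| * L + M) => x y.
have -> : c * f x + h x - (c * f y + h y) = c * (f x - f y) + (h x - h y) by ring.
apply: (le_trans (ler_normD _ _)); rewrite normrM mulrDl -mulrA.
by apply: lerD => //; apply: ler_wpM2l.
Qed.

Lemma lipschitz_map_coord n (psi : X -> 'rV[R]_n) i : lipschitz_map psi ->
  lipschitz_fun (fun y => psi y 0 i).
Proof.
move=> [L HL]; exists L => x y; apply: le_trans (HL x y).
by have := norm2_coord (psi x - psi y) i; rewrite !mxE.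
Qed.

Lemma lipschitz_fun_dot n (psi : X -> 'rV[R]_n) A : lipschitz_map psi ->
  lipschitz_fun (fun y => dot A (psi y)).
Proof.
move=> lp; rewrite /dot; elim: (index_enum _) => [|i r IH].
  by exists 0 => x y; rewrite !big_nil subrr normr0 mul0r.
by under eq_fun do rewrite big_cons; apply: lipschitz_fun_lin => //; exact: lipschitz_map_coord.
Qed.

End small.

Section fragment_derivatives.
Context {R : realType} {X : completeMetricType R}.
Variables (g : frag X) (t : R).
Implicit Types f h : X -> R.

Lemma fderivable_lin f h (c : R) : fderivable g f t -> fderivable g h t ->
  fderivable g (fun y => c * f y + h y) t /\
  fderive g (fun y => c * f y + h y) t = c * fderive g f t + fderive g h t.
Proof.
move=> [gt lp cf] [_ _ ch]; have PF := within_proper lp.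
have C : diff_quotient ((fun y => c * f y + h y) \o fpoint g) t s
    @[s --> within (dom g) t^'] --> c * fderive g f t + fderive g h t.
  rewrite (_ : diff_quotient _ _ = (fun s => c * diff_quotient (f \o fpoint g) t s +
    diff_quotient (h \o fpoint g) t s)).
    by apply: cvgD ch; apply: cvgM cf; exact: cvg_cst.
  by apply/funext => s; rewrite /diff_quotient/=; ring.
split; first by split => //; apply/cvg_ex; eexists; exact: C.
by apply: cvg_lim => //; exact: Rhausdorff.
Qed.

(** Along a Lipschitz curve [o(mdist)] becomes [o(|s - t|)]. Hence differentiation along a fragment
    kills the functions with [Lip f x = 0] and descends to the cotangent fibre. *)
Lemma small_fderive f : dom g t -> limit_point (dom g) t ->
  small_at f (fpoint g t) -> fderivable g f t /\ fderive g f t = 0.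
Proof.
move=> gt lp sf; have [L L0 HL] := fpoint_lipschitz g.
have H : forall e, 0 < e -> exists2 d, 0 < d & forall s, dom g s -> 0 < `|s - t| < d ->
    `|diff_quotient (f \o fpoint g) t s - 0| <= e.
  move=> e e0; have L1 : 0 < L + 1 by rewrite ltr_wpDl.
  have [d d0 Hd] := (nbhs_mdist _ _).1 (sf (e / (L + 1)) (divr_gt0 e0 L1)).
  exists (d / (L + 1)); first exact: divr_gt0.
  move=> s gs /andP[st0 std]; rewrite subr0 /diff_quotient/= normrM normfV ler_pdivrMr//.
  have h1 : mdist (fpoint g t) (fpoint g s) <= (L + 1) * `|s - t|.
    apply: (le_trans (HL _ _ gt gs)); rewrite (distrC t s).
    by rewrite ler_wpM2r// lerDl.
  have h2 : mdist (fpoint g t) (fpoint g s) < d.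
    by apply: (le_lt_trans h1); move: std; rewrite ltr_pdivlMr// mulrC.
  apply: (le_trans (Hd _ h2)); rewrite -mulrA ler_pM2l//.
  by rewrite mulrC ler_pdivrMr// mulrC.
split; last exact: derive_inE.
by apply/derivable_inP; split => //; exists 0.
Qed.

Lemma fderive_dot n (psi : X -> 'rV[R]_n) A : dom g t -> limit_point (dom g) t ->
  (forall i, fderivable g (fun y => psi y 0 i) t) ->
  fderivable g (fun y => dot A (psi y)) t /\
  fderive g (fun y => dot A (psi y)) t = dot A (\row_i fderive g (fun y => psi y 0 i) t).
Proof.
move=> gt lp H; rewrite /dot.
rewrite [RHS](_ : _ = \sum_i A 0 i * fderive g (fun y => psi y 0 i) t); last first.
  by apply: eq_bigr => i _; rewrite mxE.
elim: (index_enum _) => [|i r [IH1 IH2]].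
  by under eq_fun do rewrite big_nil; rewrite big_nil; apply: small_fderive => //; exact: small_at0.
under eq_fun do rewrite big_cons; rewrite big_cons.
by have [] := fderivable_lin (A 0 i) (H i) IH1; rewrite IH2.
Qed.

Lemma fderive_chain n (psi : X -> 'rV[R]_n) f A : dom g t -> limit_point (dom g) t ->
  (forall i, fderivable g (fun y => psi y 0 i) t) ->
  small_at (fun y => f y - dot A (psi y)) (fpoint g t) ->
  fderivable g f t /\ fderive g f t = dot A (\row_i fderive g (fun y => psi y 0 i) t).
Proof.
move=> gt lp H sA.
have [d1 d1E] := fderive_dot A gt lp H.
have [d2 d2E] := small_fderive gt lp sA.
have := fderivable_lin 1 d2 d1; rewrite d1E d2E mulr0 add0r.
by rewrite (_ : (fun y => _) = f)//; apply/funext => y; ring.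
Qed.

End fragment_derivatives.

(** * Velocities in the tangent space *)

Lemma continuous_ptws (R : realType) (T : topologicalType) (A : Type)
    (h : T -> {ptws A -> R}) :
  (forall f, continuous (fun t => h t f)) -> continuous h.
Proof.
move=> H t; apply/cvg_sup => f B [V [[W oW <-] Wt] WB].
apply: (filterS WB); apply: (H f t); exact: open_nbhs_nbhs.
Qed.

Section tangent_space.
Context {R : realType} {X : completeMetricType R}.
Context {I : countType} {N : I -> nat}.
Variables (U : I -> set X) (phi : forall a : I, X -> 'rV[R]_(N a)).
Hypothesis lphi : forall a, lipschitz_map (phi a).
Hypothesis compat : forall a b x, U a x -> U b x ->
  forall i, differentiable_wrt (phi b) (fun y => phi a y 0 i) x.

(** Compatibility of the charts carries a Taylor expansion from one chart to any other one around
    the point. *)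
Lemma diff_atE a x (f : X -> R) : U a x ->
  diff_at U phi x f <-> lipschitz_fun f /\ differentiable_wrt (phi a) f x.
Proof.
move=> ax; split=> -[fL H]; split => //; last by exists a.
by case: H => b [bx]; apply: differentiable_wrt_trans => i; exact: compat.
Qed.

Lemma diff_at_lin x f h (c : R) : diff_at U phi x f -> diff_at U phi x h ->
  diff_at U phi x (fun y => c * f y + h y).
Proof.
move=> df dh; have [fL [a [ax _]]] := df.
have [_ fx] := (diff_atE f ax).1 df; have [hL hx] := (diff_atE h ax).1 dh.
by apply/(diff_atE _ ax); split; [exact: lipschitz_fun_lin|exact: differentiable_wrt_lin].
Qed.

Lemma diff_at_coord a x i : U a x -> diff_at U phi x (fun y => phi a y 0 i).
Proof.
move=> ax; apply/(diff_atE _ ax); split; first exact: lipschitz_map_coord.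
exact: differentiable_wrt_coord.
Qed.

Lemma diff_at_dot a x A : U a x -> diff_at U phi x (fun y => dot A (phi a y)).
Proof.
move=> ax; apply/(diff_atE _ ax); split; first exact: lipschitz_fun_dot.
exact: differentiable_wrt_dot.
Qed.

(** The value 0 off [diff_at] is the normalisation imposed by [tangent]. *)
Definition velocity (g : frag X) (t : R) : {ptws (X -> R) -> R} :=
  fun f => if `[< diff_at U phi (fpoint g t) f >] then fderive g f t else 0.

Lemma velocityP (g : frag X) (t : R) : dom g t -> limit_point (dom g) t ->
  (forall b i, fderivable g (fun y => phi b y 0 i) t) ->
  is_velocity U phi g t (velocity g t).
Proof.
move=> gt lp dphi; set x := fpoint g t.
have D f : diff_at U phi x f -> fderivable g f t.
  by move=> [_ [a [ax /differentiable_wrtP[A /(fderive_chain gt lp (dphi a))[]]]]].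
split.
- rewrite /velocity; split.
  + by move=> f; case: asboolP.
  + move=> c f h df dh; have dfh := diff_at_lin c df dh.
    rewrite (asboolT df) (asboolT dh) (asboolT dfh).
    by have [_ ->] := fderivable_lin c (D _ df) (D _ dh).
  + move=> f df /Lip_eq0P sf; rewrite (asboolT df).
    by have [] := small_fderive gt lp sf.
- by move=> a ax i; rewrite /velocity (asboolT (diff_at_coord i ax)).
Qed.

Section chart_point.
Variables (a : I) (x : X).
Hypothesis ax : U a x.

(* The coefficients are unique only if the components of phi a are independent
   at x; any choice will do. *)
Definition gradient (f : X -> R) : 'rV[R]_(N a) :=
  xget 0 [set A | small_at (fun y => f y - dot A (phi a y)) x].

(** Recovers a tangent vector from its coordinates in the chart [a]. For other [c] it need not give
    an element of [tangent], but it is continuous and homogeneous in [c] throughout. *)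
Definition vector (c : 'rV[R]_(N a)) : {ptws (X -> R) -> R} :=
  fun f => if `[< diff_at U phi x f >] then dot (gradient f) c else 0.

(** Each [f] in [diff_at] is the sum of a linear combination of chart components and a function with
    zero [Lip] at [x], which [w] kills. *)
Lemma tangent_vector w : tangent U phi x w ->
  w = vector (\row_i w (fun y => phi a y 0 i)).
Proof.
move=> [w1 w2 w3]; apply/funext => f; rewrite /vector.
case: asboolP => [df|/w1//].
have [fL /differentiable_wrtP sf] := (diff_atE f ax).1 df.
have sg : small_at (fun y => f y - dot (gradient f) (phi a y)) x.
  exact: (@xgetPex _ 0 [set A | small_at (fun y => f y - dot A (phi a y)) x]).
have wdot A : w (fun y => dot A (phi a y)) = dot A (\row_i w (fun y => phi a y 0 i)).
  have c0 : diff_at U phi x (fun _ => 0).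
    have := diff_at_dot 0 ax; congr (diff_at _ _ _ _).
    by apply/funext => y; rewrite /dot big1// => i _; rewrite mxE mul0r.
  rewrite /dot.
  suff [] : diff_at U phi x (fun y => \sum_i A 0 i * phi a y 0 i) /\
    w (fun y => \sum_i A 0 i * phi a y 0 i) =
    \sum_i A 0 i * (\row_i0 w (fun y => phi a y 0 i0)) 0 i by [].
  elim: (index_enum _) => [|i r [IH1 IH2]].
    under eq_fun do rewrite big_nil; rewrite big_nil; split => //.
    by apply: w3 => //; apply/Lip_eq0P; exact: small_at0.
  under eq_fun do rewrite big_cons; rewrite big_cons mxE.
  have dc := diff_at_coord i ax.
  by split; [exact: diff_at_lin|rewrite w2// IH2].
have dg := diff_at_dot (gradient f) ax.
have dh : diff_at U phi x (fun y => f y - dot (gradient f) (phi a y)).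
  have := diff_at_lin (-1) dg df; congr (diff_at _ _ _ _).
  by apply/funext => y; ring.
have fE : f = (fun y => 1 * (f y - dot (gradient f) (phi a y)) + dot (gradient f) (phi a y)).
  by apply/funext => y; ring.
rewrite {1}fE w2// wdot w3//; last exact/Lip_eq0P.
by rewrite mulr0 add0r.
Qed.

Lemma vectorZ (s : R) c : vector (s *: c) = (fun f => s * vector c f).
Proof.
by apply/funext => f; rewrite /vector; case: asboolP => _; rewrite ?dotZr ?mulr0.
Qed.

Lemma vector_continuous : continuous vector.
Proof.
apply: continuous_ptws => f; rewrite /vector.
case: `[< _ >] => u; last exact: (@cst_continuous _ R).
rewrite /dot /continuous_at; elim: (index_enum _) => [|i r IH].
  rewrite big_nil (_ : (fun x0 => _) = cst 0); first exact: (@cst_continuous _ R).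
  by apply/funext => c; rewrite big_nil.
under eq_fun do rewrite big_cons; rewrite big_cons.
by apply: cvgD IH; apply: cvgM; [exact: (@cst_continuous _ R)|exact: coord_continuous].
Qed.

Lemma closed_tangent : closed (tangent U phi x).
Proof.
have ev (f : X -> R) : continuous (fun w : {ptws (X -> R) -> R} => w f : R).
  exact: (@proj_continuous {classic (X -> R)} (fun _ => R)).
have cl0 (F : {ptws (X -> R) -> R} -> R) : continuous F -> closed (F @^-1` [set 0]).
  move=> cF; apply: closed_comp; first by move=> w _; exact: cF.
  exact/accessible_closed_set1/hausdorff_accessible/Rhausdorff.
move=> w cw; split.
- move=> f nf; apply: (cl0 _ (ev f)); apply: closure_subset cw => z [z1 _ _].
  exact: z1.
- move=> c f h df dh; apply/eqP; rewrite -subr_eq0; apply/eqP.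
  apply: (cl0 (fun z : {ptws (X -> R) -> R} => z (fun y => c * f y + h y) - (c * z f + z h))).
    have cv z f0 : (w0 f0 : R) @[w0 --> (z : {ptws (X -> R) -> R})] --> z f0 by exact: ev.
    move=> z; apply: (@cvgB _ R^o _ (nbhs z) _ (fun w0 : {ptws (X -> R) -> R} => w0 _)
      (fun w0 => c * w0 f + w0 h)); first exact: cv.
    apply: (@cvgD _ R^o _ (nbhs z) _ (fun w0 : {ptws (X -> R) -> R} => c * w0 f)
      (fun w0 => w0 h)); last exact: cv.
    apply: (@cvgM _ _ (nbhs z) _ (fun _ => c)
      (fun w0 : {ptws (X -> R) -> R} => w0 f)); [exact: cvg_cst|exact: cv].
  by apply: closure_subset cw => z [_ z2 _]; rewrite /= z2// subrr.
- move=> f df L0; apply: (cl0 _ (ev f)); apply: closure_subset cw => z [_ _ z3].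
  exact: z3.
Qed.

Lemma tangent_rays G : G `<=` tangent U phi x -> rays G `<=` tangent U phi x.
Proof.
move=> GT _ [s [s0 [w /GT[w1 w2 w3] ->]]]; split.
- by move=> f /w1 ->; rewrite mulr0.
- by move=> c f h df dh; rewrite w2//; ring.
- by move=> f df L0; rewrite w3// mulr0.
Qed.

(** Since [vector] is continuous, a neighbourhood of a tangent vector contains the images of all
    coordinates within some [e] of its own; this reduces density to an approximation in the
    coordinate space. *)
Lemma closure_rays (G : set {ptws (X -> R) -> R}) (v : nat -> 'rV[R]_(N a)) (theta : nat -> R) :
  (forall k, sphere (v k)) -> sphere `<=` closure (range v) ->
  (forall k, 0 < theta k < pi / 2) -> theta k @[k --> \oo] --> 0 ->
  G `<=` tangent U phi x ->
  (forall k, exists2 w, G w &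
    cone (v k) (theta k) (\row_i w (fun y => phi a y 0 i))) ->
  closure (rays G) = tangent U phi x.
Proof.
move=> vs vd th th0 GT HG; apply/seteqP; split=> w.
  by move=> /(closure_subset (tangent_rays GT)); exact: closed_tangent.
move=> Tw B; rewrite (tangent_vector Tw); set u := \row_i _ => nB.
have /nbhs_rowP[e e0 He] := vector_continuous nB.
(* The zero vector has no direction; it is on the ray through any element of [G], with factor 0. *)
have [u0|u0] := eqVneq (norm2 u) 0.
  have [z Gz _] := HG 0%N; exists (fun f => 0 * z f); split; first by exists 0; split => //; exists z.
  rewrite (_ : (fun f => _) = vector u); first exact: nbhs_singleton.
  rewrite (_ : u = 0 *: u) ?vectorZ; last by rewrite scale0r; exact: norm2_eq0.
  by apply/funext => f; rewrite !mul0r.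
have up : 0 < norm2 u by rewrite lt_def u0 norm2_ge0.
have su : sphere ((norm2 u)^-1 *: u) by rewrite /sphere/= norm2Z ?invr_ge0 ?ltW// mulVf.
have HG' k : exists2 c, [set c | exists2 z, G z & c = \row_i z (fun y => phi a y 0 i)] c &
    cone (v k) (theta k) c.
  by have [z Gz cz] := HG k; eexists; last exact: cz; exists z.
(* The direction is approximated within [e / norm2 u], since scaling back to [u] multiplies the
   error by [norm2 u]. *)
have [s [_ [s0 [z Gz ->] sz]]] := approx_direction vs vd th th0 HG' su (divr_gt0 e0 up).
set c := \row_i _ in sz.
exists (vector ((norm2 u * s) *: c)); split.
  exists (norm2 u * s); split; first by rewrite mulr_ge0// ltW.
  by exists z => //; rewrite vectorZ -(tangent_vector (GT _ Gz)).
apply: He => i; have := sz i; rewrite !mxE ltr_pdivlMr//.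
rewrite -[X in _ * X](gtr0_norm up) -normrM distrC.
by congr (`|_| < _); field.
Qed.

End chart_point.
End tangent_space.

(** * The set of full measure *)

Section cone_direction.
Context {R : realType} {X : completeMetricType R}.
Variable d : nat -> X.
Hypothesis dP : forall x (e : R), 0 < e -> exists i, mdist x (d i) < e.
Local Notation fR := (borel (frag X) * R)%type.

Lemma measurable_direction (V : set X) n (psi : X -> 'rV[R]_n) (v : 'rV[R]_n) (theta : R) :
  measurable (V : set (borel X)) -> lipschitz_map psi ->
  measurable [set z : fR | dom z.1 z.2 -> V (fpoint z.1 z.2) ->
    (forall i, fderivable z.1 (fun x => psi x 0 i) z.2) /\
    cone v theta (\row_i fderive z.1 (fun x => psi x 0 i) z.2)].
Proof.
move=> mV lpsi.
pose E := [set z : fR | forall i, fderivable z.1 (fun x => psi x 0 i) z.2].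
pose u (z : fR) : 'rV[R]_n := \row_i fderive z.1 (fun x => psi x 0 i) z.2.
have mE : measurable E.
  by apply: measurable_forall => i; apply: (measurable_fderivable dP); exact: lipschitz_map_coord.
have mu i : measurable_fun E (fun z => u z 0 i).
  under eq_fun do rewrite mxE.
  apply: (@measurable_funS _ _ _ _ [set z : fR | fderivable z.1 (fun x => psi x 0 i) z.2]).
  - by apply: (measurable_fderivable dP); exact: lipschitz_map_coord.
  - by move=> z; apply.
  - by apply: (measurable_fun_fderive dP); exact: lipschitz_map_coord.
have mdot : measurable_fun E (fun z => dot v (u z)).
  by apply: measurable_sum => i; apply: measurable_funM.
have mnorm : measurable_fun E (fun z => norm2 (u z - dot v (u z) *: v)).
  apply: (@measurableT_comp _ _ _ _ _ _ (@Num.sqrt R)).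
    by apply: continuous_measurable_fun; exact: sqrt_continuous.
  apply: measurable_sum => i.
  rewrite (_ : (fun z => _) = (fun z => (u z 0 i - dot v (u z) * v 0 i) *
    (u z 0 i - dot v (u z) * v 0 i))); last by apply/funext => z; rewrite !mxE.
  by apply: measurable_funM; apply: measurable_funB => //; apply: measurable_funM.
have mc : measurable (E `&` [set z | cone v theta (u z)]).
  have := @measurable_fun_ltr _ _ _ E _ (fun z => tan theta * dot v (u z)) mnorm.
  by move=> /(_ _ mE [set true]); apply => //; apply: measurable_funM.
have := measurable_impl (measurable_dom_fpoint dP mV) mc.
rewrite (_ : [set z : fR | _ -> _] = [set z : fR | dom z.1 z.2 -> V (fpoint z.1 z.2) ->
    (forall i, fderivable z.1 (fun x => psi x 0 i) z.2) /\
    cone v theta (\row_i fderive z.1 (fun x => psi x 0 i) z.2)])//.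
by apply/seteqP; split=> z H; [move=> z1 z2; exact: H|case; exact: H].
Qed.

End cone_direction.

Theorem theorem5p3 (R : realType) (X : completeMetricType R)
    (mu : {measure set (borel X) -> \bar R})
    (I : countType) (N : I -> nat) (U : I -> set X)
    (phi : forall a : I, X -> 'rV[R]_(N a))
    (v : forall a : I, nat -> 'rV[R]_(N a)) (theta : I -> nat -> R)
    (P : nat -> {measure set (borel (frag X)) -> \bar R})
    (nu : nat -> frag X -> {measure set (borel X) -> \bar R})
    (Gamma0 : set (borel (frag X)))
    (F C : set (X -> R)) (S : set (X -> X -> R)) (D : set X) :
  separable X ->
  radon mu ->
  atlas mu U phi ->
  (forall a k, sphere (v a k)) ->
  (forall a, sphere `<=` closure (range (v a))) ->
  (forall a k, 0 < theta a k < pi / 2) ->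
  (forall a, theta a k @[k --> \oo] --> 0) ->
  (forall k, alberti mu (P k) (nu k)) ->
  (forall a k, in_direction (P k) (U a) (phi a) (cone (v a k) (theta a k))) ->
  measurable Gamma0 ->
  (forall k, P k (~` Gamma0) = 0%E) ->
  generic_data F C S D U phi ->
  exists Y : set (borel X),
    [/\ completed_algebra_gen mu Y, mu.-negligible (~` Y) &
        forall x, Y x ->
          closure (rays (generic_velocities F C S D U phi Gamma0 x)) =
          tangent U phi x].
Proof.
move=> sepX [locfin _] [charts fullU compat] vs vd th th0 alb dir mG G0 data.
have [d dP] := dense_seq sepX.
have mU a : measurable (U a : set (borel X)) by have [_ []] := charts a.
have lphi a : lipschitz_map (phi a) by have [] := charts a.
have Fphi a i : F (fun x => phi a x 0 i) by have [[_ [_ H]] _ _ _] := data; exact: H.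
have [Qg [mQg QgP nQg]] := thick_generic dP data.
(* All charts are treated at once, so that one set [Q k] serves at every point, whichever chart
   contains it. *)
pose dirs k (z : borel (frag X) * R) := forall a, dom z.1 z.2 -> U a (fpoint z.1 z.2) ->
  (forall i, fderivable z.1 (fun x => phi a x 0 i) z.2) /\
  cone (v a k) (theta a k) (\row_i fderive z.1 (fun x => phi a x 0 i) z.2).
pose Q k := Qg `&` [set z | Gamma0 z.1] `&` [set z | dirs k z].
have mQ k : measurable (Q k).
  apply: measurableI; first by apply: measurableI => //; exact: measurable_preimage_fst.
  by apply: measurable_forall => a; exact: (measurable_direction dP).
have aeQ k : {ae P k, forall g,
    (@lebesgue_measure R).-negligible [set t | dom g t /\ ~ Q k (g, t)]}.
  have ae1 : {ae P k, forall g, Gamma0 g}.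
    exists (~` Gamma0); split => //; exact: measurableC.
  have ae2 := ae_forall_countable (fun a => dir a k).
  apply: negligibleS (negligibleU ae1 ae2) => g /= ng.
  apply: contrapT => /not_orP[/contrapT Gg /contrapT/ae_forall_countable dg]; apply: ng.
  apply: negligibleS (negligibleU (nQg g) dg) => t [gt nQ] /=.
  have [q|nq] := pselect (Qg (g, t)); last by left.
  by right => H; apply: nQ; split => // a; exact: H.
have /choice[Y HY] k := good_points dP sepX (alb k) (mQ k) locfin (aeQ k).
pose Z : set (borel X) := [set x | forall k, Y k x] `&` [set x | exists a, U a x].
have mZ : measurable Z.
  apply: measurableI; first by apply: measurable_forall => k; have [] := HY k.
  exact: measurable_exists.
exists Z; split.
(* [Z] is Borel, so in the completion it is itself with an empty negligible part. *)
- by exists Z => //; exists set0; [exact: negligible_set0|rewrite setU0].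
- have : mu.-negligible (\bigcup_k ~` Y k `|` ~` \bigcup_a U a).
    apply: negligibleU.
      apply: negligible_bigcup => k; have [mY Y0 _] := HY k.
      by exists (~` Y k); split => //; exact: measurableC.
    exists (~` \bigcup_a U a); split => //; apply: measurableC.
    exact: countable_bigcupT_measurable.
  apply: negligibleS => x /= /not_andP[/existsNP[k nY]|nU]; first by left; exists k.
  by right => -[a _ ax]; apply: nU; exists a.
- move=> x [Yx [a ax]].
  apply: (closure_rays lphi compat ax (vs a) (vd a) (th a) (th0 a)).
    by move=> w [g [t [_ _ <- _ []]]].
  move=> k; have [_ _ /(_ x (Yx k))[g [t [[[Qgt Gg] dirgt] gt gx]]]] := HY k.
  have gen := QgP _ _ Qgt; have [[_ dens] Fgt _ _ _] := gen.
  have vel : is_velocity U phi g t (velocity U phi g t).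
    apply: velocityP => //; first exact: density_limit_point.
    by move=> b i; have [] := Fgt _ (Fphi b i).
  exists (velocity U phi g t); first by exists g, t; split => //; exists a.
  rewrite -gx in ax; have [_] := dirgt a gt ax.
  by congr (cone _ _ _); apply/rowP => i; rewrite !mxE; case: vel => _ ->.
Qed.
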